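(* (1) $Q_5^{(3)} = Q_5^{(2)} + R\, s_4 x y s_4 x s_4$. (2) $Q_5^{(3)} = Q_5^{(2)} + R\, s_4 w_- s_4w_- s_4 = Q_5^{(2)}+ R\, s_4^{-1}w_+s_4^{-1}w_+s_4^{-1}$. (3) Modulo $Q_5^{(2)}$, for all $\lambda\in Q_4$, $$\lambda\, s_4 w_- s_4w_- s_4 \equiv s_4 w_- s_4w_- s_4\,\lambda \equiv \varepsilon(\lambda)\, s_4 w_- s_4w_- s_4,$$ $$\lambda\, s_4^{-1}w_+s_4^{-1}w_+s_4^{-1} \equiv s_4^{-1}w_+s_4^{-1}w_+s_4^{-1}\,\lambda \equiv \varepsilon(\lambda)\, s_4^{-1}w_+s_4^{-1}w_+s_4^{-1}.$$
   Context: $R=\mathbb{Z}[a^{\pm1},b^{\pm1},c^{\pm1}]$. $B_n$ is the braid group with Artin generators $s_1,\dots,s_{n-1}$. For $n\ge 3$, $Q_n$ is the quotient of $RB_n$ by the relations $(s_1-a)(s_1-b)(s_1-c)=0$ and $$s_1^{-1}s_2s_1 = s_1 s_2 s_1^{-1} - a^{-1} s_1 s_2 + a s_1 s_2^{-1} + a s_1^{-1}s_2 - a^3 s_1^{-1} s_2^{-1}+ a^{-1} s_2 s_1 - a s_2 s_1^{-1} - a s_2^{-1} s_1 + a^3 s_2^{-1}s_1^{-1} + a^2 s_1^{-1} s_2^{-1} s_1- a^2 s_1 s_2^{-1} s_1^{-1}.$$ $Q_5$ is regarded as a $Q_4$-bimodule via the natural morphism $Q_4\to Q_5$. $u_4=R+Rs_4+Rs_4^{-1}\subset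 Q_5$; $Q_5^{(k)} = Q_4u_4Q_4\cdots u_4Q_4$ with $k+1$ factors $Q_4$ ($R$-span of products of elements, using the image of $Q_4$ in $Q_5$). $x = s_3s_2^{-1}s_3$, $y = s_1s_2^{-1}s_1$, $w_+ = s_3 s_2 s_1^{-1} s_2 s_3$, $w_- = s_3^{-1} s_2^{-1} s_1 s_2^{-1} s_3^{-1}$. $\varepsilon : Q_4 \to R$ is the $R$-algebra morphism induced by $s_i \mapsto a$. *)

(* Defs.v *)
From HB Require Import structures.
From mathcomp Require Import all_boot all_order all_algebra.
From mathcomp Require Import finmap.
From mathcomp Require Import ring monalg.
From mathcomp Require Import boolp classical_sets.

Set Implicit Arguments.
Unset Strict Implicit.
Unset Printing Implicit Defensive.

Import GRing.Theory.
Local Open Scope ring_scope.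
Local Open Scope quotient_scope.

(* [{malg K[G]}] is the free K-module on the set G, with basis [<< g >>]; the
   ring structure of monalg is not available for it, because it asks for a
   monoid without nontrivial units. The operations are locked because
   unification otherwise unfolds those of monalg without end. *)
Definition grpalg (K : comNzRingType) (G : groupType) : Type := {malg K[G]}.

HB.lock Definition grp_zero (K : comNzRingType) (G : groupType) : grpalg K G :=
  (0 : {malg K[G]}).
HB.lock Definition grp_opp (K : comNzRingType) (G : groupType)
  (x : grpalg K G) : grpalg K G := - (x : {malg K[G]}).
HB.lock Definition grp_add (K : comNzRingType) (G : groupType)
  (x y : grpalg K G) : grpalg K G := (x : {malg K[G]}) + y.
HB.lock Definition grp_scale (K : comNzRingType) (G : groupType)
  (c : K) (x : grpalg K G) : grpalg K G := c *: (x : {malg K[G]}).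
HB.lock Definition basis (K : comNzRingType) (G : groupType)
  (g : G) : grpalg K G := << g >>.

Section GroupModule.
Variables (K : comNzRingType) (G : groupType).
Implicit Types (x y z : grpalg K G) (c d : K).

HB.instance Definition _ := Choice.copy (grpalg K G) {malg K[G]}.

Fact grp_addA : associative (@grp_add K G).
Proof. by move=> x y z; rewrite !grp_add.unlock; apply: addrA. Qed.
Fact grp_addC : commutative (@grp_add K G).
Proof. by move=> x y; rewrite !grp_add.unlock; apply: addrC. Qed.
Fact grp_add0 : left_id (grp_zero K G) (@grp_add K G).
Proof. by move=> x; rewrite grp_add.unlock grp_zero.unlock; apply: add0r. Qed.
Fact grp_addN : left_inverse (grp_zero K G) (@grp_opp K G) (@grp_add K G).
Proof.
by move=> x; rewrite grp_add.unlock grp_zero.unlock grp_opp.unlock; apply: addNr.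
Qed.

HB.instance Definition _ := GRing.isZmodule.Build (grpalg K G)
  grp_addA grp_addC grp_add0 grp_addN.

Fact grp_scaleA c d x : grp_scale c (grp_scale d x) = grp_scale (c * d) x.
Proof. by rewrite !grp_scale.unlock; apply: scalerA. Qed.
Fact grp_scale1 : left_id 1 (@grp_scale K G).
Proof. by move=> x; rewrite grp_scale.unlock; apply: scale1r. Qed.
Fact grp_scaleDr : right_distributive (@grp_scale K G) +%R.
Proof.
move=> c x y; rewrite -[(_ + _ : grpalg K G)]/(grp_add _ _).
rewrite -[RHS]/(grp_add _ _) !grp_scale.unlock !grp_add.unlock.
exact: scalerDr.
Qed.
Fact grp_scaleDl x : {morph (@grp_scale K G)^~ x : c d / c + d}.
Proof.
move=> c d; rewrite -[RHS]/(grp_add _ _) !grp_scale.unlock grp_add.unlock.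
exact: scalerDl.
Qed.

HB.instance Definition _ := GRing.Zmodule_isLmodule.Build K (grpalg K G)
  grp_scaleA grp_scale1 grp_scaleDr grp_scaleDl.

Definition gcoef (g : G) (x : grpalg K G) : K := mcoeff g x.

Lemma gcoefP x y : (forall g, gcoef g x = gcoef g y) -> x = y.
Proof. by move=> exy; apply/(@malgP G K). Qed.
Lemma gcoef0 g : gcoef g 0 = 0.
Proof.
by rewrite -[0 : grpalg K G]/(grp_zero K G) grp_zero.unlock; apply: mcoeff0.
Qed.
Lemma gcoefD g x y : gcoef g (x + y) = gcoef g x + gcoef g y.
Proof. by rewrite -[x + y]/(grp_add _ _) grp_add.unlock; apply: mcoeffD. Qed.
Lemma gcoefZ g c x : gcoef g (c *: x) = c * gcoef g x.
Proof. by rewrite -[c *: x]/(grp_scale _ _) grp_scale.unlock; apply: mcoeffZ. Qed.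
Lemma gcoef_basis g h : gcoef g (basis K h) = (h == g)%:R.
Proof. by rewrite basis.unlock; apply: mcoeffU. Qed.

Definition gsupp x : {fset G} := msupp x.

Lemma gcoef_outdom x g : g \notin gsupp x -> gcoef g x = 0.
Proof. exact: mcoeff_outdom. Qed.
Lemma gsupp_basis g : gsupp (basis K g) = [fset g]%fset.
Proof. by rewrite basis.unlock /gsupp msuppU oner_eq0. Qed.

End GroupModule.

Section LinearExtension.
Variables (K : comNzRingType) (G : groupType).
Local Notation basis := (@basis K G).

Definition linext (V : lmodType K) (f : G -> V) (x : grpalg K G) : V :=
  \sum_(g <- gsupp x) gcoef g x *: f g.

Lemma linextEw (V : lmodType K) (f : G -> V) (x : grpalg K G) (d : {fset G}) :
  (gsupp x `<=` d)%fset -> linext f x = \sum_(g <- d) gcoef g x *: f g.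
Proof.
move=> le_d; rewrite /linext (big_fset_incl _ le_d) //= => g _.
by move/gcoef_outdom->; rewrite scale0r.
Qed.

Lemma linext_linear (V : lmodType K) (f : G -> V) : linear (linext f).
Proof.
move=> c x y; pose d := (gsupp x `|` gsupp y `|` gsupp (c *: x + y)%R)%fset.
have sx : (gsupp x `<=` d)%fset by rewrite /d -fsetUA fsubsetUl.
have sy : (gsupp y `<=` d)%fset by rewrite /d fsetUAC fsubsetUr.
have sz : (gsupp (c *: x + y)%R `<=` d)%fset by rewrite /d fsubsetUr.
rewrite (linextEw f sx) (linextEw f sy) (linextEw f sz).
rewrite scaler_sumr -big_split /=; apply: eq_bigr => g _.
by rewrite gcoefD gcoefZ scalerDl scalerA.
Qed.

HB.instance Definition _ (V : lmodType K) (f : G -> V) :=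
  GRing.isLinear.Build K (grpalg K G) V *:%R (linext f) (@linext_linear V f).

Lemma linext_basis (V : lmodType K) (f : G -> V) g : linext f (basis g) = f g.
Proof. by rewrite /linext gsupp_basis big_seq_fset1 gcoef_basis eqxx scale1r. Qed.

Lemma grpalgE (x : grpalg K G) : x = linext basis x.
Proof.
apply: gcoefP => h; rewrite /linext.
rewrite (big_morph (gcoef h) (gcoefD h) (gcoef0 _ h)).
under eq_bigr => g _ do rewrite gcoefZ gcoef_basis.
have [hx|hx] := boolP (h \in gsupp x).
  rewrite (big_fsetD1 h) //= eqxx mulr1 big1_fset ?addr0 // => g.
  by rewrite in_fsetD1 => /andP[/negPf-> _] _; rewrite mulr0.
rewrite (gcoef_outdom hx) big1_fset // => g gx _.
by case: eqP hx => [<-|_ _]; rewrite ?gx ?mulr0.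
Qed.

Lemma grpalg_ind (P : grpalg K G -> Prop) :
    P 0 -> (forall x y, P x -> P y -> P (x + y)) ->
    (forall c x, P x -> P (c *: x)) -> (forall g, P (basis g)) ->
  forall x, P x.
Proof.
move=> P0 PD PZ Pb x; rewrite [x]grpalgE.
by apply: (big_ind P) => // g _; apply/PZ/Pb.
Qed.

Definition grpalg_mul : grpalg K G -> grpalg K G -> grpalg K G :=
  locked (fun x y => linext (fun g => linext (fun h => basis (g * h)%g) y) x).

Lemma grpalg_mulDl : left_distributive grpalg_mul +%R.
Proof. by move=> x y z; rewrite /grpalg_mul -lock linearD. Qed.

Lemma grpalg_mulZl c x y : grpalg_mul (c *: x) y = c *: grpalg_mul x y.
Proof. by rewrite /grpalg_mul -lock linearZ. Qed.

Lemma grpalg_mul0l x : grpalg_mul 0 x = 0.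
Proof. by rewrite /grpalg_mul -lock linear0. Qed.

Lemma grpalg_mulbl g y :
  grpalg_mul (basis g) y = linext (fun h => basis (g * h)%g) y.
Proof. by rewrite /grpalg_mul -lock linext_basis. Qed.

Lemma grpalg_mulbb g h : grpalg_mul (basis g) (basis h) = basis (g * h)%g.
Proof. by rewrite grpalg_mulbl linext_basis. Qed.

Lemma grpalg_mulDr : right_distributive grpalg_mul +%R.
Proof.
move=> x y z; elim/grpalg_ind: x => [|x1 x2 IH1 IH2|c x IH|g].
- by rewrite !grpalg_mul0l addr0.
- by rewrite !grpalg_mulDl IH1 IH2 addrACA.
- by rewrite !grpalg_mulZl IH scalerDr.
- by rewrite !grpalg_mulbl linearD.
Qed.

Lemma grpalg_mulZr c x y : grpalg_mul x (c *: y) = c *: grpalg_mul x y.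
Proof.
elim/grpalg_ind: x => [|x1 x2 IH1 IH2|d x IH|g].
- by rewrite !grpalg_mul0l scaler0.
- by rewrite !grpalg_mulDl IH1 IH2 scalerDr.
- by rewrite !grpalg_mulZl IH !scalerA mulrC.
- by rewrite !grpalg_mulbl linearZ.
Qed.

Lemma grpalg_mul0r x : grpalg_mul x 0 = 0.
Proof. by rewrite -(scale0r (0 : grpalg K G)) grpalg_mulZr !scale0r. Qed.

Lemma grpalg_mulA : associative grpalg_mul.
Proof.
move=> x y z; elim/grpalg_ind: x => [|x1 x2 IH1 IH2|d x IH|g].
- by rewrite !grpalg_mul0l.
- by rewrite !grpalg_mulDl IH1 IH2.
- by rewrite !grpalg_mulZl IH.
elim/grpalg_ind: y => [|x1 x2 IH1 IH2|d x IH|h].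
- by rewrite !(grpalg_mul0l, grpalg_mul0r).
- by rewrite !(grpalg_mulDl, grpalg_mulDr) IH1 IH2.
- by rewrite !(grpalg_mulZl, grpalg_mulZr) IH.
elim/grpalg_ind: z => [|x1 x2 IH1 IH2|d x IH|k].
- by rewrite !(grpalg_mul0l, grpalg_mul0r).
- by rewrite !grpalg_mulDr IH1 IH2.
- by rewrite !grpalg_mulZr IH.
- by rewrite !grpalg_mulbb mulgA.
Qed.

Lemma grpalg_mul1l : left_id (basis 1%g) grpalg_mul.
Proof.
move=> x; rewrite grpalg_mulbl; elim/grpalg_ind: x => [|x1 x2 IH1 IH2|d x IH|g].
- by rewrite linear0.
- by rewrite linearD /= IH1 IH2.
- by rewrite linearZ /= IH.
- by rewrite linext_basis mul1g.
Qed.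

Lemma grpalg_mul1r : right_id (basis 1%g) grpalg_mul.
Proof.
move=> x; elim/grpalg_ind: x => [|x1 x2 IH1 IH2|d x IH|g].
- by rewrite grpalg_mul0l.
- by rewrite grpalg_mulDl IH1 IH2.
- by rewrite grpalg_mulZl IH.
- by rewrite grpalg_mulbb mulg1.
Qed.

Lemma grpalg_one_neq0 : basis 1%g != 0.
Proof.
apply/eqP => /(congr1 (gcoef 1%g)) /eqP.
by rewrite gcoef_basis gcoef0 eqxx oner_eq0.
Qed.

HB.instance Definition _ := GRing.Zmodule_isNzRing.Build (grpalg K G)
  grpalg_mulA grpalg_mul1l grpalg_mul1r grpalg_mulDl grpalg_mulDr
  grpalg_one_neq0.

HB.instance Definition _ := GRing.Lmodule_isLalgebra.Build K (grpalg K G)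
  (fun c x y => esym (grpalg_mulZl c x y)).

HB.instance Definition _ := GRing.Lalgebra_isAlgebra.Build K (grpalg K G)
  (fun c x y => esym (grpalg_mulZr c x y)).

Lemma basisM g h : basis (g * h)%g = basis g * basis h.
Proof. by rewrite -[RHS]/(grpalg_mul _ _) grpalg_mulbb. Qed.

Lemma basis1 : basis 1%g = 1. Proof. by []. Qed.

Lemma linext_monoid_morphism (A : algType K) (f : G -> A) :
    f 1%g = 1 -> (forall g h, f (g * h)%g = f g * f h) ->
  monoid_morphism (linext f).
Proof.
move=> f1 fM; split=> [|x y]; first by rewrite linext_basis.
elim/grpalg_ind: x => [|x1 x2 IH1 IH2|d x IH|g].
- by rewrite mul0r linear0 mul0r.
- by rewrite mulrDl !linearD /= mulrDl IH1 IH2.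
- by rewrite -scalerAl !linearZ /= IH scalerAl.
elim/grpalg_ind: y => [|x1 x2 IH1 IH2|d x IH|h].
- by rewrite mulr0 linear0 mulr0.
- by rewrite mulrDr !linearD /= mulrDr IH1 IH2.
- by rewrite -scalerAr !linearZ /= IH scalerAr.
- by rewrite -basisM !linext_basis fM.
Qed.

End LinearExtension.

(* Z[a^+-1, b^+-1, c^+-1] is the group ring over Z of the multiplicative group
   of monomials a^i b^j c^k, encoded as (i, j, k). *)

Definition monomials : Type := (int * int * int)%type.

HB.instance Definition _ := Choice.copy monomials (int * int * int)%type.

Section Monomials.
Implicit Types u v : monomials.
Let mone : monomials := (0, 0, 0).
Let mmul u v : monomials := (u.1.1 + v.1.1, u.1.2 + v.1.2, u.2 + v.2).
Let minv u : monomials := (- u.1.1, - u.1.2, - u.2).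

Fact mmulA : associative mmul.
Proof. by move=> u v w; rewrite /mmul /= !addrA. Qed.
Fact mmul1l : left_id mone mmul.
Proof. by case=> [[i j] k]; rewrite /mmul /= !add0r. Qed.
Fact mmul1r : right_id mone mmul.
Proof. by case=> [[i j] k]; rewrite /mmul /= !addr0. Qed.
Fact mmulVl : left_inverse mone minv mmul.
Proof. by case=> [[i j] k]; rewrite /mmul /minv /= !addNr. Qed.
Fact mmulVr : right_inverse mone minv mmul.
Proof. by case=> [[i j] k]; rewrite /mmul /minv /= !addrN. Qed.

Fact mmulC : commutative mmul.
Proof.
move=> [[i j] k] [[i' j'] k']; rewrite /mmul /=.
by rewrite (addrC i) (addrC j) (addrC k).
Qed.

HB.instance Definition _ :=
  isGroup.Build monomials mmulA mmul1l mmul1r mmulVl mmulVr.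

Fact monomials_mulC u v : (u * v = v * u)%g.
Proof. exact: mmulC. Qed.
End Monomials.

Definition laurent : Type := grpalg int monomials.

HB.instance Definition _ := GRing.NzRing.copy laurent (grpalg int monomials).

Fact laurent_mulC : @commutative laurent laurent *%R.
Proof.
move=> x y; elim/grpalg_ind: x => [|x1 x2 IH1 IH2|d x IH|g].
- by rewrite mul0r mulr0.
- by rewrite mulrDl mulrDr IH1 IH2.
- by rewrite -[LHS]scalerAl -[RHS]scalerAr IH.
elim/grpalg_ind: y => [|x1 x2 IH1 IH2|d x IH|h].
- by rewrite mul0r mulr0.
- by rewrite mulrDl mulrDr IH1 IH2.
- by rewrite -[RHS]scalerAl -[LHS]scalerAr IH.
- by rewrite -[LHS]basisM -[RHS]basisM monomials_mulC.
Qed.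

HB.instance Definition _ :=
  GRing.PzRing_hasCommutativeMul.Build laurent laurent_mulC.

Definition la : laurent := basis int ((1, 0, 0) : monomials).
Definition lb : laurent := basis int ((0, 1, 0) : monomials).
Definition lc : laurent := basis int ((0, 0, 1) : monomials).
Definition laV : laurent := basis int ((-1, 0, 0) : monomials).

Lemma laK : la * laV = 1. Proof. by rewrite -[LHS]/((la : grpalg int monomials) * laV) -basisM. Qed.

(* The letter (i, e) with i : 'I_n.-1 is the Artin generator s_(i+1) when e is
   true, and its inverse when e is false. *)
Definition braid_word (n : nat) : Type := seq ('I_n.-1 * bool).

Inductive braid_eq (n : nat) : braid_word n -> braid_word n -> Prop :=
| BraidRefl u : braid_eq u u
| BraidSym u v : braid_eq u v -> braid_eq v u
| BraidTrans v u w : braid_eq u v -> braid_eq v w -> braid_eq u w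
| BraidCat u v u' v' : braid_eq u v -> braid_eq u' v' ->
    braid_eq (u ++ u') (v ++ v')
| BraidInv i e : braid_eq [:: (i, e); (i, ~~ e)] [::]
| BraidFar (i j : 'I_n.-1) : (i.+1 < j)%N ->
    braid_eq [:: (i, true); (j, true)] [:: (j, true); (i, true)]
| BraidNear (i j : 'I_n.-1) : j = i.+1 :> nat ->
    braid_eq [:: (i, true); (j, true); (i, true)]
             [:: (j, true); (i, true); (j, true)].

Section BraidGroup.
Variable n : nat.
Implicit Types u v w : braid_word n.

HB.instance Definition _ := Choice.copy (braid_word n) (seq ('I_n.-1 * bool)).

Definition braid_rel u v : bool := `[< braid_eq u v >].

Fact braid_rel_equiv : equiv_class_of braid_rel.
Proof.
split=> [u|u v|v u w]; first exact/asboolP/BraidRefl.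
  by apply/asboolP/asboolP; apply: BraidSym.
by move=> /asboolP uv /asboolP vw; apply/asboolP/(BraidTrans uv vw).
Qed.

Canonical braid_equiv := EquivRelPack braid_rel_equiv.

Definition braid : Type := {eq_quot braid_rel}.

HB.instance Definition _ := Choice.on braid.
HB.instance Definition _ : EqQuotient _ braid_rel braid := EqQuotient.on braid.

Definition braid_of u : braid := \pi_braid u.

Lemma braid_ofP u v : braid_of u = braid_of v <-> braid_eq u v.
Proof.
rewrite /braid_of; split=> [/eqP|uv]; first by rewrite eqmodE => /asboolP.
by apply/eqP; rewrite eqmodE; apply/asboolP.
Qed.

Lemma braid_repr u : braid_eq (repr (braid_of u)) u.
Proof. by apply/braid_ofP; rewrite /braid_of reprK. Qed.

Lemma braid_ofK (g : braid) : braid_of (repr g) = g.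
Proof. exact: reprK. Qed.

Definition braid_winv u : braid_word n := rev [seq (x.1, ~~ x.2) | x <- u].

Fact braid_winvl u : braid_eq (braid_winv u ++ u) [::].
Proof.
elim: u => [|[i e] u IH]; first exact: BraidRefl.
rewrite /braid_winv /= rev_cons cat_rcons -/(braid_winv u).
apply: BraidTrans IH; apply: BraidCat; first exact: BraidRefl.
rewrite -{2}[u]cat0s -[_ :: _ :: u]/([:: (i, ~~ e); (i, e)] ++ u).
by apply: BraidCat; [have := BraidInv i (~~ e); rewrite negbK | exact: BraidRefl].
Qed.

Lemma braid_winvK : involutive braid_winv.
Proof.
move=> u; rewrite /braid_winv map_rev revK -map_comp -[RHS]map_id.
by apply: eq_map => -[i e] /=; rewrite negbK.
Qed.

Fact braid_winv_eq u v : braid_eq u v -> braid_eq (braid_winv u) (braid_winv v).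
Proof.
move=> uv; apply: (@BraidTrans _ (braid_winv u ++ (v ++ braid_winv v))).
  rewrite -{1}[braid_winv u]cats0; apply: BraidCat; first exact: BraidRefl.
  by apply: BraidSym; have := braid_winvl (braid_winv v); rewrite braid_winvK.
rewrite catA -{2}[braid_winv v]cat0s; apply: BraidCat; last exact: BraidRefl.
apply: BraidTrans (braid_winvl u); apply: BraidCat; first exact: BraidRefl.
exact: BraidSym.
Qed.

Definition braid_mul (g h : braid) : braid := braid_of (repr g ++ repr h).
Definition braid_inv (g : braid) : braid := braid_of (braid_winv (repr g)).

Lemma braid_mulE u v : braid_mul (braid_of u) (braid_of v) = braid_of (u ++ v).
Proof. by apply/braid_ofP/BraidCat; apply: braid_repr. Qed.

Lemma braid_invE u : braid_inv (braid_of u) = braid_of (braid_winv u).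
Proof. by apply/braid_ofP/braid_winv_eq/braid_repr. Qed.

Fact braid_mulA : associative braid_mul.
Proof.
move=> g h k; rewrite -[g]braid_ofK -[h]braid_ofK -[k]braid_ofK.
by rewrite !braid_mulE catA.
Qed.
Fact braid_mul1l : left_id (braid_of [::]) braid_mul.
Proof. by move=> g; rewrite -[g]braid_ofK braid_mulE. Qed.
Fact braid_mul1r : right_id (braid_of [::]) braid_mul.
Proof. by move=> g; rewrite -[g]braid_ofK braid_mulE cats0. Qed.
Fact braid_mulVl : left_inverse (braid_of [::]) braid_inv braid_mul.
Proof.
move=> g; rewrite -[g]braid_ofK braid_invE braid_mulE.
exact/braid_ofP/braid_winvl.
Qed.
Fact braid_mulVr : right_inverse (braid_of [::]) braid_inv braid_mul.
Proof.
move=> g; rewrite -[g]braid_ofK braid_invE braid_mulE; apply/braid_ofP.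
by have := braid_winvl (braid_winv (repr g)); rewrite braid_winvK.
Qed.

HB.instance Definition _ := isGroup.Build braid
  braid_mulA braid_mul1l braid_mul1r braid_mulVl braid_mulVr.

(* Artin generators, numbered from 1 to n - 1 as usual; [sigma i] is the unit
   when i is out of this range. *)
Definition sigma (i : nat) : braid :=
  if i is j.+1 then
    if insub j is Some k then braid_of [:: (k, true)] else 1%g
  else 1%g.

Lemma sigmaE (k : 'I_n.-1) : sigma k.+1 = braid_of [:: (k, true)].
Proof. by rewrite /sigma insubT //= => h; congr (braid_of [:: (_, _)]); apply: val_inj. Qed.

Lemma sigmaVE (k : 'I_n.-1) : (sigma k.+1)^-1%g = braid_of [:: (k, false)].
Proof. by rewrite sigmaE -[LHS]/(braid_inv _) braid_invE. Qed.

End BraidGroup.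

Inductive ideal_gen (A : nzRingType) (S : set A) : set A :=
| IdealGen x : S x -> ideal_gen S x
| Ideal0 : ideal_gen S 0
| IdealD x y : ideal_gen S x -> ideal_gen S y -> ideal_gen S (x + y)
| IdealM u x v : ideal_gen S x -> ideal_gen S (u * x * v).

Definition cubic_defect (A : algType laurent) (s : A) : A :=
  (s - la%:A) * (s - lb%:A) * (s - lc%:A).

(* t stands for s^-1 and similarly for s1, s2. *)
Definition quad_defect (A : algType laurent) (s1 t1 s2 t2 : A) : A :=
  t1 * s2 * s1 -
  (s1 * s2 * t1 - laV *: (s1 * s2) + la *: (s1 * t2) + la *: (t1 * s2)
   - la ^+ 3 *: (t1 * t2) + laV *: (s2 * s1) - la *: (s2 * t1)
   - la *: (t2 * s1) + la ^+ 3 *: (t2 * t1) + la ^+ 2 *: (t1 * t2 * s1)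
   - la ^+ 2 *: (s1 * t2 * t1)).

Lemma cubic_defect_morph (A B : algType laurent) (f : {lrmorphism A -> B}) s :
  f (cubic_defect s) = cubic_defect (f s).
Proof.
have fc c : f (c%:A) = c%:A by rewrite linearZ_LR rmorph1.
by rewrite /cubic_defect !rmorphM !rmorphB /= !fc.
Qed.

Lemma quad_defect_morph (A B : algType laurent) (f : {lrmorphism A -> B})
    s1 t1 s2 t2 :
  f (quad_defect s1 t1 s2 t2) = quad_defect (f s1) (f t1) (f s2) (f t2).
Proof.
have fZ c x : f (c *: x) = c *: f x by rewrite linearZ_LR.
by rewrite /quad_defect !(rmorphD, rmorphN) /= !fZ !rmorphM.
Qed.

Section QAlgebra.
Variable n : nat.

Definition RB : Type := grpalg laurent (braid n).
HB.instance Definition _ := GRing.Algebra.copy RB (grpalg laurent (braid n)).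

Definition rs (i : nat) : RB := basis laurent (sigma n i).
Definition rt (i : nat) : RB := basis laurent (sigma n i)^-1%g.

(* No relation is imposed when n < 3, where s_1 and s_2 do not both exist. *)
Definition Q_relators : set RB :=
  [set x | (3 <= n)%N /\
     (x = cubic_defect (rs 1) \/ x = quad_defect (rs 1) (rt 1) (rs 2) (rt 2))].

(* Images f i of s_i and t i of s_i^-1 satisfying the relations of Q_n. *)
Record Q_datum (A : algType laurent) (f t : nat -> A) : Prop := QDatum {
  Q_datum_inv : forall i, (0 < i < n)%N -> f i * t i = 1 /\ t i * f i = 1;
  Q_datum_far : forall i j, (0 < i)%N -> (i.+1 < j)%N -> (j < n)%N ->
    f i * f j = f j * f i;
  Q_datum_near : forall i, (0 < i)%N -> (i.+1 < n)%N ->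
    f i * f i.+1 * f i = f i.+1 * f i * f i.+1;
  Q_datum_rel : (3 <= n)%N -> cubic_defect (f 1) = 0 /\
    quad_defect (f 1) (t 1) (f 2) (t 2) = 0
}.

Section RBLift.
Variables (A : algType laurent) (f t : nat -> A).

Definition word_eval (u : braid_word n) : A :=
  \prod_(x <- u) (if x.2 then f x.1.+1 else t x.1.+1).

Definition RB_lift (x : RB) : A := linext (fun g : braid n => word_eval (repr g)) x.

HB.instance Definition _ := GRing.Linear.copy RB_lift
  (linext (fun g : braid n => word_eval (repr g))).

Hypothesis ftP : Q_datum f t.

Let letter_lt (k : 'I_n.-1) : (0 < k.+1 < n)%N.
Proof. by have := ltn_ord k; case: (n) k. Qed.

Lemma word_eval_eq u v : braid_eq u v -> word_eval u = word_eval v.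
Proof.
have [inv far near _] := ftP.
rewrite /word_eval; elim=> {u v} // [u v w _ -> _ -> //|u v u' v' _ IH _ IH'|i e|i j ij|i j ij].
- by rewrite !big_cat /= IH IH'.
- have [ft tf] := inv _ (letter_lt i).
  by rewrite !big_cons !big_nil mulr1; case: e => /=.
- rewrite !big_cons !big_nil !mulr1 /=; apply: far => //.
  by have /andP[] := letter_lt j.
- rewrite !big_cons !big_nil !mulr1 /= !mulrA ij; apply: near => //.
  by have /andP[] := letter_lt j; rewrite ij.
Qed.

Lemma RB_lift_braid (u : braid_word n) :
  RB_lift (basis laurent (braid_of u)) = word_eval u.
Proof. by rewrite /RB_lift linext_basis; apply/word_eval_eq/braid_repr. Qed.

Lemma RB_lift_monoid_morphism : monoid_morphism RB_lift.
Proof.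
apply: linext_monoid_morphism => [|g h].
  by rewrite (word_eval_eq (braid_repr [::])) /word_eval big_nil.
by rewrite (word_eval_eq (braid_repr _)) /word_eval big_cat.
Qed.

Lemma RB_lift_s i : (0 < i < n)%N -> RB_lift (rs i) = f i.
Proof.
case: i => // i lt_i; have lt_i' : (i < n.-1)%N by case: (n) lt_i.
rewrite /rs -[i]/(val (Ordinal lt_i')) sigmaE RB_lift_braid.
by rewrite /word_eval big_seq1.
Qed.

Lemma RB_lift_t i : (0 < i < n)%N -> RB_lift (rt i) = t i.
Proof.
case: i => // i lt_i; have lt_i' : (i < n.-1)%N by case: (n) lt_i.
rewrite /rt -[i]/(val (Ordinal lt_i')) sigmaVE RB_lift_braid.
by rewrite /word_eval big_seq1.
Qed.

Lemma RB_lift_ideal x : ideal_gen Q_relators x -> RB_lift x = 0.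
Proof.
pose F : {lrmorphism RB -> A} := HB.pack RB_lift
  (GRing.isMonoidMorphism.Build RB A RB_lift RB_lift_monoid_morphism).
have FM := RB_lift_monoid_morphism.2.
elim=> {x} [x [n3 Rx]||x y _ x0 _ y0|u x v _ x0].
- have [c0 q0] := Q_datum_rel ftP n3.
  have i1 : (0 < 1 < n)%N by rewrite (leq_trans _ n3).
  have i2 : (0 < 2 < n)%N by [].
  case: Rx => ->.
    have := cubic_defect_morph F (rs 1).
    by rewrite -![F _]/(RB_lift _) RB_lift_s // c0.
  have := quad_defect_morph F (rs 1) (rt 1) (rs 2) (rt 2).
  by rewrite -![F _]/(RB_lift _) !RB_lift_s // !RB_lift_t // q0.
- exact: linear0.
- by rewrite linearD /= x0 y0 addr0.
- by rewrite !FM x0 mulr0 mul0r.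
Qed.

End RBLift.

Lemma Q_datum_augmentation :
  Q_datum (fun=> la : laurent^o) (fun=> laV : laurent^o).
Proof.
have aV : (la : laurent^o) * (laV : laurent^o) = 1 by exact: laK.
have Va : (laV : laurent^o) * (la : laurent^o) = 1 by rewrite mulrC.
split=> // _; split.
  by rewrite /cubic_defect -[_%:A]/(la * 1) mulr1 subrr !mul0r.
have quadC (K : comNzRingType) (u v : K) : v * u * u - (u * u * v - v * (u * u)
    + u * (u * v) + u * (v * u) - u ^+ 3 * (v * v) + v * (u * u) - u * (u * v)
    - u * (v * u) + u ^+ 3 * (v * v) + u ^+ 2 * (v * v * u)
    - u ^+ 2 * (u * v * v)) = 0 by ring.
exact: (quadC laurent la laV).
Qed.

Definition Q_ideal (x : RB) : bool := `[< ideal_gen Q_relators x >].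

Fact Q_ideal_zmod_closed : zmod_closed Q_ideal.
Proof.
split=> [|x y /asboolP Ix /asboolP Iy]; apply/asboolP; first exact: Ideal0.
by apply: IdealD => //; rewrite -mulN1r -[_ * _]mulr1; apply: IdealM.
Qed.

HB.instance Definition _ :=
  GRing.isZmodClosed.Build RB Q_ideal Q_ideal_zmod_closed.

Definition Q_zmodClosed : zmodClosed RB := GRing.ZmodClosed.clone RB Q_ideal _.

Definition Q : Type := Quotient.quot Q_zmodClosed.
HB.instance Definition _ := GRing.Zmodule.on Q.

Definition toQ (x : RB) : Q := \pi_(Quotient.quot Q_zmodClosed) x.

Lemma toQP x y : toQ x = toQ y <-> ideal_gen Q_relators (x - y).
Proof.
rewrite /toQ; split=> [/eqP|Ixy].
  by rewrite -Quotient.idealrBE => /asboolP.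
by apply/eqP; rewrite -Quotient.idealrBE; apply/asboolP.
Qed.

Definition ofQ (q : Q) : RB := repr (q : Quotient.quot Q_zmodClosed).
Lemma ofQK q : toQ (ofQ q) = q. Proof. exact: reprK. Qed.

Lemma toQD x y : toQ (x + y) = toQ x + toQ y.
Proof. exact: Quotient.pi_add. Qed.
Lemma toQN x : toQ (- x) = - toQ x.
Proof. exact: Quotient.pi_opp. Qed.
Lemma toQ0 : toQ 0 = 0.
Proof. by apply: (addrI (toQ 0)); rewrite -toQD !addr0. Qed.
Lemma toQ_ofQ x : ideal_gen Q_relators (ofQ (toQ x) - x).
Proof. by apply/toQP; rewrite ofQK. Qed.

Definition Q_mul (p q : Q) : Q := toQ (ofQ p * ofQ q).
Definition Q_scale (c : laurent) (q : Q) : Q := toQ (c *: ofQ q).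

Lemma ideal_genMl (x y : RB) :
  ideal_gen Q_relators x -> ideal_gen Q_relators (y * x).
Proof. by move=> Ix; rewrite -[y * x]mulr1; apply: IdealM. Qed.
Lemma ideal_genMr (x y : RB) :
  ideal_gen Q_relators x -> ideal_gen Q_relators (x * y).
Proof. by move=> Ix; rewrite -[x]mul1r; apply: IdealM. Qed.

Lemma Q_mulE x y : Q_mul (toQ x) (toQ y) = toQ (x * y).
Proof.
apply/toQP; set x' := ofQ _; set y' := ofQ _.
have -> : x' * y' - x * y = (x' - x) * y' + x * (y' - y).
  by rewrite mulrBl mulrBr addrA subrK.
by apply: IdealD; [apply/ideal_genMr/toQ_ofQ | apply/ideal_genMl/toQ_ofQ].
Qed.

Lemma Q_scaleE c x : Q_scale c (toQ x) = toQ (c *: x).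
Proof.
apply/toQP; rewrite -scalerBr -[X in _ *: X]mul1r scalerAl.
exact/ideal_genMl/toQ_ofQ.
Qed.

Fact Q_mulA : associative Q_mul.
Proof.
move=> p q r; rewrite -[p]ofQK -[q]ofQK -[r]ofQK.
by rewrite !Q_mulE mulrA.
Qed.
Fact Q_mul1l : left_id (toQ 1) Q_mul.
Proof. by move=> p; rewrite -[p]ofQK Q_mulE mul1r. Qed.
Fact Q_mul1r : right_id (toQ 1) Q_mul.
Proof. by move=> p; rewrite -[p]ofQK Q_mulE mulr1. Qed.
Fact Q_mulDl : left_distributive Q_mul +%R.
Proof.
move=> p q r; rewrite -[p]ofQK -[q]ofQK -[r]ofQK.
by rewrite -toQD !Q_mulE mulrDl toQD.
Qed.
Fact Q_mulDr : right_distributive Q_mul +%R.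
Proof.
move=> p q r; rewrite -[p]ofQK -[q]ofQK -[r]ofQK.
by rewrite -toQD !Q_mulE mulrDr toQD.
Qed.
Fact Q_one_neq0 : toQ 1 != 0.
Proof.
apply/eqP; rewrite -toQ0 => /toQP; rewrite subr0.
move/(RB_lift_ideal Q_datum_augmentation).
rewrite (RB_lift_monoid_morphism Q_datum_augmentation).1.
exact/eqP/oner_neq0.
Qed.

HB.instance Definition _ := GRing.Zmodule_isNzRing.Build Q
  Q_mulA Q_mul1l Q_mul1r Q_mulDl Q_mulDr Q_one_neq0.

Fact Q_scaleA c d p : Q_scale c (Q_scale d p) = Q_scale (c * d) p.
Proof. by rewrite -[p]ofQK !Q_scaleE scalerA. Qed.
Fact Q_scale1 : left_id 1 Q_scale.
Proof. by move=> p; rewrite -[p]ofQK Q_scaleE scale1r. Qed.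
Fact Q_scaleDr : right_distributive Q_scale +%R.
Proof.
move=> c p q; rewrite -[p]ofQK -[q]ofQK -toQD.
by rewrite !Q_scaleE scalerDr toQD.
Qed.
Fact Q_scaleDl p : {morph Q_scale^~ p : c d / c + d}.
Proof. by move=> c d; rewrite -[p]ofQK !Q_scaleE scalerDl toQD. Qed.

HB.instance Definition _ := GRing.Zmodule_isLmodule.Build laurent Q
  Q_scaleA Q_scale1 Q_scaleDr Q_scaleDl.

Lemma toQM x y : toQ (x * y) = toQ x * toQ y.
Proof. by rewrite -Q_mulE. Qed.
Lemma toQZ c x : toQ (c *: x) = c *: toQ x.
Proof. by rewrite -Q_scaleE. Qed.

Fact Q_scalerAl (c : laurent) (p q : Q) : c *: (p * q) = (c *: p) * q.
Proof. by rewrite -[p]ofQK -[q]ofQK -toQM -!toQZ -toQM scalerAl. Qed.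
HB.instance Definition _ := GRing.Lmodule_isLalgebra.Build laurent Q Q_scalerAl.
Fact Q_scalerAr (c : laurent) (p q : Q) : c *: (p * q) = p * (c *: q).
Proof. by rewrite -[p]ofQK -[q]ofQK -toQM -!toQZ -toQM scalerAr. Qed.
HB.instance Definition _ := GRing.Lalgebra_isAlgebra.Build laurent Q Q_scalerAr.

HB.instance Definition _ := GRing.isLinear.Build laurent RB Q *:%R toQ
  (fun c x y => etrans (toQD _ _) (congr1 (+%R^~ _) (toQZ c x))).
HB.instance Definition _ := GRing.isMonoidMorphism.Build RB Q toQ
  (erefl (1 : Q), toQM).

Section QLift.
Variables (A : algType laurent) (f t : nat -> A).

Definition Q_lift (q : Q) : A := RB_lift f t (ofQ q).

Hypothesis ftP : Q_datum f t.

Lemma Q_lift_toQ x : Q_lift (toQ x) = RB_lift f t x.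
Proof.
have := RB_lift_ideal ftP (toQ_ofQ x).
by rewrite linearB => /eqP; rewrite subr_eq0 => /eqP.
Qed.

Lemma Q_lift_linear : linear Q_lift.
Proof.
move=> c p q; rewrite -[p]ofQK -[q]ofQK -linearP !Q_lift_toQ.
exact: linearP.
Qed.

Lemma Q_lift_monoid_morphism : monoid_morphism Q_lift.
Proof.
split=> [|p q].
  by rewrite -[1]/(toQ 1) Q_lift_toQ (RB_lift_monoid_morphism ftP).1.
rewrite -[p]ofQK -[q]ofQK -toQM !Q_lift_toQ.
exact: (RB_lift_monoid_morphism ftP).2.
Qed.

End QLift.

End QAlgebra.

(* gen n i is the image of s_i in Q_n and genV n i that of s_i^-1, for 0 < i < n;
   both are 1 for other i. *)
Definition gen (n i : nat) : Q n := toQ (rs n i).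
Definition genV (n i : nat) : Q n := toQ (rt n i).

(* The morphism Q_n -> Q_(n+1) mapping s_i to s_i, and the augmentation
   Q_n -> R mapping s_i to a. *)
Definition Q_incl (n : nat) : Q n -> Q n.+1 := Q_lift (gen n.+1) (genV n.+1).
Definition epsilon (n : nat) : Q n -> laurent^o :=
  Q_lift (fun=> la : laurent^o) (fun=> laV : laurent^o).

Section Morphisms.
Variable n : nat.

Lemma sK i : gen n i * genV n i = 1.
Proof. by rewrite -toQM -basisM mulgV. Qed.
Lemma sVK i : genV n i * gen n i = 1.
Proof. by rewrite -toQM -basisM mulVg. Qed.

Lemma s_far i j : (0 < i)%N -> (i.+1 < j)%N -> (j < n)%N ->
  gen n i * gen n j = gen n j * gen n i.
Proof.
case: i j => // i [] // j _ ij jn.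
have jn' : (j < n.-1)%N by case: (n) jn.
have in' : (i < n.-1)%N by apply: ltn_trans jn'; apply: ltnW.
rewrite -!toQM -!basisM; congr (toQ (basis laurent _)).
rewrite -[i]/(val (Ordinal in')) -[j]/(val (Ordinal jn')) !sigmaE.
by rewrite -![(_ * _)%g]/(braid_mul _ _) !braid_mulE; apply/braid_ofP/BraidFar.
Qed.

Lemma s_near i : (0 < i)%N -> (i.+1 < n)%N ->
  gen n i * gen n i.+1 * gen n i = gen n i.+1 * gen n i * gen n i.+1.
Proof.
case: i => // i _ jn.
have jn' : (i.+1 < n.-1)%N by case: (n) jn.
have in' : (i < n.-1)%N by apply: ltn_trans jn'.
have sss j k l : gen n j * gen n k * gen n l =
    toQ (basis laurent (sigma n j * sigma n k * sigma n l)%g).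
  by rewrite !basisM !toQM.
rewrite !sss; congr (toQ (basis laurent _)).
rewrite -[i.+2]/((val (Ordinal jn')).+1) -[i]/(val (Ordinal in')) !sigmaE.
rewrite -![(_ * _)%g]/(braid_mul _ _) !braid_mulE.
by apply/braid_ofP/BraidNear.
Qed.

Lemma s_cubic : (3 <= n)%N -> cubic_defect (gen n 1) = 0.
Proof.
move=> n3; rewrite -cubic_defect_morph -toQ0; apply/toQP; rewrite subr0.
by apply: IdealGen; split=> //; left.
Qed.

Lemma s_quad : (3 <= n)%N -> quad_defect (gen n 1) (genV n 1) (gen n 2) (genV n 2) = 0.
Proof.
move=> n3; rewrite -quad_defect_morph -toQ0; apply/toQP; rewrite subr0.
by apply: IdealGen; split=> //; right.
Qed.

End Morphisms.

Section MorphismInstances.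
Variable n : nat.

Fact Q_incl_datum : Q_datum n (gen n.+1) (genV n.+1).
Proof.
split=> [i _|i j i0 ij jn|i i0 iN|n3].
- by rewrite sK sVK.
- by apply: s_far => //; apply: ltnW.
- by apply: s_near => //; apply: ltnW.
- by rewrite s_cubic ?s_quad // ltnW.
Qed.

HB.instance Definition _ := GRing.isLinear.Build laurent (Q n) (Q n.+1) *:%R
  (@Q_incl n) (Q_lift_linear Q_incl_datum).
HB.instance Definition _ := GRing.isMonoidMorphism.Build (Q n) (Q n.+1)
  (@Q_incl n) (Q_lift_monoid_morphism Q_incl_datum).

HB.instance Definition _ := GRing.isLinear.Build laurent (Q n) laurent^o *:%R
  (@epsilon n) (Q_lift_linear (Q_datum_augmentation n)).
HB.instance Definition _ := GRing.isMonoidMorphism.Build (Q n) laurent^o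
  (@epsilon n) (Q_lift_monoid_morphism (Q_datum_augmentation n)).

Lemma Q_incl_s i : (0 < i < n)%N -> Q_incl (gen n i) = gen n.+1 i.
Proof.
by move=> i_n; rewrite /Q_incl (Q_lift_toQ Q_incl_datum)
  (RB_lift_s Q_incl_datum).
Qed.

Lemma epsilon_s i : (0 < i < n)%N -> epsilon (gen n i) = la.
Proof.
by move=> i_n; rewrite /epsilon (Q_lift_toQ (Q_datum_augmentation n))
  (RB_lift_s (Q_datum_augmentation n)).
Qed.

End MorphismInstances.

Definition Rspan (A : lmodType laurent) (S : set A) : set A :=
  [set z | exists m (r : 'I_m -> laurent) (v : 'I_m -> A),
     (forall i, S (v i)) /\ z = \sum_(i < m) r i *: v i].

Definition u4 : set (Q 5) :=
  [set z | exists r0 r1 r2 : laurent,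
     z = r0%:A + r1 *: gen 5 4 + r2 *: genV 5 4].

Definition Q5_products (k : nat) : set (Q 5) :=
  [set z | exists (q0 : Q 4) (u : 'I_k -> Q 5) (q : 'I_k -> Q 4),
     (forall i, u4 (u i)) /\
     z = Q_incl q0 * \prod_(i < k) (u i * Q_incl (q i))].

Definition Q5 (k : nat) : set (Q 5) := Rspan (Q5_products k).

Definition add_line (S : set (Q 5)) (e : Q 5) : set (Q 5) :=
  [set z + r *: e | z in S & r in [set: laurent]].

Definition eq_modulo (S : set (Q 5)) (p q : Q 5) : Prop := S (p - q).

Definition x_elt : Q 4 := gen 4 3 * genV 4 2 * gen 4 3.
Definition y_elt : Q 4 := gen 4 1 * genV 4 2 * gen 4 1.
Definition w_plus : Q 4 := gen 4 3 * gen 4 2 * genV 4 1 * gen 4 2 * gen 4 3.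
Definition w_minus : Q 4 := genV 4 3 * genV 4 2 * gen 4 1 * genV 4 2 * genV 4 3.

(* Main.v *)
From HB Require Import structures.
Require Import Defs.
From mathcomp Require Import all_boot all_order all_algebra.
From mathcomp Require Import classical_sets.
From mathcomp Require Import ring zify.
Set Implicit Arguments.
Unset Strict Implicit.
Unset Printing Implicit Defensive.
Import GRing.Theory.
Local Open Scope ring_scope.

(* Rescale the generators so that a = 1, put t_i = s_i^-1, x = s_3 t_2 s_3,
   Z = s_4 t_3 s_4, V = s_4 x s_4, f = s_4 x y s_4 x s_4, and work modulo degree
   at most 2 in s_4, t_4.  As a Q_3-bimodule Q_4 is spanned by u_3, x, w_+ and
   w_-, and from this u_4 Q_4 Z and Z Q_4 u_4 have degree at most 2.  So
   Q_4 Z Q_4 can be dropped inside a product of three factors u_4; modulo it, V is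
   fixed by s_2 and s_3 on both sides.  Hence V h x s_4, with h in Q_3, is a
   multiple of f, and f is fixed by s_2 and s_3; f is also a unit times
   s_1 s_2 s_3 s_2 g, where g = s_4 w_+ t_4 w_+ s_4 is fixed by s_1, which makes
   Q_4 act on f through the augmentation and gives V Q_4 u_4 and u_4 Q_4 V inside
   the line of f.  A word w z w' z' w'' with w, w', w'' in {s_4, t_4} is brought to
   these cases by braid relations when w, w' or w', w'' have opposite signs, and by
   the relation between s_3 and s_4 otherwise.  Reversing words and exchanging s
   with t are symmetries of the situation; the second one maps f to a unit multiple
   of f, by comparing both sides of t_4 w_+ s_4 w_- s_4 = t_4 w_+ t_4 w_- s_4. *)

(** One congruence drives the reductions: for adjacent i and j, the element s_j t_i s_j is fixed by
    s_i on both sides modulo u_i u_j u_i, and is there congruent to q t_j s_i t_j. It is used on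
    {s_1, s_2}, {s_2, s_3} and {s_3, s_4}, and allows the signs in the middle of a word to be
    exchanged at the cost of the unit q.

    With a = 1 the relation between two adjacent generators has coefficients 1 and -1 and is
    invariant under the exchange of s and t, while the cubic one keeps its shape with q replaced by
    q^-1. This is why the argument is written for an arbitrary algebra satisfying [ok]: each
    statement can then be applied to (t, s).

    R is not a field, so lines are compared only through units: the factors relating f to the other
    generators of the line are powers of q and a, up to sign.

    The exchange is not visible on f. Words with three letters t_4 lead to the exchanged element f',
    and cannot be treated before f' is known to lie on the line of f. *)

Definition submod (K : comNzRingType) (A : lmodType K) (P : A -> Prop) : Prop :=
  P 0 /\ forall (c : K) (x y : A), P x -> P y -> P (c *: x + y).

Inductive span (K : comNzRingType) (A : lmodType K) (S : A -> Prop) : A -> Prop :=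
| Span0 : span S 0
| SpanDZ (c : K) x y : S x -> span S y -> span S (c *: x + y).

Section Submodules.
Variables (K : comNzRingType) (A : algType K).
Implicit Types (P S : A -> Prop) (c : K) (x y z l r : A).

Section Closure.
Variable P : A -> Prop.
Hypothesis sP : submod P.

Lemma sub0 : P 0. Proof. by case: sP. Qed.
Lemma subZ c x : P x -> P (c *: x).
Proof. by move=> Px; rewrite -[_ *: _]addr0; apply: sP.2 => //; apply: sub0. Qed.
Lemma subD x y : P x -> P y -> P (x + y).
Proof. by move=> Px Py; rewrite -[x]scale1r; apply: sP.2. Qed.
Lemma subN x : P x -> P (- x).
Proof. by move=> Px; rewrite -scaleN1r; apply: subZ. Qed.
Lemma subB x y : P x -> P y -> P (x - y).
Proof. by move=> Px Py; apply: subD => //; apply: subN. Qed.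

Lemma sub_mod x y : P (x - y) -> P y -> P x.
Proof. by move=> Pxy Py; rewrite -(subrK y x); apply: subD. Qed.
Lemma sub_mods x y : P (x - y) -> P (y - x).
Proof. by move=> Pxy; rewrite -opprB; apply: subN. Qed.
Lemma sub_modt y x z : P (x - y) -> P (y - z) -> P (x - z).
Proof. by move=> Pxy Pyz; rewrite -(subrK y x) -addrA; apply: subD. Qed.
Lemma sub_modZ c x y : P (x - y) -> P (c *: x - c *: y).
Proof. by move=> Pxy; rewrite -scalerBr; apply: subZ. Qed.

Lemma submod_lr l r : submod (fun x => P (l * x * r)).
Proof.
split=> [|c x y Px Py]; first by rewrite mulr0 mul0r; apply: sub0.
by rewrite mulrDr mulrDl -scalerAr -scalerAl; apply: sP.2.
Qed.

Lemma span_sub S : (forall x, S x -> P x) -> forall x, span S x -> P x.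
Proof.
move=> SP x; elim=> [|c y z Sy _ Pz]; first exact: sub0.
by apply: sP.2 => //; apply: SP.
Qed.

End Closure.

Lemma span_submod S : submod (span S).
Proof.
split=> [|c x y]; first exact: Span0.
elim=> [|d x1 x2 Sx1 _ IH] Sy; first by rewrite scaler0 add0r.
by rewrite scalerDr scalerA -addrA; apply: SpanDZ => //; apply: IH.
Qed.

Lemma mem_span S x : S x -> span S x.
Proof. by move=> Sx; rewrite -[x]scale1r -[_ *: _]addr0; apply: SpanDZ => //; apply: Span0. Qed.

End Submodules.

(* [ok s t p q qi rv]: s_1, .., s_4 are generators, normalised so that a = 1,
   with inverses t_i; p = b + c, q = b c, and rv is the word reversal. *)
Record ok (K : comNzRingType) (A : algType K) (s t : nat -> A) (p q qi : K)
    (rv : A -> A) : Prop := Ok {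
  ok_q : q * qi = 1;
  ok_st : forall i, (0 < i < 5)%N -> s i * t i = 1;
  ok_ts : forall i, (0 < i < 5)%N -> t i * s i = 1;
  ok_far : forall i j, (0 < i)%N -> (i.+1 < j)%N -> (j < 5)%N ->
    s i * s j = s j * s i;
  ok_near : forall i, (0 < i < 4)%N ->
    s i * s i.+1 * s i = s i.+1 * s i * s i.+1;
  ok_sq : forall i, (0 < i < 5)%N ->
    s i * s i = (p + 1) *: s i - (p + q) *: 1 + q *: t i;
  ok_cross : forall i j, (0 < i < 5)%N -> (0 < j < 5)%N ->
      (j == i.+1) || (i == j.+1) ->
    s i * s j * t i - s i * t j * t i - t i * s j * s i + t i * t j * s i =
    s i * s j - s i * t j - s j * s i + t j * s i
      + s j * t i - t j * t i - t i * s j + t i * t j;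
  ok_rvL : forall c x y, rv (c *: x + y) = c *: rv x + rv y;
  ok_rvM : forall x y, rv (x * y) = rv y * rv x;
  ok_rv_s : forall i, (0 < i < 5)%N -> rv (s i) = s i
}.

(** * Braid words *)

(* The letter LS i e is s_i or its inverse; LA k is the k-th atom, an element of
   the algebra which commutes with s_4 when it is flagged so. *)
Inductive letter := LS of nat & bool | LA of nat.
Inductive tree := TL of letter | TM of tree & tree | T1.

Fixpoint flat (e : tree) : seq letter :=
  match e with TL l => [:: l] | TM a b => flat a ++ flat b | T1 => [::] end.

Definition bword : Type := seq (nat * bool).

Definition binv (w : bword) : bword := rev [seq (x.1, ~~ x.2) | x <- w].

(** The prefix [acc] is stored reversed. The search for s_i^(-e) stops at s_(i-1), so the word v
    skipped over contains only s_(i+1) and letters commuting with s_i, which is the case covered by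
    [conj_word]. *)
Fixpoint back (i : nat) (e : bool) (acc v : bword) : option (bword * bword) :=
  if acc is (j, d) :: acc' then
    if j == i then (if d == ~~ e then Some (acc', v) else None)
    else if j.+1 == i then None
    else back i e acc' ((j, d) :: v)
  else None.

(* Handle reduction removes the subword s_i^d v s_i^(-d) by
   s_i^d s_(i+1)^f s_i^(-d) = s_(i+1)^(-d) s_i^f s_(i+1)^d *)
Definition conj_word (i : nat) (d : bool) (v : bword) : bword :=
  flatten [seq (if x.1 == i.+1 then [:: (i.+1, ~~ d); (i, x.2); (i.+1, d)]
                else [:: x]) | x <- v].

Fixpoint hstep (acc w : bword) : option bword :=
  if w is (i, e) :: w' then
    if back i e acc [::] is Some (r, v) then
      Some (catrev r (conj_word i (~~ e) v ++ w'))
    else hstep ((i, e) :: acc) w'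
  else None.

Fixpoint hred (n : nat) (w : bword) : bword :=
  if n is n'.+1 then (if hstep [::] w is Some w' then hred n' w' else w) else w.

(* 1000 is fuel: only the soundness of the reduction matters. *)
Definition bred (w : bword) : bword := hred 1000 w.

Definition bvalid (w : bword) := all (fun x => (0 < x.1 < 5)%N) w.

Definition beq (u v : bword) : bool :=
  bvalid u && bvalid v && nilp (bred (u ++ binv v)).

Fixpoint chop (w : seq letter) : bword * option (nat * seq letter) :=
  match w with
  | [::] => ([::], None)
  | LS i e :: w' => let: (u, r) := chop w' in ((i, e) :: u, r)
  | LA k :: w' => ([::], Some (k, w'))
  end.

(** The word c is a braid carried from the left, as the invariant [weq_sound] shows. At an atom the
    discrepancy v^-1 c u between the two sides must be trivial, or reduce to letters s_4^(+-1) in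
    front of an atom commuting with s_4; it then passes the atom and becomes the new carry. *)
Fixpoint weq (n : nat) (fl : seq bool) (c : bword) (w1 w2 : seq letter) : bool :=
  let: (u, r1) := chop w1 in
  let: (v, r2) := chop w2 in
  match n, r1, r2 with
  | _, None, None => beq (c ++ u) v
  | n'.+1, Some (k, w1'), Some (k', w2') =>
    [&& k == k', bvalid (c ++ u), bvalid v &
    let g := bred (binv v ++ c ++ u) in
    (nilp g || (nth false fl k && all (fun x => x.1 == 4) g)) &&
    weq n' fl g w1' w2']
  | _, _, _ => false
  end.

Section BraidWords.
Variables (K : comNzRingType) (A : algType K) (s t : nat -> A) (p q qi : K)
  (rv : A -> A).
Hypothesis H : ok s t p q qi rv.

Let g (x : nat * bool) : A := if x.2 then s x.1 else t x.1.

Definition bev (w : bword) : A := \prod_(x <- w) g x.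

Lemma bev_cat u v : bev (u ++ v) = bev u * bev v.
Proof. by rewrite /bev big_cat. Qed.
Lemma bev_cons x v : bev (x :: v) = g x * bev v.
Proof. by rewrite /bev big_cons. Qed.
Lemma bev_nil : bev [::] = 1. Proof. by rewrite /bev big_nil. Qed.

Let gK i e : (0 < i < 5)%N -> g (i, e) * g (i, ~~ e) = 1.
Proof. by move=> hi; case: e; rewrite /g /= ?(ok_st H) ?(ok_ts H). Qed.

Let gVK i e : (0 < i < 5)%N -> g (i, ~~ e) * g (i, e) = 1.
Proof. by move=> hi; rewrite -{2}[e]negbK gK. Qed.

Lemma bev_binv u : bvalid u -> bev u * bev (binv u) = 1.
Proof.
elim: u => [|[i e] u IH] /=; first by rewrite !bev_nil mul1r.
move=> /andP[hi /IH {}IH]; rewrite /binv /= rev_cons -cats1 bev_cat.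
by rewrite -/(binv u) !bev_cons bev_nil mulr1 mulrA -[_ * bev u * _]mulrA IH mulr1 gK.
Qed.

Lemma binvK u : binv (binv u) = u.
Proof.
rewrite /binv map_rev revK -map_comp -[RHS]map_id; apply: eq_map => -[i e] /=.
by rewrite negbK.
Qed.
Lemma bvalid_binv u : bvalid (binv u) = bvalid u.
Proof. by rewrite /bvalid /binv all_rev all_map. Qed.

Lemma bev_binvl u : bvalid u -> bev (binv u) * bev u = 1.
Proof. by move=> hu; rewrite -{2}[u]binvK bev_binv // bvalid_binv. Qed.

Let ginj i e x y : (0 < i < 5)%N -> g (i, e) * x = g (i, e) * y -> x = y.
Proof.
move=> hi E; rewrite -[x]mul1r -[y]mul1r -(gK (~~ e) hi) negbK.
by rewrite -!mulrA E.
Qed.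

Let comm_flip i e x : (0 < i < 5)%N ->
  g (i, e) * x = x * g (i, e) -> g (i, ~~ e) * x = x * g (i, ~~ e).
Proof.
move=> hi E; apply: (@ginj i e) => //.
by rewrite mulrA gK // mul1r mulrA E -mulrA gK // mulr1.
Qed.

Let far i e j d : (0 < i < 5)%N -> (0 < j < 5)%N -> j != i -> j.+1 != i ->
  j != i.+1 -> g (i, e) * g (j, d) = g (j, d) * g (i, e).
Proof.
move=> hi hj n1 n2 n3.
have E : g (i, true) * g (j, true) = g (j, true) * g (i, true).
  have [i0 i5] := andP hi; have [j0 j5] := andP hj.
  have [ij|ij] := ltnP i.+1 j; first exact: (ok_far H).
  by symmetry; apply: (ok_far H) => //=; lia.
have E1 : g (i, e) * g (j, true) = g (j, true) * g (i, e).
  by case: e => //; apply: (@comm_flip i true).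
by case: d => //; symmetry; apply: (@comm_flip j true).
Qed.

Let near i e d : (0 < i < 4)%N ->
  g (i, e) * g (i.+1, d) * g (i, ~~ e) =
  g (i.+1, ~~ e) * g (i, d) * g (i.+1, e).
Proof.
move=> hi.
have hi5 : (0 < i < 5)%N by case/andP: hi => -> h; rewrite (ltn_trans h).
have hj5 : (0 < i.+1 < 5)%N by case/andP: hi.
have N := ok_near H hi; have [a b] := (ok_st H hi5, ok_st H hj5).
have [a' b'] := (ok_ts H hi5, ok_ts H hj5).
have base f : g (i, true) * g (i.+1, f) * g (i, false) =
              g (i.+1, false) * g (i, f) * g (i.+1, true).
  have Nf : g (i.+1, true) * g (i, true) * g (i.+1, f) =
            g (i, f) * g (i.+1, true) * g (i, true).
    case: f; rewrite /g /=; first by rewrite N.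
    have -> : s i.+1 * s i * t i.+1 = t i * (s i * s i.+1 * s i) * t i.+1.
      by rewrite !mulrA a' mul1r.
    by rewrite N -!mulrA b mulr1.
  apply: (@ginj i.+1 true) => //.
  by rewrite !mulrA Nf /g /= b mul1r -!mulrA a mulr1.
case: e; first exact: base.
have Nd : g (i.+1, d) * g (i, true) * g (i.+1, true) =
          g (i, true) * g (i.+1, true) * g (i, d).
  case: d; rewrite /g /=; first by rewrite N.
  have -> : s i * s i.+1 * t i = t i.+1 * (s i.+1 * s i * s i.+1) * t i.
    by rewrite !mulrA b' mul1r.
  by rewrite -N -!mulrA a mulr1.
apply: (@ginj i true) => //.
have -> : g (i, true) * (g (i, false) * g (i.+1, d) * g (i, ~~ false)) =
    g (i.+1, d) * g (i, true) by rewrite !mulrA /g /= a mul1r.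
rewrite !mulrA -Nd -!mulrA /g /= b mulr1.
by [].
Qed.

Lemma bev_conj i d v : (0 < i < 5)%N -> bvalid v ->
  all (fun x => (x.1 != i) && (x.1.+1 != i)) v ->
  g (i, d) * bev v = bev (conj_word i d v) * g (i, d).
Proof.
move=> hi; elim: v => [|[j e] v IH] /=; first by rewrite bev_nil mulr1 mul1r.
move=> /andP[hj hv] /andP[/andP[n1 n2] nv]; rewrite /conj_word /= bev_cat.
rewrite bev_cons -[RHS]mulrA -IH // !mulrA; congr (_ * _); case: ifP => [/eqP jE|n3].
  rewrite !bev_cons bev_nil mulr1 !mulrA {n1 n2}; subst j.
  have hi4 : (0 < i < 4)%N by case/andP: hi => ->; case/andP: hj.
  by rewrite -near // -!mulrA gVK // mulr1.
by rewrite bev_cons bev_nil mulr1 far // n3.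
Qed.

Lemma back_sound i e acc v r v' : bvalid acc ->
    all (fun x => (x.1 != i) && (x.1.+1 != i)) v ->
    back i e acc v = Some (r, v') ->
  catrev acc v = catrev r ((i, ~~ e) :: v') /\
  all (fun x => (x.1 != i) && (x.1.+1 != i)) v'.
Proof.
elim: acc v => [|[j d] acc IH] v //= /andP[hj hacc] hv.
case: eqP => [->|n1].
  by case: eqP => // -> [<- <-].
case: eqP => // n2 /(IH _ hacc) [] //=.
by rewrite hv andbT; apply/andP; split; apply/eqP.
Qed.

Lemma bvalid_catrev u v : bvalid (catrev u v) = bvalid u && bvalid v.
Proof. by rewrite catrevE /bvalid all_cat all_rev. Qed.
Lemma bvalid_conj i d v : (0 < i < 5)%N -> bvalid v -> bvalid (conj_word i d v).
Proof.
move=> hi; rewrite /bvalid /conj_word.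
elim: v => [|[j e] v IH] //= /andP[hj /IH hv]; rewrite all_cat hv andbT.
by case: eqP hj => [-> /= h|_ /= h]; rewrite ?hi ?h.
Qed.

Lemma hstep_sound acc w w' : bvalid acc -> bvalid w ->
  hstep acc w = Some w' -> bev w' = bev (catrev acc w) /\ bvalid w'.
Proof.
elim: w acc => [|[i e] w IH] acc //= hacc /andP[hi hw].
case E : back => [[r v]|]; last first.
  by move=> Ew; apply: (IH ((i, e) :: acc)) => //=; rewrite hi.
have [//|//|E1 E2] := back_sound _ _ E.
have hv : bvalid (catrev acc [::]) by rewrite bvalid_catrev hacc.
move: hv; rewrite E1 bvalid_catrev /= => /and3P[hr _ hv] [<-].
rewrite bvalid_catrev hr /= /bvalid all_cat -!/(bvalid _) bvalid_conj // hw.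
split=> //; rewrite !catrevE !bev_cat bev_cons.
have -> : bev (rev acc) = bev (rev r) * (g (i, ~~ e) * bev v).
  by rewrite -bev_cons -bev_cat -!catrevE -E1 catrevE cats0.
rewrite bev_conj // -!mulrA; congr (_ * (_ * _)).
by rewrite mulrA gVK // mul1r.
Qed.

Lemma hred_sound n w : bvalid w -> bev (hred n w) = bev w /\ bvalid (hred n w).
Proof.
elim: n w => [|n IH] w //= hw; case E : hstep => [w'|] //.
by have [//|//|<- /IH] := hstep_sound _ _ E.
Qed.

Lemma bred_sound w : bvalid w -> bev (bred w) = bev w /\ bvalid (bred w).
Proof. exact: hred_sound. Qed.

Lemma beq_sound u v : beq u v -> bev u = bev v.
Proof.
move=> /andP[/andP[hu hv] /nilP E].
have [|] := bred_sound (w := u ++ binv v).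
  by rewrite /bvalid all_cat -!/(bvalid _) bvalid_binv hu.
rewrite E bev_nil bev_cat => E' _.
by rewrite -[bev u]mulr1 -(bev_binvl hv) mulrA -E' mul1r.
Qed.

Section Atoms.
Variable (env : seq (bool * A)).

Fixpoint env_ok (e : seq (bool * A)) : Prop :=
  if e is (b, x) :: e' then (b -> x * s 4 = s 4 * x) /\ env_ok e' else True.

Let fl := unzip1 env.
Let at_ k := nth 1 (unzip2 env) k.

Definition lev (l : letter) : A :=
  match l with
  | LS i true => s i
  | LS i false => t i
  | LA k => nth 1 (unzip2 env) k
  end.

Fixpoint tev (e : tree) : A :=
  match e with TL l => lev l | TM a b => tev a * tev b | T1 => 1 end.

Definition wev (w : seq letter) : A := \prod_(l <- w) lev l.

Lemma tevE e : tev e = wev (flat e).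
Proof.
elim: e => [l|a IHa b IHb|] /=; rewrite ?IHa ?IHb /wev ?big_cat ?big_nil //.
by rewrite big_cons big_nil mulr1.
Qed.

Hypothesis eok : env_ok env.

Let at_comm k x : nth false fl k -> x.1 = 4%N -> at_ k * g x = g x * at_ k.
Proof.
case: x => _ e /= hk ->; rewrite /at_ /fl in hk *.
have E : nth 1 (unzip2 env) k * s 4 = s 4 * nth 1 (unzip2 env) k.
  elim: env k eok hk => [|[b x] en IH] [|k] //= [h1 h2] hk //.
    exact: h1.
  exact: IH.
case: e => //=; symmetry; apply: (@comm_flip 4 true) => //.
Qed.

Lemma at_comm_word k w : nth false fl k -> all (fun x => x.1 == 4) w ->
  at_ k * bev w = bev w * at_ k.
Proof.
move=> hk; elim: w => [|x w IH] /=; first by rewrite bev_nil mulr1 mul1r.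
move=> /andP[/eqP hx /IH {}IH]; rewrite bev_cons mulrA at_comm //.
by rewrite -!mulrA IH.
Qed.

Lemma chopE w : wev w = bev (chop w).1 *
  (if (chop w).2 is Some (k, w') then at_ k * wev w' else 1).
Proof.
elim: w => [|[i e|k] w IH] /=; first by rewrite /wev big_nil bev_nil mul1r.
  rewrite /wev big_cons -/(wev w) IH; case: (chop w) => u r /=.
  by rewrite bev_cons mulrA; case: e.
by rewrite /wev big_cons bev_nil mul1r.
Qed.

Lemma weq_sound n c w1 w2 : weq n fl c w1 w2 -> bev c * wev w1 = wev w2.
Proof.
elim: n c w1 w2 => [|n IH] c w1 w2 /=; rewrite (chopE w1) (chopE w2);
  case: (chop w1) => u [[k w1']|]; case: (chop w2) => v [[k' w2']|] //=.
- by move/beq_sound; rewrite !mulr1 bev_cat.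
- move=> /and4P[/eqP <- hcu hv /andP[hg /IH E]].
  have [|Eg hvg] := bred_sound (w := binv v ++ c ++ u).
    by rewrite /bvalid all_cat -!/(bvalid _) bvalid_binv hv.
  set gg := bred _ in hg E Eg hvg *.
  have cE : bev c * bev u = bev v * bev gg.
    by rewrite Eg !bev_cat [RHS]mulrA bev_binv ?mul1r.
  have aE : bev gg * at_ k = at_ k * bev gg.
    case/orP: hg => [/nilP ->|/andP[hk h4]]; first by rewrite bev_nil mulr1 mul1r.
    by rewrite at_comm_word.
  by rewrite mulrA cE -mulrA [bev gg * _]mulrA aE -[at_ k * _ * _]mulrA E.
- by move/beq_sound; rewrite !mulr1 bev_cat.
Qed.

Lemma braid_eval e1 e2 :
  weq 20 fl [::] (flat e1) (flat e2) -> tev e1 = tev e2.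
Proof. by move/weq_sound; rewrite bev_nil mul1r -!tevE. Qed.

End Atoms.
End BraidWords.

(** * Subalgebras generated by s_1, .., s_n and degree in s_4 *)

Section Filtration.
Variables (K : comNzRingType) (A : algType K) (s t : nat -> A).

(** The image of Q_(n+1): hence the later notations [B3] for [salg 2] and [B4] for [salg 3]. *)
Inductive salg (n : nat) : A -> Prop :=
| Salg1 : salg n 1
| SalgS i x : (0 < i <= n)%N -> salg n x -> salg n (x * s i)
| SalgT i x : (0 < i <= n)%N -> salg n x -> salg n (x * t i)
| SalgL c x y : salg n x -> salg n y -> salg n (c *: x + y).

(* Elements of degree at most k in s_4 and its inverse. *)
Inductive D : nat -> A -> Prop :=
| DB x : salg 3 x -> D 0 x
| Ds : D 1 (s 4)
| Dt : D 1 (t 4)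
| DM j k x y : D j x -> D k y -> D (j + k) (x * y)
| DL k c x y : D k x -> D k y -> D k (c *: x + y)
| DW j k x : D j x -> (j <= k)%N -> D k x.

Definition pw (i : nat) (x : A) : Prop := [\/ x = 1, x = s i | x = t i].

(** The module u_i u_j u_i, where u_i is spanned by 1, s_i and t_i. *)
Definition uuu_span (i j : nat) : A -> Prop := span (fun x =>
  exists a b c, [/\ pw i a, pw j b, pw i c & x = a * b * c]).

Lemma salg0 n : salg n 0.
Proof. by rewrite -[0](addNr (1 : A)) -scaleN1r; apply: SalgL; apply: Salg1. Qed.

Lemma salg_submod n : submod (salg n).
Proof. by split; [apply: salg0 | apply: SalgL]. Qed.

Lemma salgM n x y : salg n x -> salg n y -> salg n (x * y).
Proof.
move=> hx; elim=> [|i z hi _ IH|i z hi _ IH|c u v _ IHu _ IHv].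
- by rewrite mulr1.
- by rewrite mulrA; apply: SalgS.
- by rewrite mulrA; apply: SalgT.
- by rewrite mulrDr -scalerAr; apply: SalgL.
Qed.

Lemma salg_s n i : (0 < i <= n)%N -> salg n (s i).
Proof. by move=> hi; rewrite -[s i]mul1r; apply: SalgS => //; apply: Salg1. Qed.
Lemma salg_t n i : (0 < i <= n)%N -> salg n (t i).
Proof. by move=> hi; rewrite -[t i]mul1r; apply: SalgT => //; apply: Salg1. Qed.

Lemma salg_le n m x : salg n x -> (n <= m)%N -> salg m x.
Proof.
move=> hx nm; elim: hx => [|i z hi _ IH|i z hi _ IH|c u v _ IHu _ IHv].
- exact: Salg1.
- by apply: SalgS => //; lia.
- by apply: SalgT => //; lia.
- exact: SalgL.
Qed.

Lemma salg23 x : salg 2 x -> salg 3 x.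
Proof. by move/salg_le; apply. Qed.

Lemma D_submod k : submod (D k).
Proof.
split; last exact: DL.
by apply: (@DW 0) => //; apply/DB/salg0.
Qed.

Lemma uuu_submod i j : submod (uuu_span i j).
Proof. exact: span_submod. Qed.

Lemma pw_uuu i j a b c : pw i a -> pw j b -> pw i c -> uuu_span i j (a * b * c).
Proof. by move=> ha hb hc; apply: mem_span; exists a, b, c. Qed.

End Filtration.

(** * Tactics for membership, degree and braid identities *)

Ltac inB := solve [repeat first
  [ assumption | apply: Salg1 | apply: salgM
  | apply: salg_s; exact: erefl | apply: salg_t; exact: erefl
  | apply: salg23; assumption ]].

Ltac degE := first
  [ eassumption
  | apply: Ds | apply: Dt
  | apply: DB; inB
  | eapply DM; [degE | degE] ].
Ltac deg := solve [eapply DW; [degE | exact: erefl]].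

Ltac in_env x env :=
  lazymatch env with
  | nil => constr:(false)
  | cons (_, x) _ => constr:(true)
  | cons _ ?e => in_env x e
  end.
Ltac atom_idx x env :=
  lazymatch env with
  | cons (_, x) _ => constr:(0%N)
  | cons _ ?e => let n := atom_idx x e in constr:(S n)
  end.
Ltac atom_flag s t x :=
  match goal with
  | _ : salg s t 2 x |- _ => constr:(true)
  | _ => constr:(false)
  end.
Ltac collect s t x env :=
  lazymatch x with
  | ?a * ?b => let e := collect s t a env in collect s t b e
  | @GRing.one _ => env
  | s _ => env
  | t _ => env
  | _ => let b := in_env x env in
         lazymatch b with
         | true => env
         | false => let f := atom_flag s t x in constr:(cons (f, x) env)
         end
  end.
Ltac reify s t env x :=
  lazymatch x with
  | ?a * ?b => let u := reify s t env a in let v := reify s t env b in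
               constr:(TM u v)
  | @GRing.one _ => constr:(T1)
  | s ?i => constr:(TL (LS i true))
  | t ?i => constr:(TL (LS i false))
  | _ => let n := atom_idx x env in constr:(TL (LA n))
  end.

Section Comm.
Variables (K : comNzRingType) (A : algType K) (s t : nat -> A) (p q qi : K)
  (rv : A -> A).
Hypothesis H : ok s t p q qi rv.

Lemma salg2_comm h : salg s t 2 h -> h * s 4 = s 4 * h.
Proof.
elim=> [|i x hi _ IH|i x hi _ IH|c x y _ IHx _ IHy].
- by rewrite mul1r mulr1.
- have E : s i * s 4 = s 4 * s i by apply: (ok_far H); lia.
  by rewrite -mulrA E !mulrA IH.
- have E : s i * s 4 = s 4 * s i by apply: (ok_far H); lia.
  have hi5 : (0 < i < 5)%N by lia.
  have E' : t i * s 4 = s 4 * t i.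
    rewrite -[t i * _]mulr1 -(ok_st H hi5) -!mulrA (mulrA (s 4)) -E.
    by rewrite !mulrA (ok_ts H hi5) mul1r.
  by rewrite -mulrA E' !mulrA IH.
- by rewrite mulrDl mulrDr -scalerAl -scalerAr IHx IHy.
Qed.

End Comm.

Ltac env_solve H := first
  [ exact: I
  | split; [first [by move=> _; apply: (salg2_comm H) | by []] | env_solve H] ].

Ltac braid :=
  lazymatch goal with
  | H : @ok ?K ?A ?s ?t _ _ _ _ |- ?l = ?r =>
    let env0 := constr:(@nil (bool * GRing.Algebra.sort A)) in
    let env1 := collect s t l env0 in
    let env := collect s t r env1 in
    let e1 := reify s t env l in
    let e2 := reify s t env r in
    change (tev s t env e1 = tev s t env e2);
    apply: (braid_eval H); [env_solve H | vm_compute; reflexivity]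
  end.

(* Equalities between K-linear combinations, checked coefficient by coefficient. *)
Inductive lexp (K : Type) :=
| LV of nat | LAdd of lexp K & lexp K | LOpp of lexp K | LZ | LSc of K & lexp K.
Arguments LV {K}.
Arguments LZ {K}.

Section LinearCombinations.
Variables (K : comNzRingType) (A : lmodType K) (env : seq A).

Fixpoint lexp_eval (e : lexp K) : A :=
  match e with
  | LV k => nth 0 env k
  | LAdd a b => lexp_eval a + lexp_eval b
  | LOpp a => - lexp_eval a
  | LZ => 0
  | LSc c a => c *: lexp_eval a
  end.

Fixpoint coef (k : nat) (e : lexp K) : K :=
  match e with
  | LV j => if j == k then 1 else 0
  | LAdd a b => coef k a + coef k b
  | LOpp a => - coef k a
  | LZ => 0
  | LSc c a => c * coef k a
  end.

Lemma lexp_evalE e : lexp_eval e = \sum_(k < size env) coef k e *: env`_k.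
Proof.
elim: e => [j|a IHa b IHb|a IHa||c a IHa] /=; rewrite ?IHa ?IHb.
- case: (ltnP j (size env)) => hj.
    rewrite (bigD1 (Ordinal hj)) //= eqxx scale1r big1 ?addr0 // => k /negPf.
    by rewrite -val_eqE /= eq_sym => ->; rewrite scale0r.
  rewrite nth_default // big1 // => k _.
  by case: eqP => [jk|_]; rewrite ?scale0r //; move: hj; rewrite jk leqNgt ltn_ord.
- by rewrite -big_split /=; apply: eq_bigr => k _; rewrite scalerDl.
- by rewrite -sumrN; apply: eq_bigr => k _; rewrite scaleNr.
- by rewrite big1 // => k _; rewrite scale0r.
- by rewrite scaler_sumr; apply: eq_bigr => k _; rewrite scalerA.
Qed.

Fixpoint coefs_eq (n : nat) (a b : lexp K) : Prop :=
  if n is k.+1 then coef k a = coef k b /\ coefs_eq k a b else True.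

Lemma lexp_eq a b : coefs_eq (size env) a b -> lexp_eval a = lexp_eval b.
Proof.
rewrite !lexp_evalE => E; apply: eq_bigr => -[k hk] _ /=; congr (_ *: _).
elim: (size env) hk E => //= n IH; rewrite ltnS leq_eqVlt => /orP[/eqP <- []//|].
by move=> hk [_ /(IH hk)].
Qed.

(** Derives an identity from a known relation l = r scaled by c; what remains is formal in the
    monomials and is left to [lmod]. *)
Lemma eq_from (c : K) (l r x y : A) : l = r -> x - y = c *: (l - r) -> x = y.
Proof. by move=> ->; rewrite subrr scaler0 => /eqP; rewrite subr_eq0 => /eqP. Qed.

End LinearCombinations.

Ltac same x y :=
  match goal with
  | _ => let u := match goal with _ => unify x y end in constr:(true)
  | _ => constr:(false)
  end.
Ltac lin_in x env :=
  lazymatch env with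
  | nil => constr:(false)
  | cons ?y ?e => let b := same x y in
    lazymatch b with true => constr:(true) | false => lin_in x e end
  end.
Ltac lin_idx x env :=
  lazymatch env with
  | cons ?y ?e => let b := same x y in
    lazymatch b with
    | true => constr:(0%N)
    | false => let n := lin_idx x e in constr:(S n)
    end
  end.
Ltac lin_collect x env :=
  lazymatch x with
  | ?a + ?b => let e := lin_collect a env in lin_collect b e
  | - ?a => lin_collect a env
  | ?c *: ?a => lin_collect a env
  | 0 => env
  | _ => let b := lin_in x env in
         lazymatch b with true => env | false => constr:(cons x env) end
  end.
Ltac lin_reify K env x :=
  lazymatch x with
  | ?a + ?b => let u := lin_reify K env a in let v := lin_reify K env b in
               constr:(@LAdd K u v)
  | - ?a => let u := lin_reify K env a in constr:(@LOpp K u)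
  | ?c *: ?a => let u := lin_reify K env a in constr:(@LSc K c u)
  | 0 => constr:(@LZ K)
  | _ => let n := lin_idx x env in constr:(@LV K n)
  end.
Ltac lmod K :=
  lazymatch goal with
  | |- @eq ?T ?l ?r =>
    let env0 := constr:(@nil T) in
    let env1 := lin_collect l env0 in
    let env := lin_collect r env1 in
    let e1 := lin_reify K env l in
    let e2 := lin_reify K env r in
    change (lexp_eval env e1 = lexp_eval env e2);
    apply: lexp_eq; rewrite /=; repeat split;
    first [ring | match goal with Q : _ * _ = 1 |- _ => ring: Q end]
  end.

Lemma scale_mull (K : comNzRingType) (A : algType K) (c : K) (x y : A) :
  (c *: x) * y = c *: (x * y).
Proof. by rewrite scalerAl. Qed.
Lemma scale_mulr (K : comNzRingType) (A : algType K) (c : K) (x y : A) :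
  x * (c *: y) = c *: (x * y).
Proof. by rewrite scalerAr. Qed.

Definition expandE := (mulrDl, mulrDr, mulNr, mulrN, scale_mull, scale_mulr,
  mulr1, mul1r, mulrA).
Ltac expand := rewrite ?expandE.
Ltac expand_in E := rewrite ?expandE in E.

(** * Two adjacent generators *)

Inductive adj : nat -> nat -> Prop :=
| adj12 : adj 1 2 | adj21 : adj 2 1 | adj23 : adj 2 3 | adj32 : adj 3 2
| adj34 : adj 3 4 | adj43 : adj 4 3.

Ltac uin :=
  rewrite ?mulr1 ?mul1r;
  lazymatch goal with |- uuu_span _ _ _ _ ?m => first
  [ by apply: pw_uuu
  | by have -> : m = m * 1 * 1 by [rewrite !mulr1]; apply: pw_uuu
  | by have -> : m = 1 * m * 1 by [rewrite mul1r mulr1]; apply: pw_uuu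
  | by have -> : m = 1 * m by [rewrite mul1r]; rewrite !mulrA; apply: pw_uuu
  | by rewrite -[m]mulr1; apply: pw_uuu ]
  end.

Ltac spanP sP := repeat first
  [ assumption | apply: (sub0 sP) | apply: (subB sP) | apply: (subD sP) | apply: (subN sP)
  | apply: (subZ sP) ].

Section TwoGenerators.
Variables (K : comNzRingType) (A : algType K) (s t : nat -> A) (p q qi : K)
  (rv : A -> A).
Hypothesis H : ok s t p q qi rv.
Implicit Types (i j : nat) (a b c x y z : A).
Local Notation pw := (pw s t).
Local Notation uuu := (uuu_span s t).
Local Notation XX i j := (s j * t i * s j).
Local Notation YY i j := (t j * s i * t j).

(** Multiplying the relation for s_i^2 by t_i expresses q t_i^2 through 1, t_i and s_i, and q is a
    unit. *)
Lemma ok_tt i : (0 < i < 5)%N ->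
  t i * t i = ((p + q) * qi) *: t i - ((p + 1) * qi) *: 1 + qi *: s i.
Proof.
move=> hi; have E := congr1 (fun z => t i * z) (ok_sq H hi).
expand_in E; rewrite (ok_ts H hi) mul1r in E.
apply: (eq_from (c := - qi) E).
have Q := ok_q H.
lmod K.
Qed.

Lemma pw1 i : pw i 1. Proof. exact: Or31. Qed.
Lemma pws i : pw i (s i). Proof. exact: Or32. Qed.
Lemma pwt i : pw i (t i). Proof. exact: Or33. Qed.
Hint Resolve pw1 pws pwt : core.

Lemma pw_mul i a b : (0 < i < 5)%N -> pw i a -> pw i b -> span (pw i) (a * b).
Proof.
move=> hi ha hb; have sP := span_submod (pw i).
have in1 x : pw i x -> span (pw i) x by apply: mem_span.
case: ha => [->|->|->]; case: hb => [->|->|->];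
  rewrite ?mul1r ?mulr1 ?(ok_sq H hi) ?(ok_tt hi) ?(ok_st H hi) ?(ok_ts H hi);
  auto; apply: (subD sP); (try apply: (subB sP)); apply: (subZ sP); auto.
Qed.

Lemma adj_lt i j : adj i j -> (0 < i < 5)%N /\ (0 < j < 5)%N.
Proof. by case. Qed.

Lemma uuu_lr i j a x c : adj i j -> pw i a -> pw i c -> uuu i j x ->
  uuu i j (a * x * c).
Proof.
move=> /adj_lt[hi _] ha hc; have sP := uuu_submod s t i j.
move: x; apply: (span_sub (submod_lr sP a c)) => x [a' [b [c' [ha' hb hc' ->]]]].
rewrite !mulrA -[_ * c' * c]mulrA.
move: (pw_mul hi ha ha'); move: (a * a').
have sP1 := submod_lr sP 1 (b * (c' * c)).
suff E u : pw i u -> uuu i j (1 * u * (b * (c' * c))).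
  by move=> u /(span_sub sP1 E); rewrite mul1r mulrA.
move=> hu; rewrite mul1r mulrA.
move: (pw_mul hi hc' hc); move: (c' * c).
have sP2 := submod_lr sP (u * b) 1.
suff E v : pw i v -> uuu i j (u * b * v * 1).
  by move=> v /(span_sub sP2 E); rewrite mulr1.
by move=> hv; rewrite mulr1; apply: pw_uuu.
Qed.

(** Collected here because [braid] needs numerals as indices: the cases on the pair are made once,
    and the sequel can keep i and j abstract. *)
Lemma adj_words i j : adj i j ->
  [/\ [/\ s j * s i * s j * t i = s i * s j, s j * s i * t j * t i = t i * s j,
          s j * t i * t j * s i = t i * t j * (s i * s i) &
          s j * s i * s j = s i * s j * s i],
      [/\ s j * s i * t j = t i * s j * s i, s j * t j * s i = s i,
          s j * t j * t i = t i & s j * t i * t j = t i * t j * s i] &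
      [/\ s j * t i * s j * s i = s j * s j * s i * t j,
          s i * (s j * t i * s j) = t j * s i * (s j * s j) &
          t j * s i * s j = s i * s j * t i]].
Proof. by case; split; split; braid. Qed.

(** Multiply the cross relation by s_j on the left. Braid relations bring every term into u_i u_j
    u_i except s_j t_i s_j s_i on one side and s_j t_i s_j on the other. *)
Lemma uuu_Xs i j : adj i j -> uuu i j (XX i j * s i - XX i j).
Proof.
move=> ij; have [hi hj] := adj_lt ij.
have [[m1 m2 m4 n1] [n2 n4 n6 n8] _] := adj_words ij.
have ji : (j == i.+1) || (i == j.+1) by case: ij.
have E := congr1 (fun z => s j * z) (ok_cross H hi hj ji).
expand_in E; rewrite m1 m2 m4 n1 n2 n4 n6 n8 (ok_sq H hi) (ok_sq H hj) in E.
expand_in E.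
have -> : XX i j * s i - XX i j =
  s i * s j - t i * s j
  + ((p + 1) *: (t i * t j * s i) - (p + q) *: (t i * t j) + q *: (t i * t j * t i))
  - s i * s j * s i + t i * s j * s i
  + ((p + 1) *: (s j * s i) - (p + q) *: s i + q *: (t j * s i)) - s i
  - ((p + 1) *: (s j * t i) - (p + q) *: t i + q *: (t j * t i)) + t i
  - t i * t j * s i.
  apply: (eq_from (c := -1) E). lmod K.
spanP (uuu_submod s t i j); uin.
Qed.

Lemma q_sub P x : submod P -> P (q *: x) -> P x.
Proof.
by move=> sP Px; rewrite -[x]scale1r -(ok_q H) mulrC -scalerA; apply: subZ.
Qed.

Section Adjacent.
Variables i j : nat.
Hypothesis ij : adj i j.
Let hi : (0 < i < 5)%N. Proof. by case: (adj_lt ij). Qed.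
Let hj : (0 < j < 5)%N. Proof. by case: (adj_lt ij). Qed.
Let sU : submod (uuu i j). Proof. exact: uuu_submod. Qed.

(** By braid relations s_j t_i s_j s_i = s_j^2 s_i t_j, and expanding s_j^2 leaves q t_j s_i t_j
    modulo u_i u_j u_i; the left side is congruent to s_j t_i s_j by [uuu_Xs]. *)
Lemma uuu_XY : uuu i j (XX i j - q *: YY i j).
Proof.
have [_ [n2 _ _ _] [x1 _ _]] := adj_words ij; have Q := ok_q H.
have E := x1; rewrite (ok_sq H hj) in E; expand_in E; rewrite n2 in E.
have -> : XX i j - q *: YY i j = - (XX i j * s i - XX i j)
    + (p + 1) *: (t i * s j * s i) - (p + q) *: (s i * t j).
  by apply: (eq_from (c := 1) E); lmod K.
by have h := uuu_Xs ij; spanP sU; uin.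
Qed.

Lemma uuu_sX : uuu i j (s i * XX i j - XX i j).
Proof.
have [_ _ [_ x2 x3]] := adj_words ij; have Q := ok_q H.
have E := x2; rewrite (ok_sq H hj) in E; expand_in E; rewrite x3 in E.
rewrite !mulrA; have -> : s i * s j * t i * s j - XX i j = - (XX i j - q *: YY i j)
    + (p + 1) *: (s i * s j * t i) - (p + q) *: (t j * s i).
  by apply: (eq_from (c := 1) E); lmod K.
by have h := uuu_XY; spanP sU; uin.
Qed.

Lemma uuu_XR c : pw i c -> uuu i j (XX i j * c - XX i j).
Proof.
case=> ->; first by rewrite mulr1 subrr; apply: sub0.
  exact: (uuu_Xs ij).
have := uuu_lr ij (pw1 i) (pwt i) (uuu_Xs ij); rewrite mul1r mulrBl -[_ * s i * t i]mulrA.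
by rewrite (ok_st H hi) mulr1; apply: sub_mods.
Qed.

Lemma uuu_XL c : pw i c -> uuu i j (c * XX i j - XX i j).
Proof.
case=> ->; first by rewrite mul1r subrr; apply: sub0.
  exact: uuu_sX.
have := uuu_lr ij (pwt i) (pw1 i) uuu_sX; rewrite mulr1 mulrBr [t i * (s i * _)]mulrA.
by rewrite (ok_ts H hi) mul1r; apply: sub_mods.
Qed.

Lemma uuu_YR c : pw i c -> uuu i j (YY i j * c - YY i j).
Proof.
move=> hc; apply: (q_sub sU); have := uuu_lr ij (pw1 i) hc uuu_XY.
have := uuu_XR hc; have := uuu_XY; rewrite mul1r => h1 h2 h3.
have -> : q *: (YY i j * c - YY i j) =
  (XX i j * c - XX i j) + (XX i j - q *: YY i j) - (XX i j - q *: YY i j) * c.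
  by expand; lmod K.
by spanP sU.
Qed.

Lemma uuu_YL c : pw i c -> uuu i j (c * YY i j - YY i j).
Proof.
move=> hc; apply: (q_sub sU); have := uuu_lr ij hc (pw1 i) uuu_XY.
have := uuu_XL hc; have := uuu_XY; rewrite mulr1 => h1 h2 h3.
have -> : q *: (c * YY i j - YY i j) =
  (c * XX i j - XX i j) + (XX i j - q *: YY i j) - c * (XX i j - q *: YY i j).
  by expand; lmod K.
by spanP sU.
Qed.

Lemma adj_words2 : [/\ t j * t i * s j = s i * t j * t i & t j * t i * t j = t i * t j * t i].
Proof. by case: ij; split; braid. Qed.

(** Braid relations turn every word of u_j u_i u_j into one of u_i u_j u_i, except s_j t_i s_j and
    t_j s_i t_j; by [uuu_XY] the second is q^-1 times the first. *)
Lemma uuu_triple a b c : pw j a -> pw i b -> pw j c ->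
  exists k : K, uuu i j (a * b * c - k *: XX i j).
Proof.
have U x : uuu i j x -> exists k : K, uuu i j (x - k *: XX i j).
  by exists 0; rewrite scale0r subr0.
have [[_ _ _ n1] [n2 _ _ n8] [_ _ x3]] := adj_words ij.
have [y1 y2] := adj_words2.
have J x y : pw j x -> pw j y -> uuu i j (x * y).
  move=> hx hy; have := pw_mul hj hx hy.
  by apply: (span_sub sU) => z hz; uin.
move=> ha hb hc; case: hb => ->; first by apply: U; rewrite mulr1; apply: J.
- case: ha => ->; first by apply: U; rewrite mul1r; uin.
    case: hc => ->; apply: U; [uin|by rewrite n1; uin|by rewrite n2; uin].
  case: hc => ->; [by apply: U; uin|by apply: U; rewrite x3; uin|].
  exists qi; apply: (q_sub sU); have := uuu_XY; have Q := ok_q H.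
  have -> : q *: (YY i j - qi *: XX i j) = - (XX i j - q *: YY i j) by lmod K.
  exact: subN.
- case: ha => ->; first by apply: U; rewrite mul1r; uin.
    case: hc => ->; first by apply: U; uin.
      by exists 1; rewrite scale1r subrr; apply: sub0.
    by apply: U; rewrite n8; uin.
  by case: hc => ->; apply: U; [uin|rewrite y1; uin|rewrite y2; uin].
Qed.

Let Xd (d : A) : pw j d -> exists k : K, uuu i j (XX i j * d - k *: XX i j).
Proof.
have [_ [_ _ _ n8] _] := adj_words ij.
case=> ->; first by exists 1; rewrite mulr1 scale1r subrr; apply: sub0.
  exists (p + 1); rewrite -mulrA (ok_sq H hj); expand; rewrite n8.
  have -> : (p + 1) *: XX i j - (p + q) *: (s j * t i) + q *: (t i * t j * s i)
    - (p + 1) *: XX i j = q *: (t i * t j * s i) - (p + q) *: (s j * t i) by lmod K.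
  by spanP sU; uin.
exists 0; rewrite scale0r subr0 -mulrA (ok_st H hj) mulr1; uin.
Qed.

(** That is, Q_3 = u_i u_j u_i + K s_j t_i s_j for {i, j} = {1, 2}. The right side contains 1, so
    stability under right multiplication by the generators is enough. *)
Lemma salg2_dec x : ((i <= 2) && (j <= 2))%N -> salg s t 2 x ->
  exists k : K, uuu i j (x - k *: XX i j).
Proof.
move=> ij2; pose P x := exists k : K, uuu i j (x - k *: XX i j).
have sP : submod P.
  split=> [|c u v [k hk] [l hl]]; first by exists 0; rewrite scale0r subr0; apply: sub0.
  exists (c * k + l).
  have -> : c *: u + v - (c * k + l) *: XX i j =
    c *: (u - k *: XX i j) + (v - l *: XX i j) by lmod K.
  by spanP sU.
have UP u : uuu i j u -> P u by exists 0; rewrite scale0r subr0.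
have XP : P (XX i j) by exists 1; rewrite scale1r subrr; apply: sub0.
have Pc u c : pw i c -> P u -> P (u * c).
  move=> hc [k hk]; exists k; have := uuu_lr ij (pw1 i) hc hk; rewrite mul1r.
  have h := uuu_XR hc; move=> h2.
  have -> : u * c - k *: XX i j = (u - k *: XX i j) * c + k *: (XX i j * c - XX i j).
    by expand; lmod K.
  by spanP sU.
have Pa u c : pw i c -> P u -> P (c * u).
  move=> hc [k hk]; exists k; have := uuu_lr ij hc (pw1 i) hk; rewrite mulr1.
  have h := uuu_XL hc; move=> h2.
  have -> : c * u - k *: XX i j = c * (u - k *: XX i j) + k *: (c * XX i j - XX i j).
    by expand; lmod K.
  by spanP sU.
have Pd u d : pw j d -> P u -> P (u * d).
  move=> hd [k hk].
  have -> : u * d = 1 * (u - k *: XX i j) * d + k *: (XX i j * d) by expand; lmod K.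
  apply: (subD sP); last by apply: (subZ sP); apply: Xd.
  (* For a word a b c of u_i u_j u_i, the product b c d is a word of u_j u_i u_j, covered by
     [uuu_triple]; the factor a is then put back by [Pa]. *)
  move: (u - _) hk; apply: (span_sub (submod_lr sP 1 d)) => z [a [b [c [ha hb hc ->]]]].
  by rewrite mul1r -!mulrA; apply: Pa; rewrite // mulrA; apply: uuu_triple.
have mem m : (0 < m <= 2)%N -> m = i \/ m = j by move: ij2; case: ij => //; lia.
elim=> [|m u hm _ IH|m u hm _ IH|c u v _ IHu _ IHv].
- apply: UP; uin.
- by case: (mem _ hm) => ->; [apply: Pc|apply: Pd].
- by case: (mem _ hm) => ->; [apply: Pc|apply: Pd].
- exact: sP.2.
Qed.

End Adjacent.
End TwoGenerators.

#[global] Hint Resolve pw1 pws pwt : core.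

(** * The Q_3-bimodule Q_4 *)

Section FourStrands.
Variables (K : comNzRingType) (A : algType K) (s t : nat -> A).

Definition Xe (i j : nat) : A := s j * t i * s j.
Definition Ye (i j : nat) : A := t j * s i * t j.
Definition Wp : A := s 3 * Xe 1 2 * s 3.
Definition Wm : A := t 3 * Ye 1 2 * t 3.

(* Q41, Q42 and Q43 are the sub-bimodules of Q_4 over Q_3 generated by u_3; by
   u_3 and x; by u_3, x, w_+ and w_-. *)
Inductive gen41 : A -> Prop :=
| Gen41 h v h' : salg s t 2 h -> pw s t 3 v -> salg s t 2 h' -> gen41 (h * v * h').
Inductive gen42 : A -> Prop :=
| Gen42 z : gen41 z -> gen42 z
| Gen42x h h' : salg s t 2 h -> salg s t 2 h' -> gen42 (h * Xe 2 3 * h').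
Inductive gen43 : A -> Prop :=
| Gen43 z : gen42 z -> gen43 z
| Gen43p h h' : salg s t 2 h -> salg s t 2 h' -> gen43 (h * Wp * h')
| Gen43m h h' : salg s t 2 h -> salg s t 2 h' -> gen43 (h * Wm * h').

Definition Q41 := span gen41.
Definition Q42 := span gen42.
Definition Q43 := span gen43.

Variables (p q qi : K) (rv : A -> A).
Hypothesis H : ok s t p q qi rv.
Local Notation pw := (pw s t).
Local Notation uuu := (uuu_span s t).
Local Notation B3 := (salg s t 2).

Lemma s41 : submod Q41. Proof. exact: span_submod. Qed.
Lemma s42 : submod Q42. Proof. exact: span_submod. Qed.
Lemma s43 : submod Q43. Proof. exact: span_submod. Qed.

Lemma Q41_42 z : Q41 z -> Q42 z.
Proof. by apply: (span_sub s42) => y hy; apply: mem_span; apply: Gen42. Qed.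
Lemma Q42_43 z : Q42 z -> Q43 z.
Proof. by apply: (span_sub s43) => y hy; apply: mem_span; apply: Gen43. Qed.
Lemma Q41_43 z : Q41 z -> Q43 z. Proof. by move/Q41_42/Q42_43. Qed.

Lemma pw_B3 i a : (0 < i <= 2)%N -> pw i a -> B3 a.
Proof.
by move=> hi [->|->|->]; [apply: Salg1|apply: salg_s|apply: salg_t].
Qed.

Lemma Q41_lr h z h' : B3 h -> B3 h' -> Q41 z -> Q41 (h * z * h').
Proof.
move=> hh hh'; move: z; apply: (span_sub (submod_lr s41 h h')) => z [a v b ha hv hb].
by rewrite !mulrA -[_ * b * h']mulrA; apply: mem_span; apply: Gen41 => //; apply: salgM.
Qed.

Lemma Q42_lr h z h' : B3 h -> B3 h' -> Q42 z -> Q42 (h * z * h').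
Proof.
move=> hh hh'; move: z; apply: (span_sub (submod_lr s42 h h')) => z [y hy|a b ha hb].
  by apply: Q41_42; apply: Q41_lr => //; apply: mem_span.
have -> : h * (a * Xe 2 3 * b) * h' = (h * a) * Xe 2 3 * (b * h') by rewrite !mulrA.
by apply: mem_span; apply: Gen42x; apply: salgM.
Qed.

Lemma Q43_lr h z h' : B3 h -> B3 h' -> Q43 z -> Q43 (h * z * h').
Proof.
move=> hh hh'; move: z; apply: (span_sub (submod_lr s43 h h')) => z [y hy|a b ha hb|a b ha hb].
- by apply: Q42_43; apply: Q42_lr => //; apply: mem_span.
- have -> : h * (a * Wp * b) * h' = (h * a) * Wp * (b * h') by rewrite !mulrA.
  by apply: mem_span; apply: Gen43p; apply: salgM.
- have -> : h * (a * Wm * b) * h' = (h * a) * Wm * (b * h') by rewrite !mulrA.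
  by apply: mem_span; apply: Gen43m; apply: salgM.
Qed.

Section Induction.
Variable P : A -> Prop.
Hypothesis sP : submod P.

Lemma uuu_ind i j l x r : (forall a b c, pw i a -> pw j b -> pw i c ->
  P (l * (a * b * c) * r)) -> uuu i j x -> P (l * x * r).
Proof.
move=> h; move: x; apply: (span_sub (submod_lr sP l r)) => z [a [b [c [ha hb hc ->]]]].
exact: h.
Qed.

Lemma pw_span_ind i l x r : (forall a, pw i a -> P (l * a * r)) ->
  span (pw i) x -> P (l * x * r).
Proof. by move=> h; move: x; apply: (span_sub (submod_lr sP l r)). Qed.

Lemma sub_modlr l x y r : P (l * (x - y) * r) -> P (l * y * r) -> P (l * x * r).
Proof. by move=> h1 h2; apply: (sub_mod sP) h2; rewrite -mulrBl -mulrBr. Qed.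

(** This and the next two principles rewrite a middle factor between arbitrary l and r; they leave
    the words of u_i u_j u_i and one exceptional element to be examined. *)
Lemma triple_ind i j l a b c r : adj i j -> pw j a -> pw i b -> pw j c ->
  (forall a b c, pw i a -> pw j b -> pw i c -> P (l * (a * b * c) * r)) ->
  P (l * Xe i j * r) -> P (l * (a * b * c) * r).
Proof.
move=> ij ha hb hc hu hX; have [k hk] := uuu_triple H ij ha hb hc.
apply: (sub_modlr (y := k *: Xe i j)); first exact: uuu_ind hk.
by rewrite scale_mulr scale_mull; apply: subZ.
Qed.

Lemma dec_ind i j l h r : adj i j -> ((i <= 2) && (j <= 2))%N ->
  (forall a b c, pw i a -> pw j b -> pw i c -> P (l * (a * b * c) * r)) ->
  P (l * Xe i j * r) -> B3 h -> P (l * h * r).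
Proof.
move=> ij ij2 hu hX /(salg2_dec H ij ij2)[k hk].
apply: (sub_modlr (y := k *: Xe i j)); first exact: uuu_ind hk.
by rewrite scale_mulr scale_mull; apply: subZ.
Qed.

Lemma XY_ind i j l r : adj i j ->
  (forall a b c, pw i a -> pw j b -> pw i c -> P (l * (a * b * c) * r)) ->
  P (l * Ye i j * r) -> P (l * Xe i j * r).
Proof.
move=> ij hu hX; apply: (sub_modlr (y := q *: Ye i j)).
  exact: uuu_ind (uuu_XY H ij).
by rewrite scale_mulr scale_mull; apply: subZ.
Qed.

End Induction.

Lemma pw13 a v : pw 1 a -> pw 3 v -> v * a = a * v.
Proof.
by case=> ->; case=> ->; rewrite ?mul1r ?mulr1 //; braid.
Qed.

Let P1 a : pw 1 a -> B3 a. Proof. exact: pw_B3. Qed.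
Let P2 a : pw 2 a -> B3 a. Proof. exact: pw_B3. Qed.

Lemma Q41I h v h' : B3 h -> pw 3 v -> B3 h' -> Q41 (h * v * h').
Proof. by move=> *; apply: mem_span; apply: Gen41. Qed.
Lemma Q42x h h' : B3 h -> B3 h' -> Q42 (h * Xe 2 3 * h').
Proof. by move=> *; apply: mem_span; apply: Gen42x. Qed.

Lemma u3uuu_Q42 v d r : pw 3 v -> pw 3 d -> uuu 1 2 r -> Q42 (v * r * d).
Proof.
move=> hv hd; apply: (uuu_ind s42) => a b c ha hb hc.
have -> : v * (a * b * c) * d = a * (v * b * d) * c.
  by rewrite !mulrA (pw13 ha hv) -!mulrA (pw13 hc hd).
apply: (triple_ind s42 adj23) => // [a' b' c' ha' hb' hc'|].
  apply: Q41_42; have -> : a * (a' * b' * c') * c = (a * a') * b' * (c' * c).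
    by rewrite !mulrA.
  by apply: Q41I => //; apply: salgM; auto.
by apply: Q42x; auto.
Qed.

(** Here w_+ and w_- appear. With h in u_1 u_2 u_1, the factors of u_1 commute with u_3 and leave
    u_3 u_2 u_3. With h = s_2 t_1 s_2, opposite signs of v and d give a conjugate of x by braid
    relations, and equal signs give w_+ or w_-. *)
Lemma u3B3u3 v h d : pw 3 v -> B3 h -> pw 3 d -> Q43 (v * h * d).
Proof.
move=> hv hh hd; move: hh; apply: (dec_ind s43 adj12) => // [a b c ha hb hc|].
  by apply: Q42_43; apply: u3uuu_Q42 => //; apply: pw_uuu.
have hX : B3 (Xe 1 2) by rewrite /Xe; inB.
have h1 : B3 1 by apply: Salg1.
have d1 e : pw 3 e -> Q43 (e * Xe 1 2 * 1).
  have -> : e * Xe 1 2 * 1 = 1 * e * Xe 1 2 by rewrite mul1r mulr1.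
  by move=> he; apply: Q41_43; apply: Q41I.
case: hv => ->.
- have -> : 1 * Xe 1 2 * d = Xe 1 2 * d * 1 by rewrite mul1r mulr1.
  by apply: Q41_43; apply: Q41I.
- case: hd => ->; first exact: d1.
    by rewrite -/Wp -[Wp]mul1r -[1 * _]mulr1; apply: mem_span; apply: Gen43p.
  have -> : s 3 * Xe 1 2 * t 3 = (t 2 * t 1) * Xe 2 3 * (s 1 * s 2).
    by rewrite /Xe; braid.
  apply: Q42_43; apply: Q42x; inB.
case: hd => ->; first exact: d1.
  have -> : t 3 * Xe 1 2 * s 3 = (s 2 * s 1) * Xe 2 3 * (t 1 * t 2).
    by rewrite /Xe; braid.
  by apply: Q42_43; apply: Q42x; inB.
(* Between two letters t_3, the middle has to become t_2 s_1 t_2 to form w_-. *)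
apply: (XY_ind s43 adj12) => [a b c ha hb hc|].
  by apply: Q42_43; apply: u3uuu_Q42 => //; apply: pw_uuu.
by rewrite -/Wm -[Wm]mul1r -[1 * _]mulr1; apply: mem_span; apply: Gen43m.
Qed.

Lemma Q41_u3 z d : pw 3 d -> Q41 z -> Q43 (z * d).
Proof.
move=> hd /(span_sub (submod_lr s43 1 d)) h; rewrite -[z]mul1r; apply: h => {}z.
case=> a v b ha hv hb; have -> : 1 * (a * v * b) * d = a * (v * b * d) * 1.
  by rewrite mul1r mulr1 !mulrA.
by apply: Q43_lr => //; [exact: Salg1|exact: u3B3u3].
Qed.

Lemma uuu23_Q41 r : uuu 2 3 r -> Q41 r.
Proof. by apply: (span_sub s41) => _ [a [b [c [ha hb hc ->]]]]; apply: Q41I; auto. Qed.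

Lemma u3B3Q41 v h z h' : pw 3 v -> B3 h -> Q41 z -> B3 h' -> Q43 (v * h * z * h').
Proof.
move=> hv hh hz hh'; move: z hz; apply: (span_sub (submod_lr s43 (v * h) h')).
move=> _ [a w b ha hw hb].
have -> : v * h * (a * w * b) * h' = 1 * (v * (h * a) * w) * (b * h').
  by rewrite !mulrA mul1r.
apply: Q43_lr; [exact: Salg1|exact: salgM|].
by apply: u3B3u3 => //; apply: salgM.
Qed.

Lemma Q41B3u3 z h d : Q41 z -> B3 h -> pw 3 d -> Q43 (z * h * d).
Proof.
by move=> hz hh hd; apply: Q41_u3 => //; rewrite -[z]mul1r; apply: Q41_lr => //; apply: Salg1.
Qed.

(** As a commutes with s_3, the last letter of x meets b d. The word s_3 b d lies in u_2 u_3 u_2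
    unless it is x itself; in that case x on the left is replaced by q t_3 s_2 t_3, and t_3 t_2 s_3
    = s_2 t_3 t_2 removes the obstruction. *)
Lemma x_uu_u3 a b d : pw 1 a -> pw 2 b -> pw 3 d -> Q43 (Xe 2 3 * a * b * d).
Proof.
move=> ha hb hd; have [hA hB] := (P1 ha, P2 hb).
have [hbt|hbt] : (b = t 2 /\ d = s 3) \/ uuu 2 3 (s 3 * b * d).
- have U m : uuu 2 3 m -> b = t 2 /\ d = s 3 \/ uuu 2 3 m by right.
  have J x y : pw 3 x -> pw 3 y -> uuu 2 3 (x * y).
    move=> hx hy; have := pw_mul H (i := 3) isT hx hy.
    by apply: (span_sub (uuu_submod s t 2 3)) => z hz; uin.
  case: hb => ->; first by right; rewrite mulr1; apply: J.
    case: hd => ->; right; [uin| |].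
      have -> : s 3 * s 2 * s 3 = s 2 * s 3 * s 2 by braid. uin.
    have -> : s 3 * s 2 * t 3 = t 2 * s 3 * s 2 by braid. uin.
  case: hd => ->; [right; uin|by left|right].
  have -> : s 3 * t 2 * t 3 = t 2 * t 3 * s 2 by braid. uin.
- case: hbt => -> ->; have -> : Xe 2 3 * a * t 2 * s 3 = 1 * Xe 2 3 * (a * t 2 * s 3).
    by rewrite mul1r !mulrA.
  apply: (XY_ind s43 adj23) => [a' b' c' ha' hb' hc'|].
    have -> : 1 * (a' * b' * c') * (a * t 2 * s 3) = (a' * b' * c') * (a * t 2) * s 3.
      by rewrite mul1r !mulrA.
    apply: Q41B3u3 => //; last by inB.
    by apply: Q41I; auto.
  have -> : 1 * Ye 2 3 * (a * t 2 * s 3) = t 3 * (s 2 * a) * (s 2 * t 3 * t 2) * 1.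
    have E : t 3 * t 2 * s 3 = s 2 * t 3 * t 2 by braid.
    by rewrite mulr1 mul1r /Ye -!E !mulrA -[_ * t 3 * a]mulrA (pw13 ha (pwt _ _ 3)) !mulrA.
  apply: u3B3Q41 => //; [inB|apply: Q41I => //; inB|exact: Salg1].
have -> : Xe 2 3 * a * b * d = s 3 * (t 2 * a) * (s 3 * b * d) * 1.
  by rewrite mulr1 /Xe !mulrA -[_ * s 3 * a]mulrA (pw13 ha (pws _ _ 3)) !mulrA.
by apply: u3B3Q41 => //; [inB|exact: uuu23_Q41|exact: Salg1].
Qed.

Lemma x_B3_u3 h d : B3 h -> pw 3 d -> Q43 (Xe 2 3 * h * d).
Proof.
move=> hh hd; move: hh; apply: (dec_ind s43 adj12) => // [a b c ha hb hc|].
  have -> : Xe 2 3 * (a * b * c) * d = 1 * (Xe 2 3 * a * b * d) * c.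
    by rewrite mul1r -!mulrA (pw13 hc hd) !mulrA.
  apply: Q43_lr; [exact: Salg1|by auto|exact: x_uu_u3].
have hX : B3 (Xe 1 2) by rewrite /Xe; inB.
have st12 (x : A) : pw 2 x -> B3 x by auto.
case: hd => ->.
- apply: Q42_43; rewrite mulr1 -[Xe 2 3]mul1r; apply: Q42x => //; exact: Salg1.
(* No braid relation applies to x s_2 t_1 s_2 s_3 directly. Exchanging the signs in x twice, with a
   braid relation in between, produces t_3 s_2^2 t_3; expanding s_2^2 leads back to [x_uu_u3]. *)
- rewrite -mulrA -[Xe 2 3]mul1r; apply: (XY_ind s43 adj23) => [a b c ha hb hc|].
    have -> : 1 * (a * b * c) * (Xe 1 2 * s 3) = (a * b * c) * Xe 1 2 * s 3.
      by rewrite mul1r !mulrA.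
    by apply: Q41B3u3 => //; apply: Q41I; auto.
  have -> : 1 * Ye 2 3 * (Xe 1 2 * s 3) =
      1 * (t 3 * (s 2 * s 2 * s 1) * Xe 2 3 * 1) * (t 1 * t 2).
    by rewrite /Ye /Xe; braid.
  apply: Q43_lr; [exact: Salg1|inB|].
  apply: (XY_ind s43 adj23) => [a b c ha hb hc|].
    apply: u3B3Q41 => //; [inB|apply: Q41I; auto|exact: Salg1].
  have -> : t 3 * (s 2 * s 2 * s 1) * Ye 2 3 * 1 = t 3 * (s 2 * s 2) * (t 3 * s 1 * s 2 * t 3).
    by rewrite /Ye; braid.
  have := pw_mul H (i := 2) isT (pws _ _ 2) (pws _ _ 2).
  apply: (pw_span_ind s43) => a ha.
  have -> : t 3 * a * (t 3 * s 1 * s 2 * t 3) = 1 * (t 3 * a * t 3) * (s 1 * s 2 * t 3).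
    by rewrite mul1r !mulrA.
  apply: (triple_ind s43 adj23) => // [a' b' c' ha' hb' hc'|].
    have -> : 1 * (a' * b' * c') * (s 1 * s 2 * t 3) = (a' * b' * c') * (s 1 * s 2) * t 3.
      by rewrite mul1r !mulrA.
    by apply: Q41B3u3 => //; [apply: Q41I; auto|inB].
  have -> : 1 * Xe 2 3 * (s 1 * s 2 * t 3) = Xe 2 3 * s 1 * s 2 * t 3.
    by rewrite mul1r !mulrA.
  exact: x_uu_u3.
have -> : Xe 2 3 * Xe 1 2 * t 3 =
    1 * (s 3 * (t 2 * t 2) * (s 3 * t 1 * t 2 * s 3)) * (s 1 * s 2).
  by rewrite /Xe; braid.
apply: Q43_lr; [exact: Salg1|inB|].
have := pw_mul H (i := 2) isT (pwt _ _ 2) (pwt _ _ 2).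
apply: (pw_span_ind s43) => a ha.
have -> : s 3 * a * (s 3 * t 1 * t 2 * s 3) = 1 * (s 3 * a * s 3) * (t 1 * t 2 * s 3).
  by rewrite mul1r !mulrA.
apply: (triple_ind s43 adj23) => // [a' b' c' ha' hb' hc'|].
  have -> : 1 * (a' * b' * c') * (t 1 * t 2 * s 3) = (a' * b' * c') * (t 1 * t 2) * s 3.
    by rewrite mul1r !mulrA.
  by apply: Q41B3u3 => //; [apply: Q41I; auto|inB].
have -> : 1 * Xe 2 3 * (t 1 * t 2 * s 3) = Xe 2 3 * t 1 * t 2 * s 3.
  by rewrite mul1r !mulrA.
exact: x_uu_u3.
Qed.

Lemma Q42_u3 z d : pw 3 d -> Q42 z -> Q43 (z * d).
Proof.
move=> hd /(span_sub (submod_lr s43 1 d)) h; rewrite -[z]mul1r; apply: h => {}z.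
case=> [y hy|a b ha hb]; rewrite mul1r; first by apply: Q41_u3 => //; apply: mem_span.
have -> : a * Xe 2 3 * b * d = a * (Xe 2 3 * b * d) * 1 by rewrite mulr1 !mulrA.
by apply: Q43_lr => //; [exact: Salg1|exact: x_B3_u3].
Qed.

Definition isW (w : A) : Prop := w = Wp \/ w = Wm.

(** The generator s_2 commutes with w exactly. For s_1, write w = v X v with v in u_3: s_1 commutes
    with v, and X s_1 and s_1 X are both congruent to X modulo u_1 u_2 u_1, which v _ v sends into
    [Q42]. *)
Lemma W_comm w h : isW w -> B3 h -> Q42 (w * h - h * w).
Proof.
move=> hw; have C2 a : pw 2 a -> w * a = a * w.
  by case=> ->; rewrite ?mul1r ?mulr1 //; case: hw => ->; rewrite /Wp /Wm /Xe /Ye; braid.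
have C1 a : pw 1 a -> Q42 (w * a - a * w).
  move=> ha; have [v [X [hv wE UR UL]]] : exists v X, [/\ pw 3 v, w = v * X * v,
      uuu 1 2 (X * a - X) & uuu 1 2 (a * X - X)].
    case: hw => ->; [exists (s 3), (Xe 1 2)|exists (t 3), (Ye 1 2)]; split=> //.
    - exact: (uuu_XR H adj12).
    - exact: (uuu_XL H adj12).
    - exact: (uuu_YR H adj12).
    - exact: (uuu_YL H adj12).
  have -> : w * a - a * w = v * ((X * a - X) - (a * X - X)) * v.
    rewrite wE opprB addrA subrK mulrBr mulrBl; congr (_ - _).
      by rewrite !mulrA -[_ * v * a]mulrA (pw13 ha hv) !mulrA.
    by rewrite !mulrA (pw13 ha hv).
  by apply: u3uuu_Q42 => //; apply: (subB (uuu_submod s t 1 2)).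
have C i a : (0 < i <= 2)%N -> pw i a -> Q42 (w * a - a * w).
  case: i => [|[|[|i]]] // _; first exact: C1.
  by move/C2 => ->; rewrite subrr; apply: (sub0 s42).
have step x a i : (0 < i <= 2)%N -> pw i a -> B3 x -> Q42 (w * x - x * w) ->
    Q42 (w * (x * a) - x * a * w).
  move=> hi ha hx IH; have ha' := pw_B3 hi ha.
  have -> : w * (x * a) - x * a * w = 1 * (w * x - x * w) * a + x * (w * a - a * w) * 1.
    by rewrite mul1r mulr1 mulrBl mulrBr !mulrA addrA subrK.
  by apply: (subD s42); apply: Q42_lr => //; first [exact: Salg1 | exact: (C i)].
elim=> [|i x hi hx IH|i x hi hx IH|c x y _ IHx _ IHy].
- by rewrite mulr1 mul1r subrr; apply: (sub0 s42).
- exact: step hi _ _ _.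
- exact: step hi _ _ _.
- have -> : w * (c *: x + y) - (c *: x + y) * w = c *: (w * x - x * w) + (w * y - y * w).
    by expand; lmod K.
  exact: s42.2.
Qed.

(** In a w b d the factor b is first moved to the left of w; then w d = v X (v d), and v d is again
    in u_3, so that [u3B3u3] applies. *)
Lemma Q43_u3 z d : pw 3 d -> Q43 z -> Q43 (z * d).
Proof.
move=> hd /(span_sub (submod_lr s43 1 d)) h; rewrite -[z]mul1r; apply: h => {}z hz.
rewrite mul1r; have : Q42 z \/ exists w a b, [/\ isW w, B3 a, B3 b & z = a * w * b].
  case: hz => [y hy|a b ha hb|a b ha hb]; first by left; apply: mem_span.
    by right; exists Wp, a, b; split=> //; left.
  by right; exists Wm, a, b; split=> //; right.
case=> [/(Q42_u3 hd)//|[w [a [b [hw ha hb ->]]]]].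
have -> : a * w * b * d = a * (w * b - b * w) * 1 * d + a * b * w * d.
  by rewrite mulr1 mulrBr !mulrBl !mulrA subrK.
apply: (subD s43).
  by apply: Q42_u3 => //; apply: Q42_lr => //; [exact: Salg1|exact: W_comm].
have -> : a * b * w * d = (a * b) * (w * d) * 1 by rewrite mulr1 !mulrA.
apply: Q43_lr; [exact: salgM|exact: Salg1|].
have [v [X [hv -> hX]]] : exists v X, [/\ pw 3 v, w = v * X * v & B3 X].
  case: hw => ->; [exists (s 3), (Xe 1 2)|exists (t 3), (Ye 1 2)]; split=> //;
    rewrite /Xe /Ye; inB.
rewrite -mulrA -[v * X]mul1r -[_ * (v * d)]mulr1 -mulrA mul1r mulrA.
have := pw_mul H (i := 3) isT hv hd; apply: (pw_span_ind s43) => c hc.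
by rewrite mulr1; apply: u3B3u3.
Qed.

Lemma salg3_Q43 z : salg s t 3 z -> Q43 z.
Proof.
have P3 i x a : (0 < i <= 3)%N -> pw i a -> Q43 x -> Q43 (x * a).
  have [-> _|i3 hi] := eqVneq i 3; first exact: Q43_u3.
  have hi2 : (0 < i <= 2)%N by lia.
  move=> /(pw_B3 hi2) ha hx; rewrite -[x]mul1r.
  by apply: Q43_lr => //; exact: Salg1.
elim=> [|i x hi _ IH|i x hi _ IH|c x y _ IHx _ IHy].
- apply: Q41_43; have -> : 1 = 1 * 1 * 1 :> A by rewrite !mulr1.
  by apply: Q41I => //; exact: Salg1.
- exact: P3 hi _ _.
- exact: P3 hi _ _.
- exact: s43.2.
Qed.

Lemma B4_ind (P : A -> Prop) : submod P -> (forall z, Q42 z -> P z) ->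
  (forall a w b, isW w -> B3 a -> B3 b -> P (a * w * b)) ->
  forall z, salg s t 3 z -> P z.
Proof.
move=> sP hx hW z /salg3_Q43; apply: (span_sub sP) => {}z [y hy|a b ha hb|a b ha hb].
- by apply: hx; apply: mem_span.
- by apply: hW => //; left.
- by apply: hW => //; right.
Qed.

End FourStrands.

(** * The symmetries: exchange of s and t, word reversal *)

Section Inversion.
Variables (K : comNzRingType) (A : algType K) (s t : nat -> A).

Lemma salg_swap n x : salg s t n x -> salg t s n x.
Proof. by elim=> *; [apply: Salg1|apply: SalgT|apply: SalgS|apply: SalgL]. Qed.

Lemma D_swap k x : D s t k x -> D t s k x.
Proof.
elim=> {k x} [x /salg_swap hx|||j k x y _ hx _ hy|k c x y _ hx _ hy|j k x _ hx jk].
- exact: DB.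
- exact: Dt.
- exact: Ds.
- exact: DM.
- exact: DL.
- exact: DW hx jk.
Qed.

Lemma pw_swap i x : pw s t i x -> pw t s i x.
Proof. by case=> ->; [apply: Or31|apply: Or33|apply: Or32]. Qed.

Lemma Q41_swap z : Q41 s t z -> Q41 t s z.
Proof.
apply: (span_sub (s41 _ _)) => _ [a v b ha hv hb].
by apply: Q41I; [apply: salg_swap|apply: pw_swap|apply: salg_swap].
Qed.

Section Reversal.
Variables (p q qi : K) (rv : A -> A).
Hypothesis H : ok s t p q qi rv.

Lemma rv1 : rv 1 = 1.
Proof.
have i1 : (0 < 1 < 5)%N by [].
have E : rv 1 * s 1 = s 1 by rewrite -[X in _ * X](ok_rv_s H i1) -(ok_rvM H) mulr1 (ok_rv_s H).
transitivity (rv 1 * s 1 * t 1); first by rewrite -mulrA (ok_st H) // mulr1.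
by rewrite E (ok_st H).
Qed.

Lemma rv_t i : (0 < i < 5)%N -> rv (t i) = t i.
Proof.
move=> hi; transitivity (rv (t i) * s i * t i); first by rewrite -mulrA (ok_st H) // mulr1.
by rewrite -[X in _ * X * _](ok_rv_s H hi) -(ok_rvM H) (ok_st H hi) rv1 mul1r.
Qed.

Lemma rv0 : rv 0 = 0.
Proof.
have := ok_rvL H 1 0 0; rewrite !scale1r addr0 => E.
by apply: (addrI (rv 0)); rewrite addr0 -E.
Qed.
Lemma rvZ c x : rv (c *: x) = c *: rv x.
Proof. by have := ok_rvL H c x 0; rewrite rv0 !addr0. Qed.
Lemma rvD x y : rv (x + y) = rv x + rv y.
Proof. by have := ok_rvL H 1 x y; rewrite !scale1r. Qed.
Lemma rvN x : rv (- x) = - rv x.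
Proof. by rewrite -scaleN1r rvZ scaleN1r. Qed.

Lemma salg_rv n x : (n < 5)%N -> salg s t n x -> salg s t n (rv x).
Proof.
move=> n5; elim=> [|i z hi _ IH|i z hi _ IH|c u v _ IHu _ IHv].
- by rewrite rv1; apply: Salg1.
- rewrite (ok_rvM H) (ok_rv_s H); last by lia.
  by apply: salgM => //; apply: salg_s.
- rewrite (ok_rvM H) rv_t; last by lia.
  by apply: salgM => //; apply: salg_t.
- by rewrite (ok_rvL H); apply: SalgL.
Qed.

Lemma salg_rvK n x : (n < 5)%N -> salg s t n x -> rv (rv x) = x.
Proof.
move=> n5; elim=> [|i z hi _ IH|i z hi _ IH|c u v _ IHu _ IHv].
- by rewrite !rv1.
- by rewrite !(ok_rvM H) IH !(ok_rv_s H) //; lia.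
- by rewrite !(ok_rvM H) IH !rv_t //; lia.
- by rewrite !(ok_rvL H) IHu IHv.
Qed.

Lemma D_rv k x : D s t k x -> D s t k (rv x).
Proof.
elim=> {k x} [x /salg_rv hx|||j k x y _ hx _ hy|k c x y _ hx _ hy|j k x _ hx jk].
- by apply: DB; apply: hx.
- by rewrite (ok_rv_s H) //; apply: Ds.
- by rewrite rv_t //; apply: Dt.
- by rewrite (ok_rvM H) addnC; apply: DM.
- by rewrite (ok_rvL H); apply: DL.
- exact: DW hx jk.
Qed.

Lemma pw_rv i x : (0 < i < 5)%N -> pw s t i x -> rv x = x.
Proof. by move=> hi [->|->|->]; [apply: rv1|apply: (ok_rv_s H)|apply: rv_t]. Qed.

Lemma Q41_rv z : Q41 s t z -> Q41 s t (rv z).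
Proof.
elim=> [|c x y [a v b ha hv hb] _ IH]; first by rewrite rv0; apply: (sub0 (s41 _ _)).
rewrite (ok_rvL H); apply: (s41 _ _).2 => //; rewrite !(ok_rvM H) (pw_rv _ hv) // mulrA.
by apply: Q41I => //; apply: salg_rv.
Qed.

Lemma Q41_rvK z : Q41 s t z -> rv (rv z) = z.
Proof.
elim=> [|c x y [a v b ha hv hb] _ IH]; first by rewrite !rv0.
rewrite !(ok_rvL H) IH !(ok_rvM H) !(pw_rv _ hv) //.
by rewrite !(salg_rvK (n := 2)).
Qed.

Lemma ok_swap : ok t s (p * qi) qi q rv.
Proof.
have Q := ok_q H; split.
- by rewrite mulrC.
- by move=> i hi; rewrite (ok_ts H).
- by move=> i hi; rewrite (ok_st H).
- move=> i j i0 ij j5.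
  have h4 : (i = 1 /\ j = 3 \/ i = 1 /\ j = 4 \/ i = 2 /\ j = 4)%N by lia.
  by case: h4 => [[-> ->]|[[-> ->]|[-> ->]]]; braid.
- move=> i hi; have h3 : (i = 1 \/ i = 2 \/ i = 3)%N by lia.
  by case: h3 => [->|[->|->]]; braid.
- move=> i hi; rewrite (ok_tt H) //.
  have -> : p * qi + 1 = (p + q) * qi by rewrite mulrDl Q.
  by have -> : p * qi + qi = (p + 1) * qi by rewrite mulrDl mul1r.
- move=> i j hi hj ij; by apply: (eq_from (c := 1) (ok_cross H hi hj ij)); lmod K.
- exact: (ok_rvL H).
- exact: (ok_rvM H).
- exact: rv_t.
Qed.

End Reversal.
End Inversion.

(** * Products with Z and V *)

Section DegreeOne.
Variables (K : comNzRingType) (A : algType K) (s t : nat -> A) (p q qi : K)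
  (rv : A -> A).
Hypothesis H : ok s t p q qi rv.
Local Notation pw := (pw s t).
Local Notation uuu := (uuu_span s t).
Local Notation B3 := (salg s t 2).
Local Notation B4 := (salg s t 3).
Local Notation Q41 := (Q41 s t).
Local Notation D := (D s t).
Local Notation X i j := (Xe s t i j).
Local Notation Y i j := (Ye s t i j).
Local Notation W_ := (Wp s t).

Lemma sD k : submod (D k). Proof. exact: D_submod. Qed.

Lemma pw4_D1 w : pw 4 w -> D 1 w.
Proof. by case=> ->; deg. Qed.

Lemma pw_B4 i w : (0 < i <= 3)%N -> pw i w -> B4 w.
Proof.
by move=> hi [->|->|->]; [apply: Salg1|apply: salg_s|apply: salg_t].
Qed.

Lemma D1_ww a b : pw 4 a -> pw 4 b -> D 1 (a * b).
Proof.
move=> ha hb; have := pw_mul H (i := 4) isT ha hb.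
by apply: (span_sub (sD 1)) => c; apply: pw4_D1.
Qed.

Lemma D1_uuu x : uuu 3 4 x -> D 1 x.
Proof.
apply: (span_sub (sD 1)) => _ [a [b [c [ha hb hc ->]]]].
have [hA hC] := (pw_B4 (i := 3) isT ha, pw_B4 (i := 3) isT hc).
have hB := pw4_D1 hb; deg.
Qed.

Lemma D1_ZY : D 1 (X 3 4 - q *: Y 3 4).
Proof. by apply: D1_uuu; apply: (uuu_XY H adj34). Qed.

Lemma wvw_ind P l a v c r : submod P -> pw 4 a -> pw 3 v -> pw 4 c ->
  (forall y, D 1 y -> P (l * y * r)) -> P (l * X 3 4 * r) -> P (l * (a * v * c) * r).
Proof.
move=> sP ha hv hc hD hX; apply: (triple_ind H sP adj34) => // a' b' c' ha' hb' hc'.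
by apply/hD/D1_uuu/pw_uuu.
Qed.

Lemma D1_svt v : pw 3 v -> D 1 (s 4 * v * t 4) /\ D 1 (t 4 * v * s 4).
Proof.
case=> ->; split.
- have -> : s 4 * 1 * t 4 = 1 by braid. deg.
- have -> : t 4 * 1 * s 4 = 1 by braid. deg.
- have -> : s 4 * s 3 * t 4 = t 3 * s 4 * s 3 by braid. deg.
- have -> : t 4 * s 3 * s 4 = s 3 * s 4 * t 3 by braid. deg.
- have -> : s 4 * t 3 * t 4 = t 3 * t 4 * s 3 by braid. deg.
- have -> : t 4 * t 3 * s 4 = s 3 * t 4 * t 3 by braid. deg.
Qed.

(** As h commutes with s_4, the last s_4 of Z meets v w, and a braid relation lowers the degree
    unless v w = t_3 s_4. In that case Z is replaced by q t_4 s_3 t_4, and t_4 t_3 s_4 = s_3 t_4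
    t_3. *)
Lemma Z_kill h v w : B3 h -> pw 3 v -> pw 4 w -> D 2 (X 3 4 * h * v * w).
Proof.
move=> hh hv hw; have hw1 := pw4_D1 hw.
have hv4 := pw_B4 (i := 3) isT hv.
case: hv => ->; first rewrite mulr1.
- have -> : X 3 4 * h * w = s 4 * t 3 * h * (s 4 * w).
    by rewrite /Xe !mulrA; case: hw {hw1} => ->; braid.
  have := D1_ww (pws s t 4) hw; move=> ?; deg.
- case: hw => ->; first by rewrite /Xe; deg.
    have -> : X 3 4 * h * s 3 * s 4 = s 4 * t 3 * h * (s 3 * s 4 * s 3) by rewrite /Xe; braid.
    deg.
  have -> : X 3 4 * h * s 3 * t 4 = s 4 * t 3 * h * (t 3 * s 4 * s 3) by rewrite /Xe; braid.
  deg.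
- case: hw => ->; first by rewrite /Xe; deg.
    have -> : X 3 4 * h * t 3 * s 4 = 1 * X 3 4 * (h * (t 3 * s 4)) by rewrite mul1r !mulrA.
    apply: (sub_modlr (sD 2) (y := q *: Y 3 4)).
      have hD := D1_ZY; rewrite mul1r; deg.
    rewrite scale_mulr scale_mull; apply: (subZ (sD 2)).
    have -> : 1 * Y 3 4 * (h * (t 3 * s 4)) = t 4 * s 3 * h * (s 3 * t 4 * t 3).
      by rewrite /Ye; braid.
    deg.
  have -> : X 3 4 * h * t 3 * t 4 = s 4 * t 3 * h * (t 3 * t 4 * s 3) * 1 by rewrite /Xe; braid.
  deg.
Qed.

Lemma w_comm w h : pw 4 w -> B3 h -> w * h = h * w.
Proof. by case=> -> hh; rewrite ?mul1r ?mulr1 //; braid. Qed.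

Lemma Z_Q41 z w : Q41 z -> pw 4 w -> D 2 (X 3 4 * z * w).
Proof.
move=> hz hw; move: z hz; apply: (span_sub (submod_lr (sD 2) _ _)) => _ [a v b ha hv hb].
have -> : X 3 4 * (a * v * b) * w = X 3 4 * a * v * w * b.
  by rewrite !mulrA -[_ * b * w]mulrA -(w_comm hw hb) !mulrA.
have := Z_kill ha hv hw => ?; deg.
Qed.

Lemma rv_X34 : rv (X 3 4) = X 3 4.
Proof.
by rewrite /Xe !(ok_rvM H) !(ok_rv_s H) // (rv_t H) // !mulrA.
Qed.

Lemma Q41_Z z w : Q41 z -> pw 4 w -> D 2 (w * z * X 3 4).
Proof.
move=> hz hw; have hz' := Q41_rv H hz.
have := D_rv H (Z_Q41 hz' hw).
by rewrite 2!(ok_rvM H) rv_X34 (Q41_rvK H hz) (pw_rv H _ hw) // mulrA.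
Qed.

Lemma Z_to_Y l : D 1 l -> D 2 (l * Y 3 4) -> D 2 (l * X 3 4).
Proof.
move=> hl h; rewrite -[_ * _]mulr1; apply: (sub_modlr (sD 2) (y := q *: Y 3 4)).
  have hD := D1_ZY; deg.
by rewrite scale_mulr scale_mull mulr1; apply: (subZ (sD 2)).
Qed.

Lemma x_absorb g h w : pw 2 g -> B3 h -> pw 4 w ->
  D 2 (w * X 2 3 * h * X 3 4) -> D 2 (w * X 2 3 * (g * h) * X 3 4).
Proof.
move=> hg hh hw h2.
have -> : w * X 2 3 * (g * h) * X 3 4 = w * (X 2 3 * g) * (h * X 3 4) by rewrite !mulrA.
apply: (sub_modlr (sD 2) (y := X 2 3)); last by rewrite !mulrA; rewrite !mulrA in h2.
rewrite mulrA -[_ * h]mulrA; apply: Q41_Z => //; rewrite -[_ - _]mul1r.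
apply: Q41_lr; [exact: Salg1|done|].
by apply: uuu23_Q41; apply: (uuu_XR H adj23).
Qed.

(** Once Z is replaced by t_4 s_3 t_4, braid relations move a copy of Z to the left and leave t_4
    behind it, so that [Z_kill] applies. *)
Lemma psi1 : D 2 (s 4 * X 2 3 * X 3 4).
Proof.
apply: Z_to_Y; first by rewrite /Xe; deg.
have -> : s 4 * X 2 3 * Y 3 4 = t 3 * t 2 * X 3 4 * s 2 * (s 3 * s 3) * t 4.
  by rewrite /Ye /Xe; braid.
have := pw_mul H (i := 3) isT (pws _ _ 3) (pws _ _ 3).
apply: (pw_span_ind (sD 2)) => v hv.
have := Z_kill (h := s 2) (w := t 4) _ hv (pwt _ _ 4).
move=> /(_ ltac:(inB)) h.
have -> : t 3 * t 2 * X 3 4 * s 2 * v * t 4 = t 3 * t 2 * (X 3 4 * s 2 * v * t 4).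
  by rewrite !mulrA.
deg.
Qed.

Lemma psi2 a : a = s 1 \/ a = t 1 -> D 2 (s 4 * X 2 3 * (a * s 2) * X 3 4).
Proof.
move=> ha; apply: Z_to_Y; first by case: ha => ->; rewrite /Xe; deg.
have -> : s 4 * X 2 3 * (a * s 2) * Y 3 4 =
    t 3 * t 2 * (X 3 4 * (s 2 * a * s 2) * s 3 * t 4) * s 2.
  by rewrite /Ye /Xe; case: ha => ->; braid.
have hB : B3 (s 2 * a * s 2) by case: ha => ->; inB.
have := Z_kill hB (pws _ _ 3) (pwt _ _ 4) => h; deg.
Qed.

(** In s_1 t_2 = t_2 (t_1 s_2 s_1) the leading t_2 is absorbed by x and the trailing s_1 commutes
    with Z, which leaves [psi2]. *)
Lemma psi3 : D 2 (s 4 * X 2 3 * (s 1 * t 2) * X 3 4).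
Proof.
have -> : s 1 * t 2 = t 2 * (t 1 * s 2 * s 1) by braid.
apply: x_absorb => //; first by inB.
have -> : s 4 * X 2 3 * (t 1 * s 2 * s 1) * X 3 4 =
    s 4 * X 2 3 * (t 1 * s 2) * X 3 4 * s 1 by rewrite /Xe; braid.
have := psi2 (or_intror (erefl (t 1))) => h; deg.
Qed.

(* s_4 x s_4 t_1 t_2 t_3 = t_1 t_2 t_3 (t_4 w_+ s_4): the right factor s_4 of Z
   then merges with the s_4 on its left. *)
Lemma psi4 : D 2 (s 4 * X 2 3 * (t 1 * t 2) * X 3 4).
Proof.
have -> : s 4 * X 2 3 * (t 1 * t 2) * X 3 4 = t 1 * t 2 * t 3 * t 4 * W_ * (s 4 * s 4).
  by rewrite /Wp /Xe; braid.
have hW : B4 W_ by rewrite /Wp /Xe; inB.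
have := D1_ww (pws s t 4) (pws s t 4) => h; deg.
Qed.

Lemma pw1_Z c : pw 1 c -> c * X 3 4 = X 3 4 * c.
Proof. by case=> ->; rewrite ?mul1r ?mulr1 // /Xe; braid. Qed.

Lemma psi h : B3 h -> D 2 (s 4 * X 2 3 * h * X 3 4).
Proof.
apply: (dec_ind H (sD 2) adj12) => // [a b c ha hb hc|].
  have hC : B3 c by case: hc => ->; inB.
  have -> : s 4 * X 2 3 * (a * b * c) * X 3 4 = s 4 * X 2 3 * (a * b) * X 3 4 * c.
    by rewrite -[RHS]mulrA -(pw1_Z hc) !mulrA.
  suff h2 : D 2 (s 4 * X 2 3 * (a * b) * X 3 4) by deg.
  have p1 : D 2 (s 4 * X 2 3 * 1 * X 3 4) by rewrite mulr1; apply: psi1.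
  have pa : D 2 (s 4 * X 2 3 * a * X 3 4).
    have hA : B3 a by case: ha => ->; inB.
    have -> : s 4 * X 2 3 * a * X 3 4 = s 4 * X 2 3 * X 3 4 * a.
      by rewrite -[RHS]mulrA -(pw1_Z ha) !mulrA.
    have := psi1 => ?; deg.
  case: hb => ->; first by rewrite mulr1.
    case: ha {pa} => ->; [|apply: psi2; by left|apply: psi2; by right].
    by rewrite mul1r -[s 2]mulr1; apply: x_absorb => //; exact: Salg1.
  case: ha {pa} => ->; [|exact: psi3|exact: psi4].
  by rewrite mul1r -[t 2]mulr1; apply: x_absorb => //; exact: Salg1.
have -> : X 1 2 = s 2 * (t 1 * s 2) by rewrite /Xe mulrA.
by apply: x_absorb => //; [inB|apply: psi2; right].
Qed.

Lemma psi_Wp : D 2 (s 4 * W_ * X 3 4).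
Proof.
apply: Z_to_Y; first by rewrite /Wp /Xe; deg.
have -> : s 4 * W_ * Y 3 4 =
    t 3 * t 2 * t 1 * s 4 * X 2 3 * s 1 * s 2 * s 4 * (s 3 * s 3) * t 4.
  by rewrite /Wp /Xe /Ye; braid.
have := pw_mul H (i := 3) isT (pws _ _ 3) (pws _ _ 3).
apply: (pw_span_ind (sD 2)) => v hv; have [h _] := D1_svt hv.
have -> : t 3 * t 2 * t 1 * s 4 * X 2 3 * s 1 * s 2 * s 4 * v * t 4 =
    t 3 * t 2 * t 1 * s 4 * X 2 3 * s 1 * s 2 * (s 4 * v * t 4) by rewrite !mulrA.
have hX : B4 (X 2 3) by rewrite /Xe; inB.
deg.
Qed.

(** Braid relations produce s_4 t_3^2 s_4 at the right end. Expanding t_3^2 gives terms of degree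
    one and Z, the latter being covered by [psi4]. *)
Lemma psi_Wp' : D 2 (t 4 * W_ * X 3 4).
Proof.
have -> : t 4 * W_ * X 3 4 =
    s 3 * s 2 * s 1 * s 4 * X 2 3 * t 1 * t 2 * s 4 * (t 3 * t 3) * s 4.
  by rewrite /Wp /Xe; braid.
have := pw_mul H (i := 3) isT (pwt _ _ 3) (pwt _ _ 3).
apply: (pw_span_ind (sD 2)) => v hv.
have -> : s 3 * s 2 * s 1 * s 4 * X 2 3 * t 1 * t 2 * s 4 * v * s 4 =
    s 3 * s 2 * s 1 * s 4 * X 2 3 * t 1 * t 2 * (s 4 * v * s 4) * 1.
  by rewrite mulr1 !mulrA.
have hX : B4 (X 2 3) by rewrite /Xe; inB.
apply: (wvw_ind (sD 2)) => // [y hy|]; first by deg.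
have -> : s 3 * s 2 * s 1 * s 4 * X 2 3 * t 1 * t 2 * X 3 4 * 1 =
    s 3 * s 2 * s 1 * (s 4 * X 2 3 * (t 1 * t 2) * X 3 4) by rewrite mulr1 !mulrA.
have := psi4 => ?; deg.
Qed.

End DegreeOne.

(** * The bimodule of Z and the element V = s_4 x s_4 *)

Section DegreeTwo.
Variables (K : comNzRingType) (A : algType K) (s t : nat -> A).

(* I2 = Q_4 Z Q_4 + (degree at most 1) is what can be dropped next to a factor
   Q_4 u_4 or u_4 Q_4: see [kill_l] and [kill_r]. *)
Inductive genI2 : A -> Prop :=
| GenI2 a b : salg s t 3 a -> salg s t 3 b -> genI2 (a * Xe s t 3 4 * b)
| GenI1 y : D s t 1 y -> genI2 y.
Definition I2 := span genI2.

Definition Ve : A := s 4 * Xe s t 2 3 * s 4.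

Variables (p q qi : K) (rv : A -> A).
Hypothesis H : ok s t p q qi rv.
Local Notation pw := (pw s t).
Local Notation uuu := (uuu_span s t).
Local Notation B3 := (salg s t 2).
Local Notation B4 := (salg s t 3).
Local Notation Q41 := (Q41 s t).
Local Notation Q42 := (Q42 s t).
Local Notation D := (D s t).
Local Notation X i j := (Xe s t i j).
Local Notation Y i j := (Ye s t i j).
Local Notation V := Ve.
Local Notation sD k := (@sD K A s t k).
Local Notation isW := (isW s t).

Lemma sI2 : submod I2. Proof. exact: span_submod. Qed.

Lemma Q41_Y z w : Q41 z -> pw 4 w -> D 2 (w * z * Y 3 4).
Proof.
by move=> hz hw; apply: D_swap; apply: (Q41_Z (ok_swap H)); [apply: Q41_swap|apply: pw_swap].
Qed.

(** For w = t_4, the signs of both x and Z are exchanged, and the word becomes the image of the case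
    w = s_4 under the exchange of s and t. *)
Lemma x_Z w h : pw 4 w -> B3 h -> D 2 (w * X 2 3 * h * X 3 4).
Proof.
move=> hw hh; case: hw => ->; first by rewrite /Xe; deg.
  exact: (psi H).
have hX : B4 (X 2 3) by rewrite /Xe; inB.
apply: (Z_to_Y H); first by deg.
have -> : t 4 * X 2 3 * h * Y 3 4 = t 4 * X 2 3 * (h * Y 3 4) by rewrite !mulrA.
apply: (XY_ind H (sD 2) adj23) => [a b c ha hb hc|].
  have -> : t 4 * (a * b * c) * (h * Y 3 4) = t 4 * (1 * (a * b * c) * h) * Y 3 4.
    by rewrite mul1r !mulrA.
  apply: Q41_Y => //; apply: Q41_lr; [exact: Salg1|done|].
  by apply: uuu23_Q41; apply: pw_uuu.
have -> : t 4 * Y 2 3 * (h * Y 3 4) = t 4 * Y 2 3 * h * Y 3 4 by rewrite !mulrA.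
apply: D_swap; apply: (psi (ok_swap H)); exact: salg_swap.
Qed.

Lemma Q42_Z z w : Q42 z -> pw 4 w -> D 2 (w * z * X 3 4).
Proof.
move=> hz hw; move: z hz; apply: (span_sub (submod_lr (sD 2) _ _)) => _ [z hz|a b ha hb].
  by apply: (Q41_Z H) => //; apply: mem_span.
have -> : w * (a * X 2 3 * b) * X 3 4 = a * (w * X 2 3 * b * X 3 4).
  by rewrite !mulrA (w_comm H hw ha) ?mulrA.
have := x_Z hw hb => ?; deg.
Qed.

Lemma W_Z w u : pw 4 w -> isW u -> D 2 (w * u * X 3 4).
Proof.
move=> hw hu; have hu4 : B4 u by case: hu => ->; rewrite /Wp /Wm /Xe /Ye; inB.
case: hw => ->; first by rewrite /Xe; deg.
  case: hu {hu4} => ->; first exact: (psi_Wp H).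
  apply: (Z_to_Y H); first by rewrite /Wm /Ye; deg.
  by apply: D_swap; apply: (psi_Wp' (ok_swap H)).
case: hu {hu4} => ->; first exact: (psi_Wp' H).
apply: (Z_to_Y H); first by rewrite /Wm /Ye; deg.
by apply: D_swap; apply: (psi_Wp (ok_swap H)).
Qed.

Lemma Q4_Z z w : B4 z -> pw 4 w -> D 2 (w * z * X 3 4).
Proof.
move=> hz hw; move: z hz.
apply: (B4_ind H (submod_lr (sD 2) _ _)) => [z hz|a u b hu ha hb]; first exact: Q42_Z.
have -> : w * (a * u * b) * X 3 4 =
    w * (a * (u * b - b * u) * 1) * X 3 4 + a * b * (w * u * X 3 4).
  rewrite mulr1 mulrBr mulrBr mulrBl !mulrA (w_comm H hw ha).
  by rewrite -[a * w * b]mulrA (w_comm H hw hb) !mulrA subrK.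
apply: (subD (sD 2)); last by have := W_Z hw hu => ?; deg.
by apply: Q42_Z => //; apply: Q42_lr => //; [exact: Salg1|exact: (W_comm H)].
Qed.

Lemma Z_Q4 z w : B4 z -> pw 4 w -> D 2 (X 3 4 * z * w).
Proof.
move=> hz hw; have hz' := salg_rv H (n := 3) isT hz.
have := D_rv H (Q4_Z hz' hw).
by rewrite 2!(ok_rvM H) (rv_X34 H) (salg_rvK H (n := 3)) // (pw_rv H _ hw) // mulrA.
Qed.

Lemma I2_D1 y : D 1 y -> I2 y.
Proof. by move=> hy; apply: mem_span; apply: GenI1. Qed.
Lemma I2_Z a b : B4 a -> B4 b -> I2 (a * X 3 4 * b).
Proof. by move=> ha hb; apply: mem_span; apply: GenI2. Qed.

Lemma I2_lr a z b : B4 a -> B4 b -> I2 z -> I2 (a * z * b).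
Proof.
move=> ha hb; move: z; apply: (span_sub (submod_lr sI2 _ _)) => _ [c d hc hd|y hy].
  have -> : a * (c * X 3 4 * d) * b = (a * c) * X 3 4 * (d * b) by rewrite !mulrA.
  by apply: I2_Z; inB.
by apply: I2_D1; deg.
Qed.

Lemma kill_l w g z : pw 4 w -> B4 g -> I2 z -> D 2 (w * g * z).
Proof.
move=> hw hg; have hD := pw4_D1 hw.
rewrite -[_ * z]mulr1; move: z.
suff h z : genI2 z -> D 2 (w * g * z * 1).
  by move=> z hz; rewrite mulr1 -[_ * z]mulr1; apply: (span_sub (submod_lr (sD 2) _ _) h).
case=> [c d hc hd|y hy]; last by deg.
have -> : w * g * (c * X 3 4 * d) * 1 = w * (g * c) * X 3 4 * d by rewrite mulr1 !mulrA.
have := Q4_Z (salgM hg hc) hw => ?; deg.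
Qed.

Lemma kill_r w g z : pw 4 w -> B4 g -> I2 z -> D 2 (z * g * w).
Proof.
move=> hw hg; have hD := pw4_D1 hw.
suff h z0 : genI2 z0 -> D 2 (1 * z0 * (g * w)).
  move=> hz; rewrite -[z]mul1r -mulrA.
  exact: (span_sub (submod_lr (sD 2) _ _) h).
case=> [c d hc hd|y hy]; last by deg.
have -> : 1 * (c * X 3 4 * d) * (g * w) = c * (X 3 4 * (d * g) * w) by rewrite mul1r !mulrA.
have := Z_Q4 (salgM hd hg) hw => ?; deg.
Qed.

Lemma wQ41w w z w' : pw 4 w -> pw 4 w' -> Q41 z -> I2 (w * z * w').
Proof.
move=> hw hw'; move: z; apply: (span_sub (submod_lr sI2 _ _)) => _ [a v b ha hv hb].
have -> : w * (a * v * b) * w' = a * (w * v * w') * b.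
  by rewrite !mulrA (w_comm H hw ha) -!mulrA -(w_comm H hw' hb).
have [ha4 hb4] := (salg23 ha, salg23 hb).
apply: (wvw_ind H sI2) => // [y hy|]; last exact: I2_Z.
by apply: I2_D1; deg.
Qed.

(** Conjugation identities such as s_4 x t_4 = t_3 t_2 Z s_2 s_3 turn x between letters s_4 of
    opposite signs into a conjugate of Z. *)
Lemma I2_mixed z : Q42 z -> I2 (s 4 * z * t 4) /\ I2 (t 4 * z * s 4).
Proof.
have h1 a b : B3 a -> B3 b -> I2 (s 4 * (a * X 2 3 * b) * t 4).
  move=> ha hb; have -> : s 4 * (a * X 2 3 * b) * t 4 =
      (a * t 3 * t 2) * X 3 4 * (s 2 * s 3 * b) by rewrite /Xe; braid.
  by apply: I2_Z; inB.
have h2 a b : B3 a -> B3 b -> I2 (t 4 * (a * X 2 3 * b) * s 4).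
  move=> ha hb; have -> : t 4 * (a * X 2 3 * b) * s 4 =
      (a * s 3 * s 2) * X 3 4 * (t 2 * t 3 * b) by rewrite /Xe; braid.
  by apply: I2_Z; inB.
move=> hz; split.
  move: z hz; apply: (span_sub (submod_lr sI2 _ _)) => _ [y hy|a b ha hb].
    by apply: wQ41w; [apply: Or32|apply: Or33|apply: mem_span].
  exact: h1.
move: z hz; apply: (span_sub (submod_lr sI2 _ _)) => _ [y hy|a b ha hb].
  by apply: wQ41w; [apply: Or33|apply: Or32|apply: mem_span].
exact: h2.
Qed.

(* The relation between s_3 and s_4 multiplied on the right by t_2 s_3 s_4. *)
Lemma tV : I2 (t 3 * V - V).
Proof.
have E := congr1 (fun z => z * (t 2 * s 3 * s 4)) (ok_cross H (i := 3) (j := 4) isT isT isT).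
expand_in E.
have l1 : s 3 * s 4 * t 3 * t 2 * s 3 * s 4 = (s 3 * s 2) * X 3 4 * t 2.
  by rewrite /Xe; braid.
have l2 : s 3 * t 4 * t 3 * t 2 * s 3 * s 4 = s 3 * s 2 * s 3 * t 4 * t 3 * t 2 by braid.
have l4 : t 3 * t 4 * s 3 * t 2 * s 3 * s 4 =
    (t 3 * s 3 * s 2) * X 3 4 * (t 2 * t 3) by rewrite /Xe; braid.
have r1 : s 3 * s 4 * t 2 * s 3 * s 4 = s 3 * t 2 * s 3 * s 4 * s 3 by braid.
have r2 : s 3 * t 4 * t 2 * s 3 * s 4 = s 3 * t 2 * s 3 * s 4 * t 3 by braid.
have r4 : t 4 * s 3 * t 2 * s 3 * s 4 = (s 3 * s 2) * X 3 4 * (t 2 * t 3).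
  by rewrite /Xe; braid.
have r5 : s 4 * t 3 * t 2 * s 3 * s 4 = s 2 * X 3 4 * t 2 by rewrite /Xe; braid.
have r6 : t 4 * t 3 * t 2 * s 3 * s 4 = s 2 * s 3 * t 4 * t 3 * t 2 by braid.
have r7 : t 3 * s 4 * t 2 * s 3 * s 4 = t 3 * t 2 * s 3 * s 4 * s 3 by braid.
have r8 : t 3 * t 4 * t 2 * s 3 * s 4 = t 3 * t 2 * s 3 * s 4 * t 3 by braid.
have l3 : t 3 * s 4 * s 3 * t 2 * s 3 * s 4 = t 3 * V by rewrite /Ve /Xe; braid.
have r3 : s 4 * s 3 * t 2 * s 3 * s 4 = V by rewrite /Ve /Xe; braid.
rewrite l1 l2 l3 l4 r1 r2 r3 r4 r5 r6 r7 r8 in E.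
have -> : t 3 * V - V = (s 3 * s 2) * X 3 4 * t 2 - s 3 * s 2 * s 3 * t 4 * t 3 * t 2
  + (t 3 * s 3 * s 2) * X 3 4 * (t 2 * t 3) - s 3 * t 2 * s 3 * s 4 * s 3
  + s 3 * t 2 * s 3 * s 4 * t 3 - (s 3 * s 2) * X 3 4 * (t 2 * t 3)
  - s 2 * X 3 4 * t 2 + s 2 * s 3 * t 4 * t 3 * t 2
  + t 3 * t 2 * s 3 * s 4 * s 3 - t 3 * t 2 * s 3 * s 4 * t 3.
  by apply: (eq_from (c := -1) E); lmod K.
by spanP sI2; first [apply: I2_D1; deg | apply: I2_Z; inB].
Qed.

Lemma VL3 v : pw 3 v -> I2 (v * V - V).
Proof.
case=> ->; [by rewrite mul1r subrr; apply: (sub0 sI2)| |exact: tV].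
have -> : s 3 * V - V = - (s 3 * (t 3 * V - V) * 1).
  have E : s 3 * (t 3 * V) = V by rewrite /Ve /Xe; braid.
  by rewrite mulr1 mulrBr E opprB.
by apply: (subN sI2); apply: I2_lr; [inB|inB|exact: tV].
Qed.

Lemma V3_comm v : pw 3 v -> V * v = v * V.
Proof. by case=> ->; rewrite ?mul1r ?mulr1 // /Ve /Xe; braid. Qed.

Lemma VR3 v : pw 3 v -> I2 (V * v - V).
Proof. by move=> hv; rewrite V3_comm //; apply: VL3. Qed.

Lemma VR2 g : pw 2 g -> I2 (V * g - V).
Proof.
move=> hg; have -> : V * g - V = s 4 * (X 2 3 * g - X 2 3) * s 4.
  rewrite mulrBr mulrBl -/V; congr (_ - _).
  by case: hg => ->; rewrite /Ve /Xe; braid.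
by apply: wQ41w => //; apply: uuu23_Q41; apply: (uuu_XR H adj23).
Qed.

Lemma B4_X23 : B4 (X 2 3). Proof. by rewrite /Xe; inB. Qed.

Lemma V_B3u3 h v w : B3 h -> pw 3 v -> pw 4 w -> D 2 (V * h * v * w).
Proof.
move=> hh hv hw; have hX := B4_X23.
have -> : V * h * v * w = s 4 * X 2 3 * h * (s 4 * v * w) * 1.
  by case: hv => ->; case: hw => ->; rewrite /Ve /Xe; braid.
apply: (wvw_ind H (sD 2)) => // [y hy|]; first by deg.
have hXh : B4 (X 2 3 * h) by inB.
have -> : s 4 * X 2 3 * h * X 3 4 * 1 = s 4 * (X 2 3 * h) * X 3 4 by rewrite mulr1 !mulrA.
exact: Q4_Z.
Qed.

Lemma V_Q41 z w : Q41 z -> pw 4 w -> D 2 (V * z * w).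
Proof.
move=> hz hw; move: z hz; apply: (span_sub (submod_lr (sD 2) _ _)) => _ [a v b ha hv hb].
have -> : V * (a * v * b) * w = V * a * v * w * b.
  by rewrite !mulrA -[_ * b * w]mulrA -(w_comm H hw hb) !mulrA.
have := V_B3u3 ha hv hw => ?; deg.
Qed.

Lemma V_absorb v g w : pw 2 v \/ pw 3 v -> B4 g -> pw 4 w -> D 2 (V * (v * g) * w - V * g * w).
Proof.
move=> hv hg hw; have -> : V * (v * g) * w - V * g * w = (V * v - V) * g * w.
  by rewrite !mulrBl !mulrA.
by apply: kill_r => //; case: hv => hv; [exact: VR2|exact: VR3].
Qed.

(** V is fixed by t_3 and s_3 modulo [I2], so one of them can be inserted after V; it cancels the
    first letter of w_+ or w_- and leaves an element of Q_3 followed by a single letter of u_3. *)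
Lemma V_W u w : isW u -> pw 4 w -> D 2 (V * u * w).
Proof.
move=> hu hw; have h4 : B4 u by case: hu => ->; rewrite /Wp /Wm /Xe /Ye; inB.
case: hu h4 => -> h4.
  apply: (sub_mod (sD 2) (sub_mods (sD 2) (V_absorb (or_intror (pwt s t 3)) h4 hw))).
  have -> : V * (t 3 * Wp s t) * w = V * X 1 2 * s 3 * w.
    rewrite /Wp !mulrA -[V * t 3 * s 3]mulrA (ok_ts H) // mulr1; by [].
  by apply: V_B3u3 => //; rewrite /Xe; inB.
apply: (sub_mod (sD 2) (sub_mods (sD 2) (V_absorb (or_intror (pws s t 3)) h4 hw))).
have -> : V * (s 3 * Wm s t) * w = V * Y 1 2 * t 3 * w.
  rewrite /Wm !mulrA -[V * s 3 * t 3]mulrA (ok_st H) // mulr1; by [].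
by apply: V_B3u3 => //; rewrite /Ye; inB.
Qed.

(* s_4 x y s_4 x s_4, as y commutes with s_4. *)
Definition Fe : A := V * (s 1 * t 2 * s 1) * X 2 3 * s 4.

(** Inserting t_3 after V cancels the first letter of x, since t_3 commutes with a. *)
Lemma chi_u1 a : pw 1 a -> D 2 (V * a * X 2 3 * s 4).
Proof.
move=> ha; have ha3 : B3 a by case: ha => ->; inB.
have hX := B4_X23; have hg : B4 (a * X 2 3) by inB.
have := V_absorb (or_intror (pwt s t 3)) hg (pws s t 4).
move=> /(sub_mods (sD 2)) h; rewrite -[V * a * _]mulrA; apply: (sub_mod (sD 2) h).
have -> : V * (t 3 * (a * X 2 3)) * s 4 = V * (a * t 2) * s 3 * s 4.
  by case: ha {ha3 hg h} => ->; rewrite /Ve /Xe; braid.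
by apply: V_B3u3 => //; inB.
Qed.

(** The outer factors of u_2 u_1 u_2 disappear: the left one is absorbed by V and the right one by
    x. *)
Lemma chi_uuu r : uuu 2 1 r -> D 2 (V * r * X 2 3 * s 4).
Proof.
have -> : V * r * X 2 3 * s 4 = V * r * (X 2 3 * s 4) by rewrite !mulrA.
apply: (uuu_ind (sD 2)) => b c d hb hc hd.
have [hb3 hc3 hd3] : [/\ B3 b, B3 c & B3 d].
  by split; [case: hb|case: hc|case: hd] => ->; inB.
have hX := B4_X23; have hg : B4 (c * d * X 2 3) by inB.
have := V_absorb (or_introl hb) hg (pws s t 4) => h.
have -> : V * (b * c * d) * (X 2 3 * s 4) = V * (b * (c * d * X 2 3)) * s 4 by rewrite !mulrA.
apply: (sub_mod (sD 2) h).
have -> : V * (c * d * X 2 3) * s 4 =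
    V * (c * (d * X 2 3 - X 2 3) * 1) * s 4 + V * c * X 2 3 * s 4.
  by rewrite mulr1 !(mulrBr, mulrBl) !mulrA subrK.
apply: (subD (sD 2)); last exact: chi_u1.
apply: V_Q41 => //; apply: Q41_lr => //; first exact: Salg1.
by apply: uuu23_Q41; apply: (uuu_XL H adj23).
Qed.

(** This is where y enters: Q_3 = u_2 u_1 u_2 + K y with y = s_1 t_2 s_1, the first summand
    contributes nothing, and the second gives f. *)
Lemma chi_dec a : B3 a -> exists k : K, D 2 (V * a * X 2 3 * s 4 - k *: Fe).
Proof.
move=> ha; have [k hk] := salg2_dec H adj21 isT ha; exists k.
have -> : V * a * X 2 3 * s 4 - k *: Fe = V * (a - k *: X 2 1) * X 2 3 * s 4.
  by rewrite /Fe mulrBr !mulrBl scale_mulr !scale_mull.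
exact: chi_uuu.
Qed.

Lemma V_x_t4 a : B3 a -> D 2 (V * a * X 2 3 * t 4).
Proof.
move=> ha; have hX := B4_X23; have hXa : B4 (X 2 3 * a) by inB.
have -> : V * a * X 2 3 * t 4 = s 4 * (X 2 3 * a) * (s 4 * (1 * X 2 3 * 1) * t 4).
  by rewrite /Ve /Xe; braid.
by apply: kill_l => //; case: (I2_mixed (Q42x (Salg1 s t 2) (Salg1 s t 2))).
Qed.

Lemma V_Q42 z w : Q42 z -> pw 4 w ->
  exists l, B3 l /\ D 2 (V * z * w - Fe * l).
Proof.
move=> hz hw; elim: hz => [|c x y hx _ [l [hl hy]]].
  exists 0; split; first exact: salg0.
  by rewrite mulr0 mul0r mulr0 subrr; apply: (sub0 (sD 2)).
suff [m [hm hxm]] : exists m, B3 m /\ D 2 (V * x * w - Fe * m).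
  exists (c *: m + l); split; first exact: SalgL.
  have -> : V * (c *: x + y) * w - Fe * (c *: m + l) =
      c *: (V * x * w - Fe * m) + (V * y * w - Fe * l) by expand; lmod K.
  exact: (sD 2).2.
case: hx => [y0 hy0|a b ha hb].
  exists 0; split; first exact: salg0.
  by rewrite mulr0 subr0; apply: V_Q41 => //; apply: mem_span.
have hX := B4_X23.
have -> : V * (a * X 2 3 * b) * w = V * a * X 2 3 * w * b.
  by rewrite !mulrA -[_ * b * w]mulrA -(w_comm H hw hb) !mulrA.
have D0 u : D 2 (V * a * X 2 3 * u) ->
    exists m, B3 m /\ D 2 (V * a * X 2 3 * u * b - Fe * m).
  move=> h; exists 0; split; first exact: salg0.
  by rewrite mulr0 subr0; deg.
case: hw => ->; [by apply: D0; rewrite /Ve; deg| |by apply: D0; apply: V_x_t4].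
have [k hk] := chi_dec ha; exists (k *: b); split; first exact: (subZ (salg_submod _ _ _)).
have -> : V * a * X 2 3 * s 4 * b - Fe * (k *: b) = (V * a * X 2 3 * s 4 - k *: Fe) * b.
  by expand; lmod K.
deg.
Qed.

End DegreeTwo.

(** * The line of f *)

Section DegreeThree.
Variables (K : comNzRingType) (A : algType K) (s t : nat -> A) (p q qi : K)
  (rv : A -> A).
Hypothesis H : ok s t p q qi rv.
Local Notation pw := (pw s t).
Local Notation B3 := (salg s t 2).
Local Notation B4 := (salg s t 3).
Local Notation Q42 := (Q42 s t).
Local Notation D := (D s t).
Local Notation X i j := (Xe s t i j).
Local Notation Y i j := (Ye s t i j).
Local Notation W_ := (Wp s t).
Local Notation V := (Ve s t).
Local Notation fe := (Fe s t).
Local Notation I2 := (I2 s t).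
Local Notation sD k := (@sD K A s t k).

Definition g1 : A := s 4 * W_ * t 4 * W_ * s 4.

Lemma Q42_Y23 a b : B3 a -> B3 b -> Q42 (a * Y 2 3 * b).
Proof.
move=> ha hb; apply: (q_sub H (s42 s t)).
have -> : q *: (a * Y 2 3 * b) = a * X 2 3 * b - a * (X 2 3 - q *: Y 2 3) * b.
  by rewrite mulrBr mulrBl opprB addrC subrK scale_mulr scale_mull.
apply: (subB (s42 s t)); first exact: Q42x.
apply: Q42_lr => //; apply: Q41_42; apply: uuu23_Q41; exact: (uuu_XY H adj23).
Qed.

Lemma W_B4 u : isW s t u -> B4 u.
Proof. by case=> ->; rewrite /Wp /Wm /Xe /Ye; inB. Qed.

(* [fe] is fixed by s_2 and s_3 on both sides, and [g1] by s_1. *)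
Lemma fe_g1 : D 2 (fe - (qi * qi) *: (s 1 * s 2 * s 3 * s 2 * g1)).
Proof.
have hW : B4 W_ by apply: W_B4; left.
have hY : B3 (Y 1 2) by rewrite /Ye; inB.
(* L is the left factor shared by the three terms of the expansion of t_3^2. It ends with s_4 w_+
   s_2, so it annihilates [I2] modulo degree at most 2, which disposes of all terms but the one in
   s_3. *)
pose L := s 1 * s 2 * s 3 * s 4 * (W_ * s 2).
have fE : fe = L * (t 4 * (t 3 * t 3) * Y 1 2 * s 3 * s 4).
  by rewrite /Fe /Ve /L /Wp /Xe /Ye; braid.
have L2 z : I2 z -> D 2 (L * z).
  move=> hz; have -> : L * z = s 1 * s 2 * s 3 * (s 4 * (W_ * s 2) * z).
    by rewrite /L !mulrA.
  have hg : B4 (W_ * s 2) by inB.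
  have := kill_l H (pws s t 4) hg hz => ?; deg.
have T1 : D 2 (L * (t 4 * t 3 * Y 1 2 * s 3 * s 4)).
  apply: L2; have -> : t 4 * t 3 * Y 1 2 * s 3 * s 4 =
    t 4 * ((s 2 * s 1) * Y 2 3 * (t 1 * t 2)) * s 4 by rewrite /Ye; braid.
  suff h : Q42 ((s 2 * s 1) * Y 2 3 * (t 1 * t 2)) by case: (I2_mixed H h).
  by apply: Q42_Y23; inB.
have T2 : D 2 (L * (t 4 * Y 1 2 * s 3 * s 4)).
  apply: L2; have -> : t 4 * Y 1 2 * s 3 * s 4 = Y 1 2 * s 3 * s 4 * t 3.
    by rewrite /Ye; braid.
  by apply: I2_D1; deg.
have T3 : D 2 (L * (t 4 * s 3 * Y 1 2 * s 3 * s 4) - qi *: (L * (t 4 * W_ * s 4))).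
  have -> : L * (t 4 * s 3 * Y 1 2 * s 3 * s 4) - qi *: (L * (t 4 * W_ * s 4)) =
      - qi *: (L * (t 4 * (s 3 * (X 1 2 - q *: Y 1 2) * s 3) * s 4)).
    have Q := ok_q H; rewrite /Wp mulrBr mulrBl mulrBr mulrBl mulrBr.
    rewrite !(scale_mulr, scale_mull) !mulrA; lmod K.
  apply: (subZ (sD 2)); apply: L2.
  have h : Q42 (s 3 * (X 1 2 - q *: Y 1 2) * s 3).
    by apply: (u3uuu_Q42 H) => //; exact: (uuu_XY H adj12).
  by case: (I2_mixed H h).
have gE : L * (t 4 * W_ * s 4) = s 1 * s 2 * s 3 * s 2 * g1.
  by rewrite /L /g1 /Wp /Xe; braid.
rewrite gE in T3.
(* One factor q^-1 is the coefficient of s_3 in t_3^2; the other comes from replacing t_2 s_1 t_2 by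
   s_2 t_1 s_2 to form w_+. *)
have -> : fe - (qi * qi) *: (s 1 * s 2 * s 3 * s 2 * g1) =
  ((p + q) * qi) *: (L * (t 4 * t 3 * Y 1 2 * s 3 * s 4))
  - ((p + 1) * qi) *: (L * (t 4 * Y 1 2 * s 3 * s 4))
  + qi *: (L * (t 4 * s 3 * Y 1 2 * s 3 * s 4) - qi *: (s 1 * s 2 * s 3 * s 2 * g1)).
  rewrite fE (ok_tt H) // !(mulrDr, mulrDl, mulrN, mulNr, scale_mulr, scale_mull, mulr1).
  by lmod K.
by spanP (sD 2).
Qed.

Lemma fe_V : fe = s 4 * (X 2 3 * (s 1 * t 2 * s 1)) * V.
Proof. by rewrite /Fe /Ve /Xe; braid. Qed.

Lemma fe_R v : pw 2 v \/ pw 3 v -> D 2 (fe * v - fe).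
Proof.
move=> hv; rewrite fe_V -mulrA -mulrBr; apply: (kill_l H) => //.
  by rewrite /Xe; inB.
by case: hv => hv; [apply: (VR2 H)|apply: (VR3 H)].
Qed.

(** Left multiplication commutes with the right action: as s_1 s_2 s_3 s_2 and q are invertible, the
    right invariance of f passes to g. *)
Lemma g1_R v : pw 2 v \/ pw 3 v -> D 2 (g1 * v - g1).
Proof.
move=> hv; have Q := ok_q H; have hv4 : B4 v by case: hv => -[] ->; inB.
have h := fe_g1; have h2 := fe_R hv.
have E : g1 * v - g1 = (t 2 * t 3 * t 2 * t 1) *
    ((q * q) *: ((fe * v - fe) - (fe - (qi * qi) *: (s 1 * s 2 * s 3 * s 2 * g1)) * v
     + (fe - (qi * qi) *: (s 1 * s 2 * s 3 * s 2 * g1)))).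
  have e1 : (t 2 * t 3 * t 2 * t 1) * (s 1 * s 2 * s 3 * s 2 * g1) = g1.
    by rewrite /g1 /Wp /Xe; braid.
  have e2 : (t 2 * t 3 * t 2 * t 1) * (s 1 * s 2 * s 3 * s 2 * g1 * v) = g1 * v.
    by rewrite mulrA e1.
  have -> : (fe * v - fe) - (fe - (qi * qi) *: (s 1 * s 2 * s 3 * s 2 * g1)) * v
     + (fe - (qi * qi) *: (s 1 * s 2 * s 3 * s 2 * g1)) =
     (qi * qi) *: (s 1 * s 2 * s 3 * s 2 * g1 * v)
     - (qi * qi) *: (s 1 * s 2 * s 3 * s 2 * g1).
    by rewrite mulrBl scale_mull; lmod K.
  rewrite -scalerBr scalerA.
  have -> : q * q * (qi * qi) = 1 by ring: Q.
  by rewrite scale1r mulrBr e1 e2.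
rewrite E; have hM : B4 (t 2 * t 3 * t 2 * t 1) by inB.
set z := (X in _ * X); suff hz : D 2 z by deg.
rewrite /z; apply: (subZ (sD 2)); apply: (subD (sD 2)) => //; apply: (subB (sD 2)) => //.
move: h hv4; move: (fe - _) => y h hv4; deg.
Qed.

(** s_1 commutes with s_4 and s_3 and reaches s_2 t_1 s_2 inside the first w_+; the error sits
    between s_4 and t_4, hence lies in [I2]. *)
Lemma g1_s1 : D 2 (s 1 * g1 - g1).
Proof.
have -> : s 1 * g1 - g1 = s 4 * (s 3 * (s 1 * X 1 2 - X 1 2) * s 3) * t 4 * W_ * s 4.
  rewrite mulrBr mulrBl mulrBr !mulrBl; congr (_ - _); rewrite /g1 /Wp /Xe; braid.
apply: (kill_r H) => //; first by apply: W_B4; left.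
have h : Q42 (s 3 * (s 1 * X 1 2 - X 1 2) * s 3).
  by apply: (u3uuu_Q42 H) => //; exact: (uuu_XL H adj12).
by case: (I2_mixed H h).
Qed.

Lemma rv_g1 : rv g1 = g1.
Proof.
rewrite /g1 /Wp /Xe !(ok_rvM H) !(ok_rv_s H) // !(rv_t H) //; braid.
Qed.

Lemma rv_fe : rv fe = fe.
Proof.
rewrite /Fe /Ve /Xe !(ok_rvM H) !(ok_rv_s H) // !(rv_t H) //; braid.
Qed.

Lemma rv_V : rv V = V.
Proof.
rewrite /Ve /Xe !(ok_rvM H) !(ok_rv_s H) // !(rv_t H) //; braid.
Qed.

(** g is a palindrome, so reversal turns its right invariance under s_2 and s_3 into left
    invariance; s_1 is [g1_s1]. *)
Lemma g1_Ls i : (0 < i <= 3)%N -> D 2 (s i * g1 - g1).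
Proof.
move=> hi; have h3 : (i = 1 \/ i = 2 \/ i = 3)%N by lia.
case: h3 => [->|[->|->]]; first exact: g1_s1.
  have := D_rv H (g1_R (or_introl (pws s t 2))).
  by rewrite (rvD H) (rvN H) (ok_rvM H) rv_g1 (ok_rv_s H).
have := D_rv H (g1_R (or_intror (pws s t 3))).
by rewrite (rvD H) (rvN H) (ok_rvM H) rv_g1 (ok_rv_s H).
Qed.

(** As g is fixed by s_1, s_2 and s_3 on the left, the factor s_1 s_2 s_3 s_2 in [fe_g1] disappears:
    f is congruent to q^-2 g, and has the same left invariance. *)
Lemma fe_Ls i : (0 < i <= 3)%N -> D 2 (s i * fe - fe).
Proof.
have h b : B4 b -> D 2 (b * fe - (qi * qi) *: (b * s 1 * s 2 * s 3 * s 2 * g1)).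
  move=> hb; have := fe_g1; move: fe g1 => f g h.
  have -> : b * f - (qi * qi) *: (b * s 1 * s 2 * s 3 * s 2 * g) =
    b * (f - (qi * qi) *: (s 1 * s 2 * s 3 * s 2 * g)).
    by rewrite mulrBr scale_mulr !mulrA.
  deg.
have step b j : B4 b -> (0 < j <= 3)%N -> D 2 (b * s j * g1 - b * g1).
  move=> hb hj; have := g1_Ls hj; move: g1 => g hg.
  have -> : b * s j * g - b * g = b * (s j * g - g) by rewrite mulrBr mulrA.
  deg.
have triv b : B4 b -> D 2 (b * s 1 * s 2 * s 3 * s 2 * g1 - b * g1).
  move=> hb.
  apply: (sub_modt (sD 2) (y := b * s 1 * s 2 * s 3 * g1)); first by apply: step => //; inB.
  apply: (sub_modt (sD 2) (y := b * s 1 * s 2 * g1)); first by apply: step => //; inB.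
  apply: (sub_modt (sD 2) (y := b * s 1 * g1)); first by apply: step => //; inB.
  exact: step.
have main b : B4 b -> D 2 (b * fe - (qi * qi) *: (b * g1)).
  move=> hb; apply: (sub_modt (sD 2) (h b hb)).
  by apply: (sub_modZ (sD 2)); apply: triv.
move=> hi; have hs : B4 (s i) by apply: salg_s.
apply: (sub_modt (sD 2) (main _ hs)).
have h1 := main 1 (Salg1 _ _ _); rewrite !mul1r in h1.
apply: (sub_modt (sD 2) (y := (qi * qi) *: g1)); last exact: (sub_mods (sD 2)).
by apply: (sub_modZ (sD 2)); apply: g1_Ls.
Qed.

Lemma fe_Rs i : (0 < i <= 3)%N -> D 2 (fe * s i - fe).
Proof.
move=> hi; have := D_rv H (fe_Ls hi).
by rewrite (rvD H) (rvN H) (ok_rvM H) rv_fe (ok_rv_s H) //; lia.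
Qed.

Definition Lf (z : A) : Prop := exists k : K, D 2 (z - k *: fe).

Lemma sLf : submod Lf.
Proof.
split=> [|c x y [k hk] [l hl]].
  by exists 0; rewrite scale0r subrr; apply: (sub0 (sD 2)).
exists (c * k + l).
have -> : c *: x + y - (c * k + l) *: fe = c *: (x - k *: fe) + (y - l *: fe).
  by lmod K.
exact: (sD 2).2.
Qed.

Lemma Lf_D2 z : D 2 z -> Lf z.
Proof. by exists 0; rewrite scale0r subr0. Qed.
Lemma Lf_fe : Lf fe.
Proof. by exists 1; rewrite scale1r subrr; apply: (sub0 (sD 2)). Qed.
Lemma Lf_mod x y : D 2 (x - y) -> Lf y -> Lf x.
Proof. by move=> h; apply: (sub_mod sLf); apply: Lf_D2. Qed.

Lemma fe_Lt i : (0 < i <= 3)%N -> D 2 (t i * fe - fe).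
Proof.
move=> hi; have h := fe_Ls hi; have hi5 : (0 < i < 5)%N by lia.
have ht : B4 (t i) by apply: salg_t.
have -> : t i * fe - fe = - (t i * (s i * fe - fe)).
  by rewrite mulrBr (mulrA (t i) (s i)) (ok_ts H) // mul1r opprB.
apply: (subN (sD 2)); move: h; move: (s i * fe - fe) => y h; deg.
Qed.

Lemma fe_Rt i : (0 < i <= 3)%N -> D 2 (fe * t i - fe).
Proof.
move=> hi; have := D_rv H (fe_Lt hi).
by rewrite (rvD H) (rvN H) (ok_rvM H) rv_fe (rv_t H) //; lia.
Qed.

Lemma Lf_fR a : B4 a -> Lf (fe * a).
Proof.
have step x b : B4 b -> D 2 (fe * b - fe) -> Lf (fe * x) -> Lf (fe * (x * b)).
  move=> hb h [k hk]; exists k.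
  have -> : fe * (x * b) - k *: fe = (fe * x - k *: fe) * b + k *: (fe * b - fe).
    by rewrite mulrBl scale_mull mulrA; lmod K.
  apply: (subD (sD 2)); last exact: (subZ (sD 2)).
  move: hk; move: (fe * x - _) => y hy; deg.
elim=> [|i x hi _ IH|i x hi _ IH|c x y _ IHx _ IHy].
- by rewrite mulr1; apply: Lf_fe.
- by apply: step IH; [apply: salg_s|apply: fe_Rs].
- by apply: step IH; [apply: salg_t|apply: fe_Rt].
- by rewrite mulrDr scale_mulr; apply: sLf.2.
Qed.

Lemma Lf_R z a : B4 a -> Lf z -> Lf (z * a).
Proof.
move=> ha [k hk]; apply: (Lf_mod (y := k *: (fe * a))).
  have -> : z * a - k *: (fe * a) = (z - k *: fe) * a by rewrite mulrBl scale_mull.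
  move: hk; move: (z - _) => y hy; deg.
by apply: (subZ sLf); apply: Lf_fR.
Qed.

Lemma Lf_rv z : Lf z -> Lf (rv z).
Proof.
move=> [k hk]; exists k; have := D_rv H hk.
by rewrite (rvD H) (rvN H) (rvZ H) rv_fe.
Qed.

Lemma V_Q4 z w : B4 z -> pw 4 w -> Lf (V * z * w).
Proof.
move=> hz hw; have h42 y : Q42 y -> Lf (V * y * w).
  move=> hy; have [l [hl hD]] := V_Q42 H hy hw; apply: (Lf_mod hD).
  by apply: Lf_fR; apply: salg23.
move: z hz; apply: (B4_ind H (submod_lr sLf _ _)) => [z /h42 //|a u b hu ha hb].
have hab : B3 (a * b) by apply: salgM.
have -> : V * (a * u * b) * w =
    - (V * (1 * (u * a - a * u) * b) * w) + V * u * w * (a * b).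
  by rewrite -(mulrA (V * u)) (w_comm H hw hab); expand; lmod K.
apply: (subD sLf).
  apply: (subN sLf); apply: h42; apply: Q42_lr => //; first exact: Salg1.
  exact: (W_comm H).
by apply: Lf_R; [apply: salg23|apply/Lf_D2/(V_W H)].
Qed.

Lemma Lf_L z a : B4 a -> Lf z -> Lf (a * z).
Proof.
move=> ha [k hk]; apply: (Lf_mod (y := k *: (a * fe))).
  have -> : a * z - k *: (a * fe) = a * (z - k *: fe) by rewrite mulrBr scale_mulr.
  move: hk; move: (z - _) => y hy; deg.
apply: (subZ sLf).
have ha' := salg_rv H (n := 3) isT ha.
have := Lf_rv (Lf_fR ha').
by rewrite (ok_rvM H) rv_fe (salg_rvK H (n := 3)).
Qed.

Lemma Q4_V z w : B4 z -> pw 4 w -> Lf (w * z * V).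
Proof.
move=> hz hw; have hz' := salg_rv H (n := 3) isT hz.
have := Lf_rv (V_Q4 hz' hw).
by rewrite 2!(ok_rvM H) rv_V (salg_rvK H (n := 3)) // (pw_rv H _ hw) // mulrA.
Qed.

End DegreeThree.

(** * Words in s_4, t_4, w_+ and w_- *)

Section Relations.
Variables (K : comNzRingType) (A : algType K) (s t : nat -> A) (p q qi : K)
  (rv : A -> A).
Hypothesis H : ok s t p q qi rv.
Local Notation pw := (pw s t).
Local Notation uuu := (uuu_span s t).
Local Notation B3 := (salg s t 2).
Local Notation B4 := (salg s t 3).
Local Notation Q41 := (Q41 s t).
Local Notation Q42 := (Q42 s t).
Local Notation D := (D s t).
Local Notation X i j := (Xe s t i j).
Local Notation Y i j := (Ye s t i j).
Local Notation W_ := (Wp s t).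
Local Notation W' := (Wm s t).
Local Notation V := (Ve s t).
Local Notation V' := (Ve t s).
Local Notation fe := (Fe s t).
Local Notation I2 := (I2 s t).
Local Notation sD k := (@sD K A s t k).

Lemma chi_y : D 2 (q *: (V * (t 1 * s 2 * t 1) * X 2 3 * s 4) - fe).
Proof.
have -> : q *: (V * (t 1 * s 2 * t 1) * X 2 3 * s 4) - fe =
    - (V * (X 2 1 - q *: Y 2 1) * X 2 3 * s 4).
  by rewrite /Fe -/(X 2 1) -/(Y 2 1) !(mulrBl, mulrBr) opprB !(scale_mulr, scale_mull).
by apply: (subN (sD 2)); apply: (chi_uuu H); apply: (uuu_XY H adj21).
Qed.

(** In the expansion of t_2^2 only the term in s_2 survives. One q^-1 is its coefficient, the other
    comes from t_1 s_2 t_1 being congruent to q^-1 y. *)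
Lemma chi_tttt : D 2 (V * (t 1 * (t 2 * t 2) * t 1) * X 2 3 * s 4 - (qi * qi) *: fe).
Proof.
have Q := ok_q H; have h := chi_y.
have h1 : D 2 (V * (t 1 * t 2 * t 1) * X 2 3 * s 4).
  have -> : t 1 * t 2 * t 1 = t 2 * t 1 * t 2 by braid.
  by apply: (chi_uuu H); uin.
have h2 : D 2 (V * (t 1 * t 1) * X 2 3 * s 4).
  have := pw_mul H (i := 1) isT (pwt _ _ 1) (pwt _ _ 1) => hs.
  have -> : V * (t 1 * t 1) * X 2 3 * s 4 = V * (t 1 * t 1) * (X 2 3 * s 4).
    by rewrite !mulrA.
  move: hs; apply: (pw_span_ind (sD 2)) => a ha.
  have -> : V * a * (X 2 3 * s 4) = V * a * X 2 3 * s 4 by rewrite !mulrA.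
  exact: (chi_u1 H).
have -> : V * (t 1 * (t 2 * t 2) * t 1) * X 2 3 * s 4 - (qi * qi) *: fe =
    ((p + q) * qi) *: (V * (t 1 * t 2 * t 1) * X 2 3 * s 4)
    - ((p + 1) * qi) *: (V * (t 1 * t 1) * X 2 3 * s 4)
    + (qi * qi) *: (q *: (V * (t 1 * s 2 * t 1) * X 2 3 * s 4) - fe).
  rewrite (ok_tt H) // !(mulrDr, mulrDl, mulrN, mulNr, scale_mulr, scale_mull, mulr1).
  by lmod K.
by spanP (sD 2).
Qed.

Lemma V_Y23 h : B3 h -> D 2 (q *: (V * h * Y 2 3 * s 4) - V * h * X 2 3 * s 4).
Proof.
move=> hh; have hU : Q41 (X 2 3 - q *: Y 2 3).
  by apply: uuu23_Q41; apply: (uuu_XY H adj23).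
have -> : q *: (V * h * Y 2 3 * s 4) - V * h * X 2 3 * s 4 =
    - (V * (h * (X 2 3 - q *: Y 2 3) * 1) * s 4).
  by rewrite mulr1 !(mulrBr, mulrBl) opprB !(scale_mulr, scale_mull) !mulrA.
apply: (subN (sD 2)); apply: (V_Q41 H) => //; apply: Q41_lr => //; exact: Salg1.
Qed.

(** Up to braid relations t_2 goes through w_-, and t_1 would too if it commuted with t_2 s_1 t_2;
    then V w_- s_4 would come out, which has degree at most 2. The commutator lies in u_1 u_2 u_1,
    and it contributes words covered by [V_Q41] and [chi_u1]. *)
Lemma V_ttW : D 2 (V * t 1 * t 2 * W' * s 4).
Proof.
have -> : V * t 1 * t 2 * W' * s 4 =
    V * (t 3 * ((t 1 * Y 1 2 - Y 1 2) - (Y 1 2 * t 1 - Y 1 2)) * t 3) * (t 2 * s 4)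
    + V * W' * s 4 * (t 1 * t 2).
  rewrite opprB addrA subrK !(mulrBr, mulrBl).
  have -> : V * (t 3 * (t 1 * Y 1 2) * t 3) * (t 2 * s 4) = V * t 1 * t 2 * W' * s 4.
    by rewrite /Wm /Ve /Xe /Ye; braid.
  have -> : V * (t 3 * (Y 1 2 * t 1) * t 3) * (t 2 * s 4) = V * W' * s 4 * (t 1 * t 2).
    by rewrite /Wm /Ve /Xe /Ye; braid.
  by rewrite subrK.
apply: (subD (sD 2)); last first.
  have := V_W H (or_intror (erefl _)) (pws s t 4) => ?; deg.
have hu : uuu 1 2 ((t 1 * Y 1 2 - Y 1 2) - (Y 1 2 * t 1 - Y 1 2)).
  apply: (subB (uuu_submod _ _ _ _)); first exact: (uuu_YL H adj12).
  exact: (uuu_YR H adj12).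
have -> r : V * (t 3 * r * t 3) * (t 2 * s 4) = (V * t 3) * r * (t 3 * (t 2 * s 4)).
  by rewrite !mulrA.
move: hu; apply: (uuu_ind (sD 2)) => a b c ha hb hc.
have [ha3 hc3] : B3 a /\ B3 c by split; [case: ha|case: hc] => ->; inB.
have -> : V * t 3 * (a * b * c) * (t 3 * (t 2 * s 4)) =
    V * a * (t 3 * b * t 3) * (c * t 2 * s 4).
  by case: ha {ha3} => ->; case: hc {hc3} => ->; case: hb => ->;
    rewrite /Ve /Xe; braid.
apply: (triple_ind H (sD 2) adj23) => // [a' b' c' ha' hb' hc'|].
  have -> : V * a * (a' * b' * c') * (c * t 2 * s 4) =
      V * (a * (a' * b' * c') * (c * t 2)) * s 4 by rewrite !mulrA.
  apply: (V_Q41 H) => //; apply: Q41_lr => //; first by inB.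
  by apply: uuu23_Q41; apply: pw_uuu.
have -> : V * a * X 2 3 * (c * t 2 * s 4) = V * a * X 2 3 * s 4 * (c * t 2).
  by rewrite /Ve /Xe; braid.
have := chi_u1 H ha => ?; deg.
Qed.

(** Expand the square in t_3 w_- = t_3^2 (t_2 s_1 t_2) t_3. Only the term in s_3, with coefficient
    q^-1, survives: it is V t_1 t_2^2 t_1 (t_3 s_2 t_3) s_4 s_1 s_2. Here t_3 s_2 t_3 costs q^-1
    against x, [chi_tttt] gives q^-2, and s_1 s_2 fixes f. *)
Lemma V_tttW : D 2 (V * t 1 * t 2 * t 3 * W' * s 4 - (qi * qi * qi * qi) *: fe).
Proof.
have Q := ok_q H.
have h1 := V_ttW.
have hY : B3 (t 1 * t 2 * Y 1 2) by rewrite /Ye; inB.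
have h2 := V_B3u3 H hY (pwt s t 3) (pws s t 4).
have hT : B3 (t 1 * (t 2 * t 2) * t 1) by inB.
have h3 := V_Y23 hT.
have h4 := chi_tttt.
have h5 : D 2 (V * (t 1 * (t 2 * t 2) * t 1) * Y 2 3 * s 4 - (qi * qi * qi) *: fe).
  apply: (q_sub H (sD 2)).
  have -> : q *: (V * (t 1 * (t 2 * t 2) * t 1) * Y 2 3 * s 4 - (qi * qi * qi) *: fe) =
     (q *: (V * (t 1 * (t 2 * t 2) * t 1) * Y 2 3 * s 4)
       - V * (t 1 * (t 2 * t 2) * t 1) * X 2 3 * s 4) +
     (V * (t 1 * (t 2 * t 2) * t 1) * X 2 3 * s 4 - (qi * qi) *: fe) by lmod K.
  exact: (subD (sD 2)).
have h6 : D 2 (V * (t 1 * (t 2 * t 2) * t 1) * Y 2 3 * s 4 * s 1 * s 2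
               - (qi * qi * qi) *: fe).
  have h7 := fe_Rs H (i := 1) isT; have h8 := fe_Rs H (i := 2) isT.
  apply: (sub_modt (sD 2) (y := (qi * qi * qi) *: (fe * s 1 * s 2))).
    move: h5; move: (V * _ * _ * _) => z h5; have -> : z * s 1 * s 2 -
       (qi * qi * qi) *: (fe * s 1 * s 2) = (z - (qi * qi * qi) *: fe) * s 1 * s 2.
      by rewrite !mulrBl !scale_mull.
    move: h5; move: (z - _) => y h5; deg.
  apply: (sub_modZ (sD 2)); move: h7 h8; move: fe => f h7 h8.
  apply: (sub_modt (sD 2) (y := f * s 2)) => //.
  rewrite -mulrBl; move: h7; move: (_ - f) => y h7; deg.
have e1 : V * t 1 * t 2 * t 3 * W' * s 4 = V * t 1 * t 2 * (t 3 * t 3) * Y 1 2 * t 3 * s 4.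
  by rewrite /Wm !mulrA.
have e2 : V * t 1 * t 2 * s 3 * Y 1 2 * t 3 * s 4 =
    V * (t 1 * (t 2 * t 2) * t 1) * Y 2 3 * s 4 * s 1 * s 2.
  by rewrite /Ve /Xe /Ye; braid.
have e3 : V * t 1 * t 2 * t 3 * Y 1 2 * t 3 * s 4 = V * t 1 * t 2 * W' * s 4.
  by rewrite /Wm !mulrA.
have e4 : V * t 1 * t 2 * Y 1 2 * t 3 * s 4 = V * (t 1 * t 2 * Y 1 2) * t 3 * s 4.
  by rewrite !mulrA.
have -> : V * t 1 * t 2 * t 3 * W' * s 4 - (qi * qi * qi * qi) *: fe =
   ((p + q) * qi) *: (V * t 1 * t 2 * W' * s 4)
   - ((p + 1) * qi) *: (V * (t 1 * t 2 * Y 1 2) * t 3 * s 4)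
   + qi *: (V * (t 1 * (t 2 * t 2) * t 1) * Y 2 3 * s 4 * s 1 * s 2
               - (qi * qi * qi) *: fe).
  rewrite e1 (ok_tt H) // !(mulrDr, mulrDl, mulrN, mulNr, scale_mulr, scale_mull, mulr1).
  by rewrite e2 e3 e4; lmod K.
by spanP (sD 2).
Qed.

(* t_4 w_+ s_4 w_- s_4: its left part is s_3 s_2 s_1 V t_1 t_2 t_3. *)
Definition m1 : A := t 4 * W_ * s 4 * W' * s 4.

Lemma fe_L3 : D 2 (s 3 * s 2 * s 1 * fe - fe).
Proof.
have h1 := fe_Ls H (i := 1) isT; have h2 := fe_Ls H (i := 2) isT.
have h3 := fe_Ls H (i := 3) isT; move: h1 h2 h3; move: fe => f h1 h2 h3.
apply: (sub_modt (sD 2) (y := s 3 * s 2 * f)).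
  rewrite -mulrA -mulrBr; move: h1; move: (_ - f) => y h1; deg.
apply: (sub_modt (sD 2) (y := s 3 * f)) => //.
rewrite -mulrA -mulrBr; move: h2; move: (_ - f) => y h2; deg.
Qed.

Lemma m1_fe : D 2 (m1 - (qi * qi * qi * qi) *: fe).
Proof.
have -> : m1 = s 3 * s 2 * s 1 * (V * t 1 * t 2 * t 3 * W' * s 4).
  by rewrite /m1 /Wp /Wm /Ve /Xe /Ye; braid.
have h := V_tttW; have h3 := fe_L3; move: h h3.
move: (V * _ * _ * _ * _ * _) fe => z f h h3.
apply: (sub_modt (sD 2) (y := (qi * qi * qi * qi) *: (s 3 * s 2 * s 1 * f))).
  rewrite -scale_mulr -mulrBr; move: h; move: (z - _) => y h; deg.
exact: (sub_modZ (sD 2)).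
Qed.

Lemma cross34 (l r : A) :
  l * s 3 * s 4 * t 3 * r - l * s 3 * t 4 * t 3 * r - l * t 3 * s 4 * s 3 * r
    + l * t 3 * t 4 * s 3 * r =
  l * s 3 * s 4 * r - l * s 3 * t 4 * r - l * s 4 * s 3 * r + l * t 4 * s 3 * r
    + l * s 4 * t 3 * r - l * t 4 * t 3 * r - l * t 3 * s 4 * r + l * t 3 * t 4 * r.
Proof.
have E := congr1 (fun z => l * z * r) (ok_cross H (i := 3) (j := 4) isT isT isT).
by rewrite ?expandE in E; exact: E.
Qed.

Lemma Z'_Q4 z w : B4 z -> pw 4 w -> D 2 (Y 3 4 * z * w).
Proof.
move=> hz hw; apply: D_swap; apply: (Z_Q4 (ok_swap H)).
  exact: salg_swap.
exact: pw_swap.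
Qed.

(** The cross relation of s_3 and s_4 is inserted between s_2 t_1 s_2 and t_2 s_1 t_2. Its first two
    terms complete w_+ and w_- around s_4 and around t_4, giving the two words compared; the other
    ten terms have degree at most 2. *)
Lemma m12 : D 2 (m1 - t 4 * W_ * t 4 * W' * s 4).
Proof.
have hX : B3 (X 1 2) by rewrite /Xe; inB.
have hY : B3 (Y 1 2) by rewrite /Ye; inB.
have [hw4 hw4'] := (pws s t 4, pwt s t 4).
have hx a b : B3 a -> B3 b -> Q42 (a * X 2 3 * b) by apply: Q42x.
have E := cross34 (t 4 * s 3 * X 1 2) (Y 1 2 * t 3 * s 4).
set e1 := _ * s 3 * s 4 * t 3 * _ in E; set e2 := _ * s 3 * t 4 * t 3 * _ in E.
set e3 := _ * t 3 * s 4 * s 3 * _ in E; set e4 := _ * t 3 * t 4 * s 3 * _ in E.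
set e5 := _ * s 3 * s 4 * _ in E; set e6 := _ * s 3 * t 4 * _ in E.
set e7 := _ * s 4 * s 3 * _ in E; set e8 := _ * t 4 * s 3 * _ in E.
set e9 := _ * s 4 * t 3 * _ in E; set e10 := _ * t 4 * t 3 * _ in E.
set e11 := _ * t 3 * s 4 * _ in E; set e12 := _ * t 3 * t 4 * _ in E.
have h3 : D 2 e3.
  have -> : e3 = (t 4 * ((t 2 * t 1) * X 2 3 * (s 1 * s 2)) * s 4)
      * (s 3 * Y 1 2 * t 3) * s 4 by rewrite /e3 /Xe /Ye; braid.
  apply: (kill_r H) => //; first by rewrite /Ye; inB.
  by case: (I2_mixed H (hx (t 2 * t 1) (s 1 * s 2) ltac:(inB) ltac:(inB))).
have h4 : D 2 e4.
  have -> : e4 = t 4 * (s 3 * X 1 2 * t 3) *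
      (t 4 * ((t 2 * t 1) * Y 2 3 * (s 1 * s 2)) * s 4) by rewrite /e4 /Xe /Ye; braid.
  apply: (kill_l H) => //; first by rewrite /Xe; inB.
  have h : Q42 ((t 2 * t 1) * Y 2 3 * (s 1 * s 2)) by apply: (Q42_Y23 H); inB.
  by case: (I2_mixed H h).
have h5 : D 2 e5.
  have -> : e5 = t 4 * (W_ * Y 1 2) * X 3 4 by rewrite /e5 /Wp /Xe /Ye; braid.
  by apply: (Q4_Z H) => //; rewrite /Wp /Xe /Ye; inB.
have h6 : D 2 e6.
  have -> : e6 = t 4 * (W_ * Y 1 2) * (s 3 * t 4 * t 3) by rewrite /e6 /Wp /Xe /Ye; braid.
  by rewrite /Wp /Xe /Ye; deg.
have h7 : D 2 e7.
  have -> : e7 = s 3 * s 4 * t 3 * X 1 2 * s 3 * Y 1 2 * t 3 * s 4.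
    by rewrite /e7 /Xe /Ye; braid.
  deg.
have h8 : D 2 e8.
  have -> : e8 = Y 3 4 * (X 1 2 * s 3 * Y 1 2 * t 3) * s 4 by rewrite /e8 /Xe /Ye; braid.
  by apply: Z'_Q4 => //; rewrite /Xe /Ye; inB.
have h9 : D 2 e9.
  have -> : e9 = s 3 * s 4 * t 3 * X 1 2 * t 3 * Y 1 2 * t 3 * s 4.
    by rewrite /e9 /Xe /Ye; braid.
  deg.
have h10 : D 2 e10.
  have -> : e10 = Y 3 4 * (X 1 2 * t 3 * Y 1 2 * t 3) * s 4 by rewrite /e10 /Xe /Ye; braid.
  by apply: Z'_Q4 => //; rewrite /Xe /Ye; inB.
have h11 : D 2 e11.
  have -> : e11 = t 4 * (s 3 * X 1 2 * t 3 * Y 1 2) * X 3 4 by rewrite /e11 /Xe /Ye; braid.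
  by apply: (Q4_Z H) => //; rewrite /Xe /Ye; inB.
have h12 : D 2 e12.
  have -> : e12 = t 4 * (s 3 * X 1 2 * t 3 * Y 1 2) * (s 3 * t 4 * t 3).
    by rewrite /e12 /Xe /Ye; braid.
  deg.
have -> : m1 = e1 by rewrite /m1 /e1 /Wp /Wm /Xe /Ye; braid.
have -> : t 4 * W_ * t 4 * W' * s 4 = e2 by rewrite /e2 /Wp /Wm /Xe /Ye; braid.
have -> : e1 - e2 = e3 - e4 + e5 - e6 - e7 + e8 + e9 - e10 - e11 + e12.
  by apply: (eq_from (c := 1) E); lmod K.
by spanP (sD 2).
Qed.

Definition em : A := s 4 * W' * s 4 * W' * s 4.

(** Again an instance of the cross relation, whose term [e11] is the word itself. The only other
    term on the line is [e1], from the opposite side of the relation, hence the sign. It contains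
    s_4 (t_3 s_2 t_3) s_4, congruent to q^-1 V, followed by t_1 t_2 t_3 w_- s_4, which contributes
    the q^-4 of [V_tttW]. *)
Lemma em_fe : D 2 (em + (qi * qi * qi * qi * qi) *: fe).
Proof.
have Q := ok_q H.
have hX : B3 (X 1 2) by rewrite /Xe; inB.
have hY : B3 (Y 1 2) by rewrite /Ye; inB.
have [hw4 hw4'] := (pws s t 4, pwt s t 4).
have hU : Q41 (X 2 3 - q *: Y 2 3) by apply: uuu23_Q41; apply: (uuu_XY H adj23).
have hW : B4 W' by rewrite /Wm /Ye; inB.
have E := cross34 (s 4 * t 3 * Y 1 2) (W' * s 4).
set e1 := _ * s 3 * s 4 * t 3 * _ in E; set e2 := _ * s 3 * t 4 * t 3 * _ in E.
set e3 := _ * t 3 * s 4 * s 3 * _ in E; set e4 := _ * t 3 * t 4 * s 3 * _ in E.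
set e5 := _ * s 3 * s 4 * _ in E; set e6 := _ * s 3 * t 4 * _ in E.
set e7 := _ * s 4 * s 3 * _ in E; set e8 := _ * t 4 * s 3 * _ in E.
set e9 := _ * s 4 * t 3 * _ in E; set e10 := _ * t 4 * t 3 * _ in E.
set e11 := _ * t 3 * s 4 * _ in E; set e12 := _ * t 3 * t 4 * _ in E.
have hI : I2 (s 4 * ((s 2 * s 1) * Y 2 3 * (t 1 * t 2)) * t 4).
  have h : Q42 ((s 2 * s 1) * Y 2 3 * (t 1 * t 2)) by apply: (Q42_Y23 H); inB.
  by case: (I2_mixed H h).
have VY g : B4 g -> D 2 (q *: (s 2 * s 1 * s 4 * Y 2 3 * s 4 * g * s 4)
    - s 2 * s 1 * (V * g * s 4)).
  move=> hg; have -> : q *: (s 2 * s 1 * s 4 * Y 2 3 * s 4 * g * s 4)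
      - s 2 * s 1 * (V * g * s 4) =
      - (s 2 * s 1 * (s 4 * (X 2 3 - q *: Y 2 3) * s 4 * g * s 4)).
    by rewrite /Ve; move: (X 2 3) (Y 2 3) => a b; expand; rewrite ?opprD; lmod K.
  have := kill_r H hw4 hg (wQ41w H hw4 hw4 hU).
  by move: (_ * g * s 4) => z h; apply: (subN (sD 2)); deg.
have h1 : D 2 (e1 - (qi * qi * qi * qi * qi) *: fe).
  have -> : e1 = s 2 * s 1 * s 4 * Y 2 3 * s 4 * (t 1 * t 2 * t 3 * W') * s 4.
    by rewrite /e1 /Wm /Ye; braid.
  apply: (q_sub H (sD 2)).
  have hg : B4 (t 1 * t 2 * t 3 * W') by inB.
  have h := VY _ hg; have h2 := V_tttW.
  have h3 := fe_Ls H (i := 1) isT; have h4 := fe_Ls H (i := 2) isT.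
  have e0 : V * (t 1 * t 2 * t 3 * W') * s 4 = V * t 1 * t 2 * t 3 * W' * s 4.
    by rewrite !mulrA.
  rewrite e0 in h; move: h h2 h3 h4.
  move: (V * _ * _ * _ * _ * _) (s 2 * s 1 * s 4 * _ * _ * _ * _) fe => u z f h h2 h3 h4.
  have -> : q *: (z - (qi * qi * qi * qi * qi) *: f) =
    (q *: z - s 2 * s 1 * u) + s 2 * s 1 * (u - (qi * qi * qi * qi) *: f)
    + (qi * qi * qi * qi) *: (s 2 * (s 1 * f - f)) + (qi * qi * qi * qi) *: (s 2 * f - f).
    by expand; lmod K.
  apply: (subD (sD 2)); last exact: (subZ (sD 2)).
  apply: (subD (sD 2)); last first.
    by apply: (subZ (sD 2)); move: h3; move: (_ - f) => y h3; deg.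
  apply: (subD (sD 2)) => //; move: h2; move: (u - _) => y h2; deg.
have h2 : D 2 e2.
  have -> : e2 = s 4 * ((s 2 * s 1) * Y 2 3 * (t 1 * t 2)) * t 4 * (t 3 * W') * s 4.
    by rewrite /e2 /Wm /Ye; braid.
  by apply: (kill_r H) => //; inB.
have h3 : D 2 e3.
  have -> : e3 = s 4 * (W' * Y 1 2) * X 3 4 by rewrite /e3 /Wm /Xe /Ye; braid.
  by apply: (Q4_Z H) => //; inB.
have h4 : D 2 e4.
  have -> : e4 = s 4 * W' * Y 1 2 * (s 3 * t 4 * t 3) by rewrite /e4 /Wm /Xe /Ye; braid.
  deg.
have h5 : D 2 e5.
  have -> : e5 = s 2 * s 1 * s 4 * Y 2 3 * s 4 * (t 1 * t 2 * W') * s 4.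
    by rewrite /e5 /Wm /Ye; braid.
  apply: (q_sub H (sD 2)); have hg : B4 (t 1 * t 2 * W') by inB.
  apply: (sub_mod (sD 2) (VY _ hg)).
  have -> : V * (t 1 * t 2 * W') * s 4 = V * t 1 * t 2 * W' * s 4 by rewrite !mulrA.
  have := V_ttW => ?; deg.
have h6 : D 2 e6.
  have -> : e6 = s 4 * ((s 2 * s 1) * Y 2 3 * (t 1 * t 2)) * t 4 * W' * s 4.
    by rewrite /e6 /Wm /Ye; braid.
  by apply: (kill_r H).
have h7 : D 2 e7.
  have -> : e7 = X 3 4 * (Y 1 2 * s 3 * W') * s 4 by rewrite /e7 /Wm /Xe /Ye; braid.
  by apply: (Z_Q4 H) => //; inB.
have h8 : D 2 e8.
  have -> : e8 = (t 3 * t 4 * s 3) * Y 1 2 * s 3 * W' * s 4 by rewrite /e8 /Wm /Xe /Ye; braid.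
  deg.
have h9 : D 2 e9.
  have -> : e9 = X 3 4 * (Y 1 2 * t 3 * W') * s 4 by rewrite /e9 /Wm /Xe /Ye; braid.
  by apply: (Z_Q4 H) => //; inB.
have h10 : D 2 e10.
  have -> : e10 = (t 3 * t 4 * s 3) * Y 1 2 * t 3 * W' * s 4.
    by rewrite /e10 /Wm /Xe /Ye; braid.
  deg.
have h12 : D 2 e12.
  have -> : e12 = t 3 * t 2 * t 1 * (V' * (s 1 * s 2 * Y 1 2) * t 3 * s 4).
    by rewrite /e12 /Wm /Ve /Xe /Ye; braid.
  have hb : salg t s 2 (s 1 * s 2 * Y 1 2) by apply: salg_swap; inB.
  have := D_swap (V_B3u3 (ok_swap H) hb (pws t s 3) (pwt t s 4)) => ?; deg.
have -> : em = e11 by rewrite /em /e11 /Wm /Ye; braid.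
have -> : e11 + (qi * qi * qi * qi * qi) *: fe =
  - (e1 - (qi * qi * qi * qi * qi) *: fe) + e2 + e3 - e4 + e5 - e6 - e7 + e8 + e9 - e10 + e12.
  by apply: (eq_from (c := 1) E); lmod K.
by spanP (sD 2).
Qed.

End Relations.

Section Swap.
Variables (K : comNzRingType) (A : algType K) (s t : nat -> A) (p q qi : K)
  (rv : A -> A).
Hypothesis H : ok s t p q qi rv.
Local Notation D := (D s t).
Local Notation sD k := (@sD K A s t k).
Local Notation fe := (Fe s t).
Local Notation fe' := (Fe t s).

Lemma rv_m1_swap : rv (m1 t s) = t 4 * Wp s t * t 4 * Wm s t * s 4.
Proof.
rewrite /m1 /Wp /Wm /Xe /Ye !(ok_rvM H) !(ok_rv_s H) // !(rv_t H) //; braid.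
Qed.

(* Word reversal and the exchange of s and t relate [m1] to the right-hand side
   of [m12]. *)
Lemma fe_swap : D 2 (fe - (q * q * q * q * (q * q * q * q)) *: fe').
Proof.
have Q := ok_q H.
have h1 := m1_fe H; have h2 := m12 H.
have h3 := D_rv H (D_swap (m1_fe (ok_swap H))).
rewrite (rvD H) (rvN H) (rvZ H) (rv_fe (ok_swap H)) rv_m1_swap in h3.
(* The first word is congruent to q^-4 f and the second to q^4 f', because the exchange inverts q;
   equating them gives f = q^8 f' modulo degree at most 2. *)
move: h1 h2 h3; move: (t 4 * _ * _ * _ * _) (m1 s t) fe fe' => z m f f' h1 h2 h3.
have -> : f - (q * q * q * q * (q * q * q * q)) *: f' =
  (q * q * q * q) *: (- (m - (qi * qi * qi * qi) *: f) + (m - z)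
     + (z - (q * q * q * q) *: f')) by lmod K.
by apply: (subZ (sD 2)); apply: (subD (sD 2)) => //; apply: (subD (sD 2)) => //; apply: (subN (sD 2)).
Qed.

End Swap.

Section SwapLine.
Variables (K : comNzRingType) (A : algType K) (s t : nat -> A) (p q qi : K)
  (rv : A -> A).
Hypothesis H : ok s t p q qi rv.
Local Notation sD k := (@sD K A s t k).

Lemma Lf_swap z : Lf t s z -> Lf s t z.
Proof.
move=> [k /D_swap hk]; have /D_swap h := fe_swap (ok_swap H).
exists (k * (qi * qi * qi * qi * (qi * qi * qi * qi))).
have -> : z - (k * (qi * qi * qi * qi * (qi * qi * qi * qi))) *: Fe s t =
  (z - k *: Fe t s) + k *: (Fe t s - (qi * qi * qi * qi * (qi * qi * qi * qi)) *: Fe s t).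
  move: (Fe t s) (Fe s t) (_ * (qi * qi * qi * qi)) => f f2 c; lmod K.
by apply: (subD (sD 2)) => //; apply: (subZ (sD 2)).
Qed.

End SwapLine.

(** * Products of three factors u_4 *)

Section Spanning.
Variables (K : comNzRingType) (A : algType K) (s t : nat -> A) (p q qi : K)
  (rv : A -> A).
Hypothesis H : ok s t p q qi rv.
Local Notation pw := (pw s t).
Local Notation B4 := (salg s t 3).
Local Notation D := (D s t).
Local Notation X i j := (Xe s t i j).
Local Notation Y i j := (Ye s t i j).
Local Notation W_ := (Wp s t).
Local Notation W' := (Wm s t).
Local Notation V := (Ve s t).
Local Notation V' := (Ve t s).
Local Notation Lf := (Lf s t).

Lemma V'_Q4 z w : B4 z -> pw 4 w -> Lf (V' * z * w).
Proof.
by move=> hz hw; apply: (Lf_swap H); apply: (V_Q4 (ok_swap H)); [apply: salg_swap|apply: pw_swap].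
Qed.

Lemma Q4_V' z w : B4 z -> pw 4 w -> Lf (w * z * V').
Proof.
by move=> hz hw; apply: (Lf_swap H); apply: (Q4_V (ok_swap H)); [apply: salg_swap|apply: pw_swap].
Qed.

(** Between letters s_4 of opposite signs, w_+ gives a two-sided multiple of V by braid relations,
    and w_- one of the exchanged element V'. *)
Lemma wWw_mixed u : isW s t u ->
  exists a b, [/\ B4 a, B4 b & s 4 * u * t 4 = a * V * b \/ s 4 * u * t 4 = a * V' * b] /\
  exists a b, [/\ B4 a, B4 b & t 4 * u * s 4 = a * V * b \/ t 4 * u * s 4 = a * V' * b].
Proof.
case=> ->.
  exists (t 3 * t 2 * t 1), (s 1 * s 2 * s 3); split.
    by split; try inB; left; rewrite /Ve /Wp /Xe; braid.
  exists (s 3 * s 2 * s 1), (t 1 * t 2 * t 3).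
  by split; try inB; left; rewrite /Ve /Wp /Xe; braid.
exists (t 3 * t 2 * t 1), (s 1 * s 2 * s 3); split.
  by split; try inB; right; rewrite /Ve /Wm /Ye /Xe; braid.
exists (s 3 * s 2 * s 1), (t 1 * t 2 * t 3).
by split; try inB; right; rewrite /Ve /Wm /Ye /Xe; braid.
Qed.

Lemma wWw_V u w w' : isW s t u -> (w = s 4 /\ w' = t 4) \/ (w = t 4 /\ w' = s 4) ->
  exists a b, [/\ B4 a, B4 b & w * u * w' = a * V * b \/ w * u * w' = a * V' * b].
Proof.
by move=> /wWw_mixed [a [b [h1 h2]]] [[-> ->]|[-> ->]] //; exists a, b.
Qed.

(** With two factors w_+ braid relations lower the degree, and with one of each sign they produce Z.
    Only two factors w_- reach the line of f. *)
Lemma W_sss u u' : isW s t u -> isW s t u' -> Lf (s 4 * u * s 4 * u' * s 4).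
Proof.
have pp : D 2 (s 4 * W_ * s 4 * W_ * s 4).
  have -> : s 4 * W_ * s 4 * W_ * s 4 = s 3 * (s 4 * (W_ * X 1 2 * s 3) * s 4 * s 3).
    by rewrite /Wp /Xe; braid.
  by rewrite /Wp /Xe; deg.
have pm : D 2 (s 4 * W_ * s 4 * W' * s 4).
  have -> : s 4 * W_ * s 4 * W' * s 4 = t 3 * (s 4 * (W_ * Y 1 2) * X 3 4).
    by rewrite /Wp /Wm /Xe /Ye; braid.
  have hz : B4 (W_ * Y 1 2) by rewrite /Wp /Xe /Ye; inB.
  have := Q4_Z H hz (pws s t 4) => ?; deg.
case=> -> [] ->; try exact: Lf_D2.
  apply: Lf_D2; have := D_rv H pm; congr (D 2 _).
  by rewrite /Wp /Wm /Xe /Ye !(ok_rvM H) !(ok_rv_s H) // !(rv_t H) //; braid.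
exists (- (qi * qi * qi * qi * qi)).
by rewrite scaleNr opprK; apply: (em_fe H).
Qed.

Lemma isW_swap u : isW s t u -> isW t s u.
Proof. by case=> ->; [right|left]. Qed.

End Spanning.

Section Triples.
Variables (K : comNzRingType) (A : algType K) (s t : nat -> A) (p q qi : K)
  (rv : A -> A).
Hypothesis H : ok s t p q qi rv.
Local Notation pw := (pw s t).
Local Notation B4 := (salg s t 3).
Local Notation Q42 := (Q42 s t).
Local Notation D := (D s t).
Local Notation X i j := (Xe s t i j).
Local Notation Y i j := (Ye s t i j).
Local Notation V := (Ve s t).
Local Notation V' := (Ve t s).
Local Notation Lf := (Lf s t).
Local Notation sD k := (@sD K A s t k).
Local Notation sL := (sLf s t).

Lemma W_ttt u u' : isW s t u -> isW s t u' -> Lf (t 4 * u * t 4 * u' * t 4).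
Proof.
by move=> hu hu'; apply: (Lf_swap H); apply: (W_sss (ok_swap H)); apply: isW_swap.
Qed.

Lemma triple1 w z w' z' w'' : pw 4 w -> pw 4 w' -> pw 4 w'' -> B4 z -> B4 z' ->
  [\/ w = 1, w' = 1 | w'' = 1] -> D 2 (w * z * w' * z' * w'').
Proof.
move=> /pw4_D1 h /pw4_D1 h' /pw4_D1 h'' hz hz' [] E; subst.
- have -> : 1 * z * w' * z' * w'' = z * w' * z' * w'' by rewrite mul1r.
  deg.
- have -> : w * z * 1 * z' * w'' = w * (z * z') * w'' by rewrite mulr1 !mulrA.
  deg.
- by rewrite mulr1; deg.
Qed.

(** Opposite signs around x give an element of [I2], and two letters s_4 give V. Two letters t_4
    give q V' modulo [I2], and products with V' lie on the line by [Lf_swap]. *)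
Lemma triple_x w z w' z' w'' : pw 4 w -> pw 4 w' -> pw 4 w'' -> Q42 z -> B4 z' ->
  Lf (w * z * w' * z' * w'').
Proof.
move=> hw hw' hw'' hz hz'.
have hI y : I2 s t (w * y * w') -> Lf (w * y * w' * z' * w'').
  by move=> hy; apply: Lf_D2; apply: (kill_r H).
have E3 y : w * y * w' * z' * w'' = w * y * (w' * z' * w'') by rewrite !mulrA.
rewrite E3.
move: z hz; apply: (span_sub (submod_lr sL _ _)) => _ [y hy|a b ha hb].
  rewrite -E3; apply: hI; apply: (wQ41w H) => //; exact: mem_span.
have hX := B4_X23 s t; have [ha4 hb4] := (salg23 ha, salg23 hb).
have hab : B4 (a * X 2 3 * b) by inB.
have hbz : B4 (b * z') by inB.
have [i1|i1] : [\/ w = 1, w' = 1 | w'' = 1] \/ [/\ w <> 1 , w' <> 1 & w'' <> 1].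
  case: (eqVneq w 1) => [?|/eqP n1]; first by left; apply: Or31.
  case: (eqVneq w' 1) => [?|/eqP n2]; first by left; apply: Or32.
  by case: (eqVneq w'' 1) => [?|/eqP n3]; [left; apply: Or33|right].
  by rewrite -E3; apply: Lf_D2; apply: triple1.
case: i1 hw hw' => n1 n2 _ hw hw'.
have E v : w * (a * v * b) * (w' * z' * w'') = a * (w * v * w' * (b * z') * w'').
  by rewrite !mulrA (w_comm H hw ha) -(mulrA _ b w') -(w_comm H hw' hb) !mulrA.
case: hw n1 E hI E3 => // -> _ E hI E3; case: hw' n2 E hI E3 => // -> _ E hI E3.
- rewrite E; apply: (Lf_L H) => //; rewrite -/V; exact: (V_Q4 H).
- rewrite -E3; apply: hI; have hh : Q42 (a * X 2 3 * b) by apply: Q42x.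
  by have [] := I2_mixed H hh.
- rewrite -E3; apply: hI; have hh : Q42 (a * X 2 3 * b) by apply: Q42x.
  by have [] := I2_mixed H hh.
rewrite E; apply: (Lf_L H) => //.
apply: (Lf_mod (y := q *: (V' * (b * z') * w''))); last first.
  by apply: (subZ sL); apply: (V'_Q4 H).
have -> : t 4 * X 2 3 * t 4 * (b * z') * w'' - q *: (V' * (b * z') * w'') =
    t 4 * (X 2 3 - q *: Y 2 3) * t 4 * (b * z') * w''.
  by rewrite mulrBr !mulrBl !(scale_mulr, scale_mull).
apply: (kill_r H) => //; apply: (wQ41w H); try exact: Or33.
by apply: uuu23_Q41; apply: (uuu_XY H adj23).
Qed.

Lemma triple_W w u w' u' w'' : pw 4 w -> pw 4 w' -> pw 4 w'' ->
  isW s t u -> isW s t u' -> Lf (w * u * w' * u' * w'').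
Proof.
move=> hw hw' hw'' hu hu'; have [hu4 hu4'] := (W_B4 hu, W_B4 hu').
have L : (w = s 4 /\ w' = t 4) \/ (w = t 4 /\ w' = s 4) -> Lf (w * u * w' * u' * w'').
  have EA a v b : a * v * b * u' * w'' = a * (v * (b * u') * w'') by rewrite !mulrA.
  move=> /(wWw_V H hu) [a [b [ha hb E]]]; have hbu : B4 (b * u') by apply: salgM.
  by case: E => ->; rewrite EA; apply: (Lf_L H) => //; [apply: (V_Q4 H)|apply: (V'_Q4 H)].
have R : (w' = s 4 /\ w'' = t 4) \/ (w' = t 4 /\ w'' = s 4) -> Lf (w * u * w' * u' * w'').
  have -> : w * u * w' * u' * w'' = w * u * (w' * u' * w'') by rewrite !mulrA.
  have EA a v b : w * u * (a * v * b) = w * (u * a) * v * b by rewrite !mulrA.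
  move=> /(wWw_V H hu') [a [b [ha hb E]]]; have hua : B4 (u * a) by apply: salgM.
  by case: E => ->; rewrite EA; apply: (Lf_R H) => //; [apply: (Q4_V H)|apply: (Q4_V' H)].
have T1 : [\/ w = 1, w' = 1 | w'' = 1] -> Lf (w * u * w' * u' * w'').
  by move=> h; apply: Lf_D2; apply: triple1.
case: (hw) => e; first by apply/T1/Or31.
  case: (hw') => e'; [by apply/T1/Or32| |by apply: L; left].
  case: (hw'') => e''; [by apply/T1/Or33| |by apply: R; left].
  by rewrite e e' e''; exact: (W_sss H).
case: (hw') => e'; [by apply/T1/Or32|by apply: L; right|].
case: (hw'') => e''; [by apply/T1/Or33|by apply: R; right|].
by rewrite e e' e''; exact: W_ttt.
Qed.

Lemma span_rv (z z' : A) w w' w'' : pw 4 w -> pw 4 w' -> pw 4 w'' -> B4 z -> B4 z' ->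
  Lf (w'' * rv z' * w' * rv z * w) -> Lf (w * z * w' * z' * w'').
Proof.
move=> hw hw' hw'' hz hz' /(Lf_rv H).
rewrite !(ok_rvM H) !(salg_rvK H (n := 3)) // !(pw_rv H (i := 4)) //.
by rewrite !mulrA.
Qed.

Lemma Q42_rv z : Q42 z -> Q42 (rv z).
Proof.
elim=> [|c x y [z' hz|a b ha hb] _ IH]; rewrite ?(rv0 H) ?(ok_rvL H).
- exact: (sub0 (s42 s t)).
- apply: (s42 s t).2 => //; apply: Q41_42; apply: (Q41_rv H); exact: mem_span.
apply: (s42 s t).2 => //; rewrite /Xe !(ok_rvM H) !(ok_rv_s H) // (rv_t H) //.
rewrite (mulrA (s 3) (t 2)) mulrA.
by apply: Q42x; apply: (salg_rv H).
Qed.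

Lemma Q42_B4 z : Q42 z -> B4 z.
Proof.
apply: (span_sub (salg_submod s t 3)) => _ [_ [a v b /salg23 ha hv /salg23 hb]|a b /salg23 ha /salg23 hb].
  by have := pw_B4 (i := 3) isT hv => ?; inB.
by have := B4_X23 s t => ?; inB.
Qed.

(** The first middle factor is reduced directly and the second one through reversal, until both are
    w_+ or w_-. The element of Q_3 left between them is moved to the far left; its commutator with
    the first of them lies in [Q42], covered by [triple_x]. *)
Lemma triple_Lf w z w' z' w'' : pw 4 w -> pw 4 w' -> pw 4 w'' -> B4 z -> B4 z' ->
  Lf (w * z * w' * z' * w'').
Proof.
move=> hw hw' hw'' hz hz'.
have E3 y : w * y * w' * z' * w'' = w * y * (w' * z' * w'') by rewrite !mulrA.
rewrite E3; move: z hz; apply: (B4_ind H (submod_lr sL _ _)) => [y hy|a u b hu ha hb].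
  by rewrite -E3; apply: triple_x.
have -> : w * (a * u * b) * (w' * z' * w'') = a * (w * u * w' * (b * z') * w'').
  by rewrite !mulrA (w_comm H hw ha) -(mulrA _ b w') -(w_comm H hw' hb) !mulrA.
apply: (Lf_L H); first exact: salg23.
have {hz'} : B4 (b * z') by apply: salgM => //; apply: salg23.
have hu4 := W_B4 hu.
move: (b * z'); apply: (B4_ind H (submod_lr sL _ _)) => [y hy|{}a u' {}b hu' {}ha {}hb].
  have hy4 : B4 y by apply: Q42_B4.
  apply: span_rv => //; apply: triple_x => //; first exact: Q42_rv.
  exact: (salg_rv H).
have ha' := salg_rv H (n := 2) isT ha.
have [ha4 hb4] := (salg23 ha, salg23 hb).
have hu4' := W_B4 hu'.
have -> : w * u * w' * (a * u' * b) * w'' =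
  w * (u * a - a * u) * w' * u' * w'' * b + a * (w * u * w' * u' * w'') * b.
  have e1 : w * u * w' * (a * u' * b) * w'' = w * (u * a) * w' * u' * w'' * b.
    by rewrite !mulrA -(mulrA _ b w'') -(w_comm H hw'' hb) -(mulrA _ w' a) (w_comm H hw' ha) !mulrA.
  have e2 : a * (w * u * w' * u' * w'') * b = w * (a * u) * w' * u' * w'' * b.
    by rewrite !mulrA -(w_comm H hw ha).
  by rewrite e1 e2 mulrBr !mulrBl subrK.
apply: (subD sL); last first.
  by apply: (Lf_R H) => //; apply: (Lf_L H) => //; apply: triple_W.
apply: (Lf_R H) => //; apply: triple_x => //; exact: (W_comm H).
Qed.

(** The exchange turns [em_fe] into the coefficient -q^5 on f', and f' is congruent to q^-8 f, hence
    -q^-3. *)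
Lemma ep_fe : D 2 (t 4 * Wp s t * t 4 * Wp s t * t 4 + (qi * qi * qi) *: Fe s t).
Proof.
have Q := ok_q H.
have h := D_swap (em_fe (ok_swap H)); have h2 := D_swap (fe_swap (ok_swap H)).
move: h h2; rewrite /em -/(Wp s t); move: (t 4 * _ * _ * _ * _) (Fe t s) (Fe s t) => e f' f h h2.
have -> : e + (qi * qi * qi) *: f = (e + (q * q * q * q * q) *: f')
  - (q * q * q * q * q) *: (f' - (qi * qi * qi * qi * (qi * qi * qi * qi)) *: f) by lmod K.
by apply: (subB (sD 2)) => //; apply: (subZ (sD 2)).
Qed.

End Triples.

(** * The relations of Q_5 *)

Section Normalize.
Variables (K : comNzRingType) (A : algType K) (a aV b bV c cV : K) (S T : nat -> A)
  (rv : A -> A).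
Hypothesis aK : a * aV = 1.
Hypothesis bK : b * bV = 1.
Hypothesis cK : c * cV = 1.
Hypothesis ST : forall i, (0 < i < 5)%N -> S i * T i = 1.
Hypothesis TS : forall i, (0 < i < 5)%N -> T i * S i = 1.
Hypothesis far : forall i j, (0 < i)%N -> (i.+1 < j)%N -> (j < 5)%N -> S i * S j = S j * S i.
Hypothesis near : forall i, (0 < i < 4)%N -> S i * S i.+1 * S i = S i.+1 * S i * S i.+1.
Hypothesis cubic : (S 1 - a%:A) * (S 1 - b%:A) * (S 1 - c%:A) = 0.
Hypothesis quad : T 1 * S 2 * S 1 -
  (S 1 * S 2 * T 1 - aV *: (S 1 * S 2) + a *: (S 1 * T 2) + a *: (T 1 * S 2)
   - a ^+ 3 *: (T 1 * T 2) + aV *: (S 2 * S 1) - a *: (S 2 * T 1)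
   - a *: (T 2 * S 1) + a ^+ 3 *: (T 2 * T 1) + a ^+ 2 *: (T 1 * T 2 * S 1)
   - a ^+ 2 *: (S 1 * T 2 * T 1)) = 0.
Hypothesis rvL : forall k x y, rv (k *: x + y) = k *: rv x + rv y.
Hypothesis rvM : forall x y, rv (x * y) = rv y * rv x.
Hypothesis rvS : forall i, (0 < i < 5)%N -> rv (S i) = S i.

Definition ns (i : nat) : A := aV *: S i.
Definition nt (i : nat) : A := a *: T i.
(** After division by a the roots of the cubic are 1, b/a and c/a; p and q are the sum and the
    product of the last two. *)
Definition np : K := aV * (b + c).
Definition nq : K := aV * aV * b * c.
Definition nqi : K := a * a * bV * cV.

Lemma nst i : (0 < i < 5)%N -> ns i * nt i = 1.
Proof.
move=> hi; rewrite /ns /nt scale_mull scale_mulr scalerA mulrC aK scale1r.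
exact: ST.
Qed.
Lemma nts i : (0 < i < 5)%N -> nt i * ns i = 1.
Proof.
by move=> hi; rewrite /ns /nt scale_mull scale_mulr scalerA aK scale1r TS.
Qed.
Lemma nfar i j : (0 < i)%N -> (i.+1 < j)%N -> (j < 5)%N -> ns i * ns j = ns j * ns i.
Proof. by move=> *; rewrite /ns !scale_mull !scale_mulr far. Qed.
Lemma nnear i : (0 < i < 4)%N -> ns i * ns i.+1 * ns i = ns i.+1 * ns i * ns i.+1.
Proof. by move=> hi; rewrite /ns !(scale_mull, scale_mulr) near. Qed.

Definition sq_rel (s t : A) : Prop := s * s = (np + 1) *: s - (np + nq) *: 1 + nq *: t.

Definition cross_rel (s1 t1 s2 t2 : A) : Prop :=
    s1 * s2 * t1 - s1 * t2 * t1 - t1 * s2 * s1 + t1 * t2 * s1 =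
    s1 * s2 - s1 * t2 - s2 * s1 + t2 * s1
      + s2 * t1 - t2 * t1 - t1 * s2 + t1 * t2.

(** The cubic relation times s_1^-1, rescaled by a^-2. *)
Lemma sq1 : sq_rel (ns 1) (nt 1).
Proof.
have E := congr1 (fun x => x * T 1) cubic; move: E.
rewrite mul0r !(mulrBr, mulrBl, scale_mull, scale_mulr, mul1r, mulr1).
have i1 : (0 < 1 < 5)%N by [].
have e x : x * S 1 * T 1 = x by rewrite -mulrA ST // mulr1.
rewrite !e ST // => E; rewrite /sq_rel /ns /nt /np /nq scale_mull scale_mulr.
apply: (eq_from (c := aV * aV) E); move: (S 1) (T 1) (S 1 * S 1) => s t ss.
lmod K.
Qed.

Lemma cross12 : cross_rel (ns 1) (nt 1) (ns 2) (nt 2).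
Proof.
rewrite /cross_rel /ns /nt !(scale_mull, scale_mulr).
apply: (eq_from (c := - aV) quad).
move: (S 1 * S 2 * T 1) (S 1 * T 2 * T 1) (T 1 * S 2 * S 1) (T 1 * T 2 * S 1).
move: (S 1 * S 2) (S 1 * T 2) (S 2 * S 1) (T 2 * S 1) (S 2 * T 1) (T 2 * T 1) (T 1 * S 2) (T 1 * T 2).
move=> *; lmod K.
Qed.

Section Conj.
Variables c1 c2 : A.
Hypothesis c12 : c1 * c2 = 1.
Hypothesis c21 : c2 * c1 = 1.

Lemma conj_t i j : (0 < i < 5)%N -> (0 < j < 5)%N ->
  c1 * ns i = ns j * c1 -> ns j = c1 * ns i * c2 /\ nt j = c1 * nt i * c2.
Proof.
move=> hi hj E; have e1 : ns j = c1 * ns i * c2 by rewrite E -mulrA c12 mulr1.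
split=> //; rewrite -[LHS]mulr1.
have -> : 1 = ns j * (c1 * nt i * c2).
  rewrite e1 !mulrA -(mulrA (c1 * _) c2) c21 mulr1 -(mulrA c1) nst // mulr1.
  by rewrite c12.
by rewrite mulrA nts // mul1r.
Qed.

Lemma conjM x y : c1 * x * c2 * (c1 * y * c2) = c1 * (x * y) * c2.
Proof. by rewrite !mulrA -(mulrA (c1 * x) c2) c21 mulr1. Qed.

Lemma sq_conj s t : sq_rel s t -> sq_rel (c1 * s * c2) (c1 * t * c2).
Proof.
rewrite /sq_rel conjM => ->.
rewrite mulrDr mulrBr !scale_mulr mulrDl mulrBl !scale_mull mulr1 c12 //.
Qed.

Lemma cross_conj s t s' t' : cross_rel s t s' t' ->
  cross_rel (c1 * s * c2) (c1 * t * c2) (c1 * s' * c2) (c1 * t' * c2).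
Proof.
rewrite /cross_rel !conjM => E.
by move: (congr1 (fun x => c1 * x * c2) E); rewrite !(mulrDr, mulrDl, mulrN, mulNr).
Qed.
End Conj.

(** Conjugation by s_1 s_2 s_3 s_4 shifts s_i to s_(i+1). It carries the defining relations, given
    for s_1 and s_2 only, to all the generators. *)
Definition cyc : A := ns 1 * ns 2 * ns 3 * ns 4.
Definition cycV : A := nt 4 * nt 3 * nt 2 * nt 1.

Lemma cycK : cyc * cycV = 1.
Proof.
rewrite /cyc /cycV !mulrA -(mulrA _ (ns 4)) nst // mulr1.
by rewrite -(mulrA _ (ns 3)) nst // mulr1 -(mulrA _ (ns 2)) nst // mulr1 nst.
Qed.
Lemma cycVK : cycV * cyc = 1.
Proof.
rewrite /cyc /cycV !mulrA -(mulrA _ (nt 1)) nts // mulr1.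
by rewrite -(mulrA _ (nt 2)) nts // mulr1 -(mulrA _ (nt 3)) nts // mulr1 nts.
Qed.

Lemma cyc_s i : (0 < i < 4)%N -> cyc * ns i = ns i.+1 * cyc.
Proof.
move=> hi; have h3 : (i = 1 \/ i = 2 \/ i = 3)%N by lia.
rewrite /cyc; case: h3 => [->|[->|->]].
- rewrite -(mulrA _ (ns 4)) -(nfar (i := 1) (j := 4)) // mulrA.
  rewrite -(mulrA _ (ns 3)) -(nfar (i := 1) (j := 3)) // mulrA.
  by rewrite (nnear (i := 1)) // !mulrA.
- rewrite -(mulrA _ (ns 4)) -(nfar (i := 2) (j := 4)) // mulrA.
  rewrite -(mulrA (ns 1)) -(mulrA (ns 1)) (nnear (i := 2)) // !mulrA.
  by rewrite (nfar (i := 1) (j := 3)) // !mulrA.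
- rewrite -!mulrA (mulrA (ns 3)) (nnear (i := 3)) // !mulrA.
  rewrite -(mulrA (ns 1)) (nfar (i := 2) (j := 4)) // !mulrA.
  by rewrite (nfar (i := 1) (j := 4)) // !mulrA.
Qed.

Lemma sq_ns i : (0 < i < 5)%N -> sq_rel (ns i) (nt i).
Proof.
elim: i => // -[|i] IH hi; first exact: sq1.
have hi4 : (0 < i.+1 < 4)%N by lia.
have hi5 : (0 < i.+1 < 5)%N by lia.
have [-> ->] := conj_t cycK cycVK hi5 hi (cyc_s hi4).
by apply: (sq_conj cycK cycVK); apply: IH.
Qed.

Definition cr i j := cross_rel (ns i) (nt i) (ns j) (nt j).

(** [ok] asks for the cross relation in both orders. Conjugation by s_1 s_2 s_1 exchanges s_1 and
    s_2. *)
Lemma cross21 : cr 2 1.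
Proof.
pose g := ns 1 * ns 2 * ns 1; pose gV := nt 1 * nt 2 * nt 1.
have gK : g * gV = 1.
  rewrite /g /gV !mulrA -(mulrA _ (ns 1) (nt 1)) nst // mulr1.
  by rewrite -(mulrA _ (ns 2)) nst // mulr1 nst.
have gVK : gV * g = 1.
  rewrite /g /gV !mulrA -(mulrA _ (nt 1) (ns 1)) nts // mulr1.
  by rewrite -(mulrA _ (nt 2)) nts // mulr1 nts.
have e1 : g * ns 1 = ns 2 * g by rewrite /g (nnear (i := 1)) // -!mulrA (mulrA (ns 1)) (nnear (i := 1)) // !mulrA.
have e2 : g * ns 2 = ns 1 * g by rewrite /g -!mulrA (mulrA (ns 2)) -(nnear (i := 1)) // !mulrA.
have [E1 E2] := conj_t gK gVK (i := 1) (j := 2) isT isT e1.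
have [E3 E4] := conj_t gK gVK (i := 2) (j := 1) isT isT e2.
have := cross_conj gVK cross12; by rewrite -E1 -E2 -E3 -E4.
Qed.

Lemma cr_shift i j : (0 < i < 4)%N -> (0 < j < 4)%N -> cr i j -> cr i.+1 j.+1.
Proof.
move=> hi hj h; have [hi5 hj5] : (0 < i < 5)%N /\ (0 < j < 5)%N by lia.
have [E1 E2] := conj_t cycK cycVK hi5 (j := i.+1) ltac:(lia) (cyc_s hi).
have [E3 E4] := conj_t cycK cycVK hj5 (j := j.+1) ltac:(lia) (cyc_s hj).
by have := cross_conj cycVK h; rewrite -E1 -E2 -E3 -E4.
Qed.

Lemma cross_ns i j : (0 < i < 5)%N -> (0 < j < 5)%N ->
  (j == i.+1) || (i == j.+1) -> cr i j.
Proof.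
move=> hi hj /orP[] /eqP e; subst.
  elim: i hi hj => // -[|i] IH hi hj; first exact: cross12.
  by apply: cr_shift; [lia|lia|apply: IH; lia].
elim: j hi hj => // -[|j] IH hi hj; first exact: cross21.
by apply: cr_shift; [lia|lia|apply: IH; lia].
Qed.

Lemma normalized_ok : ok ns nt np nq nqi rv.
Proof.
split=> //; first by rewrite /nq /nqi; ring: aK bK cK.
- exact: nst.
- exact: nts.
- exact: nfar.
- exact: nnear.
- exact: sq_ns.
- exact: cross_ns.
move=> i hi; have rv0 : rv 0 = 0.
  have := rvL 1 0 0; rewrite !scale1r addr0 => E.
  by apply: (addrI (rv 0)); rewrite addr0 -E.
by have := rvL aV (S i) 0; rewrite rv0 !addr0 rvS.
Qed.

End Normalize.

Section Converse.
Variables (K : comNzRingType) (A : algType K).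

Lemma shift_comm (s : A) (x y : K) :
  (s - x%:A) * (s - y%:A) = (s - y%:A) * (s - x%:A).
Proof.
rewrite !(mulrBl, mulrBr, scale_mull, scale_mulr, mulr1, mul1r).
by move: (s * s) (1 : A) => ss e; lmod K.
Qed.

End Converse.

(* The opposite algebra: MathComp makes [A^c] a ring only. *)
Definition reversed (K : comNzRingType) (A : algType K) : Type := A.

Section Reversed.
Variables (K : comNzRingType) (A : algType K).
Local Notation rA := (reversed A).
HB.instance Definition _ := GRing.Lmodule.copy rA A.

Definition rev_mul (x y : rA) : rA := (y : A) * (x : A).

Fact rev_mulA : associative rev_mul.
Proof. by move=> x y z; rewrite /rev_mul mulrA. Qed.
Fact rev_mul1l : left_id (1 : A) rev_mul.
Proof. by move=> x; rewrite /rev_mul mulr1. Qed.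
Fact rev_mul1r : right_id (1 : A) rev_mul.
Proof. by move=> x; rewrite /rev_mul mul1r. Qed.
Fact rev_mulDl : left_distributive rev_mul +%R.
Proof. by move=> x y z; rewrite /rev_mul mulrDr. Qed.
Fact rev_mulDr : right_distributive rev_mul +%R.
Proof. by move=> x y z; rewrite /rev_mul mulrDl. Qed.
Fact rev_one_neq0 : (1 : A) != 0. Proof. exact: oner_neq0. Qed.

HB.instance Definition _ := GRing.Zmodule_isNzRing.Build rA
  rev_mulA rev_mul1l rev_mul1r rev_mulDl rev_mulDr rev_one_neq0.

Fact rev_scalerAl (c : K) (x y : rA) : c *: rev_mul x y = rev_mul (c *: x) y.
Proof. by rewrite /rev_mul -[RHS]scalerAr. Qed.
HB.instance Definition _ := GRing.Lmodule_isLalgebra.Build K rA rev_scalerAl.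
Fact rev_scalerAr (c : K) (x y : rA) : c *: rev_mul x y = rev_mul x (c *: y).
Proof. by rewrite /rev_mul -[RHS]scalerAl. Qed.
HB.instance Definition _ := GRing.Lalgebra_isAlgebra.Build K rA rev_scalerAr.

End Reversed.

Lemma cubic_defect_converse (A : algType laurent) (s : A) :
  cubic_defect (s : reversed A) = cubic_defect s.
Proof.
transitivity ((s - lc%:A) * ((s - lb%:A) * (s - la%:A))); first exact: erefl.
by rewrite mulrA (shift_comm s lc lb) -mulrA (shift_comm s lc la) mulrA (shift_comm s lb la).
Qed.

(** Reversal interchanges the two sides of the relation, so its ideal is stable. With the cubic,
    this makes the generators of Q_5 a datum in the opposite algebra, whence the anti-automorphism
    [rQ5]. *)
Lemma quad_defect_converse (A : algType laurent) (s1 t1 s2 t2 : A) :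
  quad_defect (s1 : reversed A) (t1 : reversed A) (s2 : reversed A) (t2 : reversed A) = - quad_defect s1 t1 s2 t2.
Proof.
transitivity (s1 * (s2 * t1) -
  (t1 * (s2 * s1) - laV *: (s2 * s1) + la *: (t2 * s1) + la *: (s2 * t1)
   - la ^+ 3 *: (t2 * t1) + laV *: (s1 * s2) - la *: (t1 * s2)
   - la *: (s1 * t2) + la ^+ 3 *: (t1 * t2) + la ^+ 2 *: (s1 * (t2 * t1))
   - la ^+ 2 *: (t1 * (t2 * s1)))); first exact: erefl.
rewrite !mulrA /quad_defect.
move: (s1 * s2 * t1) (s1 * t2 * t1) (t1 * s2 * s1) (t1 * t2 * s1).
move: (s1 * s2) (s1 * t2) (s2 * s1) (t2 * s1) (s2 * t1) (t2 * t1) (t1 * s2) (t1 * t2).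
move: (la ^+ 3) (la ^+ 2) la laV => k3 k2 k kV *.
rewrite ?(opprB, opprD) ?opprK.
lmod laurent.
Qed.

Section Reversal.
Local Notation rQ := (reversed (Q 5)).

Lemma Q_datum_reversed : Q_datum 5 (gen 5 : nat -> rQ) (genV 5 : nat -> rQ).
Proof.
split=> [i _|i j i0 ij j5|i i0 i4|_].
- by rewrite -[_ * _ : rQ]/(genV 5 i * gen 5 i : Q 5)
    -[X in _ /\ X = _]/(gen 5 i * genV 5 i : Q 5) sVK sK.
- exact: (esym (s_far i0 ij j5)).
- rewrite -[LHS]/(gen 5 i * (gen 5 i.+1 * gen 5 i) : Q 5).
  rewrite -[RHS]/(gen 5 i.+1 * (gen 5 i * gen 5 i.+1) : Q 5).
  by rewrite !mulrA; apply: s_near.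
rewrite cubic_defect_converse quad_defect_converse s_cubic // s_quad // oppr0.
by [].
Qed.

Definition rQ5 : Q 5 -> Q 5 := Q_lift (gen 5 : nat -> rQ) (genV 5 : nat -> rQ).

Lemma rQ5L (c : laurent) (x y : Q 5) : rQ5 (c *: x + y) = c *: rQ5 x + rQ5 y.
Proof. exact: (Q_lift_linear Q_datum_reversed). Qed.

Lemma rQ5M (x y : Q 5) : rQ5 (x * y) = rQ5 y * rQ5 x.
Proof. exact: (Q_lift_monoid_morphism Q_datum_reversed).2. Qed.

Lemma rQ5_s i : (0 < i < 5)%N -> rQ5 (gen 5 i) = gen 5 i.
Proof.
by move=> hi; rewrite /rQ5 (Q_lift_toQ Q_datum_reversed) (RB_lift_s Q_datum_reversed).
Qed.

End Reversal.

Definition lbV : laurent := basis int ((0, -1, 0) : monomials).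
Definition lcV : laurent := basis int ((0, 0, -1) : monomials).
Lemma lbK : lb * lbV = 1.
Proof. by rewrite -[LHS]/((lb : grpalg int monomials) * lbV) -basisM. Qed.
Lemma lcK : lc * lcV = 1.
Proof. by rewrite -[LHS]/((lc : grpalg int monomials) * lcV) -basisM. Qed.

Local Notation s' := (ns laV (gen 5)).
Local Notation t' := (nt la (genV 5)).

Lemma Q5_ok : ok s' t' (np laV lb lc) (nq laV lb lc) (nqi la lbV lcV) rQ5.
Proof.
apply: (normalized_ok laK lbK lcK).
- by move=> i _; apply: sK.
- by move=> i _; apply: sVK.
- exact: s_far.
- by move=> i /andP[i0 i4]; apply: (@s_near 5 i i0 i4).
- by apply: s_cubic.
- by apply: s_quad.
- exact: rQ5L.
- exact: rQ5M.
- exact: rQ5_s.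
Qed.

Local Notation B4 := (salg s' t' 3).
Local Notation DQ := (D s' t').

Lemma gen_s i : gen 5 i = la *: s' i.
Proof. by rewrite /ns scalerA laK scale1r. Qed.
Lemma genV_t i : genV 5 i = laV *: t' i.
Proof. by rewrite /nt scalerA mulrC laK scale1r. Qed.

Lemma Q_incl_t i : (0 < i < 4)%N -> Q_incl (genV 4 i) = genV 5 i.
Proof.
by move=> hi; rewrite /Q_incl (Q_lift_toQ (Q_incl_datum 4)) (RB_lift_t (Q_incl_datum 4)).
Qed.

Lemma epsilon_t i : (0 < i < 4)%N -> epsilon (genV 4 i) = laV.
Proof.
by move=> hi; rewrite /epsilon (Q_lift_toQ (Q_datum_augmentation 4))
  (RB_lift_t (Q_datum_augmentation 4)).
Qed.

Lemma Q_ind n (P : Q n -> Prop) : P 1 ->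
  (forall c x y, P x -> P y -> P (c *: x + y)) ->
  (forall i x, (0 < i < n)%N -> P x -> P (gen n i * x)) ->
  (forall i x, (0 < i < n)%N -> P x -> P (genV n i * x)) ->
  forall x, P x.
Proof.
move=> P1 PL Ps Pt x; rewrite -[x]ofQK.
have P0 : P 0 by rewrite -[0](addNr (1 : Q n)) -scaleN1r; apply: PL.
elim/grpalg_ind: (ofQ x) => [|y z IHy IHz|c y IH|g].
- by rewrite toQ0.
- by rewrite toQD -[toQ y]scale1r; apply: PL.
- by rewrite toQZ -[_ *: _]addr0; apply: PL.
rewrite -[g]braid_ofK; elim: (repr g) => [|[i e] u IH].
  exact: P1.
have -> : braid_of ((i, e) :: u) = (braid_of [:: (i, e)] * braid_of u)%g.
  by rewrite -[RHS]/(braid_mul _ _) braid_mulE.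
have hi : (0 < i.+1 < n)%N by have := ltn_ord i; lia.
rewrite basisM toQM; case: e.
  by rewrite -sigmaE; apply: (Ps i.+1).
by rewrite -sigmaVE; apply: (Pt i.+1).
Qed.

Lemma Q_incl_B4 (x : Q 4) : B4 (Q_incl x).
Proof.
elim/Q_ind: x => [|c x y hx hy|i x hi hx|i x hi hx].
- by rewrite rmorph1; apply: Salg1.
- by rewrite linearP; apply: SalgL.
- rewrite rmorphM /= Q_incl_s // gen_s scale_mull.
  by apply: (subZ (salg_submod _ _ _)); apply: salgM => //; apply: salg_s.
- rewrite rmorphM /= Q_incl_t // genV_t scale_mull.
  by apply: (subZ (salg_submod _ _ _)); apply: salgM => //; apply: salg_t.
Qed.

Lemma B4_Q_incl z : B4 z -> exists x : Q 4, z = Q_incl x.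
Proof.
elim=> [|i y hi _ [x ->]|i y hi _ [x ->]|c y z' _ [x ->] _ [x' ->]].
- by exists 1; rewrite rmorph1.
- exists (x * (laV *: gen 4 i)).
  by rewrite rmorphM /= linearZ /= Q_incl_s.
- exists (x * (la *: genV 4 i)).
  by rewrite rmorphM /= linearZ /= Q_incl_t.
- by exists (c *: x + x'); rewrite linearP.
Qed.

Lemma u4P z : u4 z <-> span (pw s' t' 4) z.
Proof.
split=> [[r0 [r1 [r2 ->]]]|].
  have sP := span_submod (pw s' t' 4).
  rewrite gen_s genV_t; apply: (subD sP); first apply: (subD sP).
  - by apply: (subZ sP); apply: mem_span; apply: Or31.
  - by do 2 apply: (subZ sP); apply: mem_span; apply: Or32.
  - by do 2 apply: (subZ sP); apply: mem_span; apply: Or33.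
elim=> [|c x y hx _ [r0 [r1 [r2 ->]]]].
  by exists 0, 0, 0; rewrite !scale0r !addr0.
case: hx => ->.
- by exists (c + r0), r1, r2; rewrite scalerDl !addrA.
- exists r0, (c * laV + r1), r2; rewrite scalerDl -scalerA -/(s' 4).
  by rewrite !addrA (addrC (r0%:A)).
- exists r0, r1, (c * la + r2); rewrite scalerDl -scalerA -/(t' 4).
  by rewrite addrC -!addrA (addrC (_ *: genV 5 4)).
Qed.

Local Notation sDQ k := (@D_submod _ _ s' t' k).

(** * The filtration of Q_5 *)

Lemma Q5_products0 z : Q5_products 0 z <-> exists q, z = Q_incl q.
Proof.
split=> [[q0 [u [q [_ ->]]]]|[q ->]]; first by exists q0; rewrite big_ord0 mulr1.
by exists q, (fun=> 0), (fun=> 0); split=> [[]|] //; rewrite big_ord0 mulr1.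
Qed.

Lemma Q5_productsS k z : Q5_products k.+1 z <->
  exists y u q, [/\ Q5_products k y, u4 u & z = y * u * Q_incl q].
Proof.
split=> [[q0 [u [q [hu ->]]]]|[y [u [q [[q0 [v [r [hv ->]]]] hu ->]]]]].
  exists (Q_incl q0 * \prod_(i < k) (u (widen_ord (leqnSn k) i) * Q_incl (q (widen_ord (leqnSn k) i)))).
  exists (u ord_max), (q ord_max); split=> //; last by rewrite big_ord_recr /= !mulrA.
  by exists q0, (fun i => u (widen_ord (leqnSn k) i)), (fun i => q (widen_ord (leqnSn k) i)).
exists q0, (fun i => if unlift ord_max i is Some j then v j else u).
exists (fun i => if unlift ord_max i is Some j then r j else q).
split=> [i|]; first by case: unliftP => [j _|_].
rewrite big_ord_recr /= unlift_none !mulrA; congr (_ * _ * _ * _).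
apply: eq_bigr => i _; have -> : widen_ord (leqnSn k) i = lift ord_max i.
  by apply: val_inj; rewrite /= /bump leqNgt ltn_ord.
by rewrite liftK.
Qed.

Lemma Q5_productsMr k z q : Q5_products k z -> Q5_products k (z * Q_incl q).
Proof.
case: k => [/Q5_products0 [r ->]|k /Q5_productsS [y [u [r [hy hu ->]]]]].
  by apply/Q5_products0; exists (r * q); rewrite rmorphM.
by apply/Q5_productsS; exists y, u, (r * q); split=> //; rewrite rmorphM !mulrA.
Qed.

Lemma Q5_productsM j k x y :
  Q5_products j x -> Q5_products k y -> Q5_products (j + k) (x * y).
Proof.
move=> hx; elim: k y => [|k IH] y.
  by move=> /Q5_products0 [q ->]; rewrite addn0; apply: Q5_productsMr.
move=> /Q5_productsS [z [u [q [hz hu ->]]]]; rewrite addnS; apply/Q5_productsS.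
by exists (x * z), u, q; split=> //; [apply: IH|rewrite !mulrA].
Qed.

Lemma u4_1 : u4 1.
Proof. by exists 1, 0, 0; rewrite !scale0r scale1r !addr0. Qed.

Lemma Q5_productsW j k z : (j <= k)%N -> Q5_products j z -> Q5_products k z.
Proof.
move=> /subnKC <-; elim: (k - j)%N => [|d IH] hz; first by rewrite addn0.
rewrite addnS; apply/Q5_productsS; exists z, 1, 1; split; [exact: IH|exact: u4_1|].
by rewrite rmorph1 !mulr1.
Qed.

Lemma Rspan_span (S : set (Q 5)) z : Rspan S z <-> span S z.
Proof.
have sP := span_submod S; split=> [[m [r [v [hv ->]]]]|].
  apply: (big_ind (span S)) => [|x y|i _]; first exact: (sub0 sP).
    exact: (subD sP).
  by apply: (subZ sP); apply: mem_span.
elim=> [|c x y hx _ [m [r [v [hv ->]]]]].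
  by exists 0, (fun=> 0), (fun=> 0); split=> [[]|] //; rewrite big_ord0.
exists m.+1, (fun i => if unlift ord0 i is Some j then r j else c).
exists (fun i => if unlift ord0 i is Some j then v j else x).
split=> [i|]; first by case: unliftP => [j _|_].
by rewrite big_ord_recl unlift_none; congr (_ + _); apply: eq_bigr => i _; rewrite liftK.
Qed.

Lemma Q5_submod k : submod (Q5 k).
Proof.
have sP := span_submod (Q5_products k).
split=> [|c x y /Rspan_span hx /Rspan_span hy]; apply/Rspan_span; first exact: (sub0 sP).
exact: sP.2.
Qed.

Lemma Q5_gen k z : Q5_products k z -> Q5 k z.
Proof. by move=> hz; apply/Rspan_span; apply: mem_span. Qed.

Lemma Q5M j k x y : Q5 j x -> Q5 k y -> Q5 (j + k) (x * y).
Proof.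
have sP := Q5_submod (j + k); move=> /Rspan_span hx /Rspan_span hy.
rewrite -[x]mul1r; move: x hx; apply: (span_sub (submod_lr sP _ _)) => x hx.
rewrite mul1r -[x * y]mulr1; move: y hy; apply: (span_sub (submod_lr sP _ _)) => y hy.
by rewrite mulr1; apply/Q5_gen/Q5_productsM.
Qed.

(** With [Q5_D], this identifies Q_5^(k) with the elements of degree at most k, where products of
    any shape are allowed. Monotonicity in k holds on the side of Q_5 because 1 lies in u_4. *)
Lemma D_Q5 k z : DQ k z -> Q5 k z.
Proof.
elim=> {k z} [x /B4_Q_incl [q ->]|||j k x y _ hx _ hy|k c x y _ hx _ hy|j k x _ hx jk].
- by apply/Q5_gen/Q5_products0; exists q.
- apply/Q5_gen/Q5_productsS; exists 1, (s' 4), 1; split.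
  + by apply/Q5_products0; exists 1; rewrite rmorph1.
  + by apply/u4P; apply: mem_span; apply: Or32.
  + by rewrite rmorph1 mulr1 mul1r.
- apply/Q5_gen/Q5_productsS; exists 1, (t' 4), 1; split.
  + by apply/Q5_products0; exists 1; rewrite rmorph1.
  + by apply/u4P; apply: mem_span; apply: Or33.
  + by rewrite rmorph1 mulr1 mul1r.
- exact: Q5M.
- exact: (Q5_submod k).2.
- move: hx => /Rspan_span; apply: (span_sub (Q5_submod k)) => y hy.
  exact/Q5_gen/(Q5_productsW jk).
Qed.

Lemma Q5_D k z : Q5 k z -> DQ k z.
Proof.
move=> /Rspan_span; move: z; apply: (span_sub (sDQ k)); elim: k => [|k IH] z.
  by move=> /Q5_products0 [q ->]; apply: DB; apply: Q_incl_B4.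
move=> /Q5_productsS [y [u [q [/IH hy /u4P hu ->]]]].
move: u hu; apply: (span_sub (submod_lr (sDQ k.+1) _ _)) => u /pw4_D1 hu.
have := DM (DM hy hu) (DB (Q_incl_B4 q)).
by rewrite addn0 addn1.
Qed.

Lemma D3_Lf z : DQ 3 z -> Lf s' t' z.
Proof.
have H := Q5_ok; have sL := sLf s' t'.
move=> /D_Q5 /Rspan_span; move: z; apply: (span_sub sL) => z.
move=> /Q5_productsS [z2 [u3 [q3 [h2 /u4P hu3 ->]]]].
case/Q5_productsS: h2 => z1 [u2 [q2 [h1 /u4P hu2 ->]]].
case/Q5_productsS: h1 => z0 [u1 [q1 [/Q5_products0 [q0 ->] /u4P hu1 ->]]].
move: (Q_incl_B4 q0) (Q_incl_B4 q1) (Q_incl_B4 q2) (Q_incl_B4 q3).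
move: (Q_incl q0) (Q_incl q1) (Q_incl q2) (Q_incl q3) => a0 a1 a2 a3 b0 b1 b2 b3.
have -> : a0 * u1 * a1 * u2 * a2 * u3 * a3 = a0 * u1 * (a1 * u2 * a2 * u3 * a3).
  by rewrite !mulrA.
move: u1 hu1; apply: (span_sub (submod_lr sL _ _)) => u1 hu1.
have -> : a0 * u1 * (a1 * u2 * a2 * u3 * a3) = a0 * u1 * a1 * u2 * (a2 * u3 * a3).
  by rewrite !mulrA.
move: u2 hu2; apply: (span_sub (submod_lr sL _ _)) => u2 hu2.
rewrite !mulrA; move: u3 hu3; apply: (span_sub (submod_lr sL _ _)) => u3 hu3.
have -> : a0 * u1 * a1 * u2 * a2 * u3 * a3 = a0 * (u1 * a1 * u2 * a2 * u3) * a3.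
  by rewrite !mulrA.
by apply: (Lf_R H) => //; apply: (Lf_L H) => //; apply: (triple_Lf H).
Qed.

(** The coefficient k must be a unit with inverse l: only then do e and f span the same line modulo
    Q_5^(2). *)
Definition spans_line (e : Q 5) : Prop :=
  exists k l : laurent, k * l = 1 /\ DQ 2 (e - k *: Fe s' t').

Lemma D3_fe : DQ 3 (Fe s' t').
Proof. by rewrite /Fe /Ve /Xe; deg. Qed.

Lemma add_lineE e : spans_line e -> Q5 3 = add_line (Q5 2) e.
Proof.
move=> [k [l [kl he]]]; apply/seteqP; split=> z.
  move=> /Q5_D /D3_Lf [m hm]; exists (z - (m * l) *: e); last first.
    by exists (m * l) => //; rewrite subrK.
  apply: D_Q5; have -> : z - (m * l) *: e =
      (z - m *: Fe s' t') - (m * l) *: (e - k *: Fe s' t').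
    move: kl hm he; move: (Fe s' t') => f kl hm he.
    by rewrite scalerBr scalerA -mulrA (mulrC l) kl mulr1 opprB addrA subrK.
  by apply: (subB (sDQ 2)) => //; apply: (subZ (sDQ 2)).
move=> [y /Q5_D hy [r _ <-]]; apply: D_Q5.
have W x : DQ 2 x -> DQ 3 x by move=> hx; exact: (DW hx).
apply: (subD (sDQ 3)); first exact: W.
apply: (subZ (sDQ 3)); apply: (sub_mod (sDQ 3) (W _ he)).
by apply: (subZ (sDQ 3)); apply: D3_fe.
Qed.

(** The normalised generators fix f, so the original ones, a times larger, act by a, which is the
    value of epsilon on them. *)
Lemma fe_lam (lam : Q 4) :
  DQ 2 (Q_incl lam * Fe s' t' - epsilon lam *: Fe s' t') /\
  DQ 2 (Fe s' t' * Q_incl lam - epsilon lam *: Fe s' t').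
Proof.
have H := Q5_ok.
have := (fe_Ls H, fe_Rs H, fe_Lt H, fe_Rt H).
move: (Fe s' t') => f [[[Ls Rs] Lt] Rt].
have stepL (x b : Q 5) (m c : laurent) : B4 b -> DQ 2 (b * f - c *: f) ->
    DQ 2 (x * f - m *: f) -> DQ 2 (b * x * f - (c * m) *: f).
  move=> hb h hx.
  have -> : b * x * f - (c * m) *: f = b * (x * f - m *: f) + m *: (b * f - c *: f).
    by rewrite mulrBr scale_mulr mulrA scalerBr scalerA (mulrC m) addrA subrK.
  apply: (subD (sDQ 2)); last exact: (subZ (sDQ 2)).
  by move: hx; move: (x * f - _) => y hy; deg.
have stepR (x b : Q 5) (m c : laurent) : B4 x -> DQ 2 (f * b - c *: f) ->
    DQ 2 (f * x - m *: f) -> DQ 2 (f * (b * x) - (c * m) *: f).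
  move=> hb h hx.
  have -> : f * (b * x) - (c * m) *: f = (f * b - c *: f) * x + c *: (f * x - m *: f).
    by rewrite mulrBl scale_mull mulrA scalerBr scalerA addrA subrK.
  apply: (subD (sDQ 2)); last exact: (subZ (sDQ 2)).
  by move: h; move: (f * b - _) => y hy; deg.
elim/Q_ind: lam => [|c x y [hx hx'] [hy hy']|i x hi [hx hx']|i x hi [hx hx']].
- by rewrite !rmorph1 mul1r mulr1 scale1r subrr; split; apply: (sub0 (sDQ 2)).
- rewrite !linearP /=; split.
    have -> : (c *: Q_incl x + Q_incl y) * f - (c *: epsilon x + epsilon y) *: f =
       c *: (Q_incl x * f - epsilon x *: f) + (Q_incl y * f - epsilon y *: f).
      by rewrite mulrDl scale_mull scalerDl scalerBr scalerA opprD addrACA.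
    exact: (sDQ 2).2.
  have -> : f * (c *: Q_incl x + Q_incl y) - (c *: epsilon x + epsilon y) *: f =
     c *: (f * Q_incl x - epsilon x *: f) + (f * Q_incl y - epsilon y *: f).
    by rewrite mulrDr scale_mulr scalerDl scalerBr scalerA opprD addrACA.
  exact: (sDQ 2).2.
- rewrite !rmorphM /= Q_incl_s // epsilon_s // gen_s; split.
    apply: stepL => //.
      by apply: (subZ (salg_submod _ _ _)); apply: salg_s.
    by rewrite scale_mull -scalerBr; apply: (subZ (sDQ 2)); apply: Ls.
  apply: stepR => //; first exact: Q_incl_B4.
  by rewrite scale_mulr -scalerBr; apply: (subZ (sDQ 2)); apply: Rs.
- rewrite !rmorphM /= Q_incl_t // epsilon_t // genV_t; split.
    apply: stepL => //.
      by apply: (subZ (salg_submod _ _ _)); apply: salg_t.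
    by rewrite scale_mull -scalerBr; apply: (subZ (sDQ 2)); apply: Lt.
  apply: stepR => //; first exact: Q_incl_B4.
  by rewrite scale_mulr -scalerBr; apply: (subZ (sDQ 2)); apply: Rt.
Qed.

Lemma line_lam e (lam : Q 4) : spans_line e ->
  DQ 2 (Q_incl lam * e - epsilon lam *: e) /\ DQ 2 (e * Q_incl lam - epsilon lam *: e).
Proof.
move=> [k [_ [_ he]]]; have [hL hR] := fe_lam lam; have hQ := Q_incl_B4 lam.
move: he hL hR hQ; move: (Fe s' t') (Q_incl lam) (epsilon lam : laurent) => f x m he hL hR hx.
split.
  have -> : x * e - m *: e = x * (e - k *: f) + k *: (x * f - m *: f) - m *: (e - k *: f).
    by rewrite mulrBr scale_mulr; move: (x * e) (x * f) => *; lmod laurent.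
  apply: (subB (sDQ 2)); last exact: (subZ (sDQ 2)).
  apply: (subD (sDQ 2)); last exact: (subZ (sDQ 2)).
  by move: he; move: (e - _) => y he; deg.
have -> : e * x - m *: e = (e - k *: f) * x + k *: (f * x - m *: f) - m *: (e - k *: f).
  by rewrite mulrBl scale_mull; move: (e * x) (f * x) => *; lmod laurent.
apply: (subB (sDQ 2)); last exact: (subZ (sDQ 2)).
apply: (subD (sDQ 2)); last exact: (subZ (sDQ 2)).
by move: he; move: (e - _) => y he; deg.
Qed.

Lemma x_eltE : Q_incl x_elt = la *: Xe s' t' 2 3.
Proof.
rewrite /x_elt !rmorphM /= !Q_incl_s // !Q_incl_t // !gen_s !genV_t; move: s' t' => s t.
rewrite !(scale_mull, scale_mulr) !scalerA; congr (_ *: _);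
  have := laK; move: la laV => u v E; ring: E.
Qed.

Lemma y_eltE : Q_incl y_elt = la *: Xe s' t' 2 1.
Proof.
rewrite /y_elt !rmorphM /= !Q_incl_s // !Q_incl_t // !gen_s !genV_t; move: s' t' => s t.
rewrite !(scale_mull, scale_mulr) !scalerA; congr (_ *: _);
  have := laK; move: la laV => u v E; ring: E.
Qed.

Lemma w_plusE : Q_incl w_plus = (la ^+ 3) *: Wp s' t'.
Proof.
rewrite /w_plus !rmorphM /= !Q_incl_s // !Q_incl_t // !gen_s !genV_t; move: s' t' => s t.
rewrite !(scale_mull, scale_mulr) !scalerA /Wp /Xe !mulrA; congr (_ *: _);
  have := laK; move: la laV => u v E; ring: E.
Qed.

Lemma w_minusE : Q_incl w_minus = (laV ^+ 3) *: Wm s' t'.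
Proof.
rewrite /w_minus !rmorphM /= !Q_incl_s // !Q_incl_t // !gen_s !genV_t; move: s' t' => s t.
rewrite !(scale_mull, scale_mulr) !scalerA /Wm /Ye !mulrA; congr (_ *: _);
  have := laK; move: la laV => u v E; ring: E.
Qed.

Lemma spans_lineZ c d e : c * d = 1 -> spans_line e -> spans_line (c *: e).
Proof.
move=> cd [k [l [kl he]]]; exists (c * k), (d * l); split.
  by rewrite mulrACA cd kl mulr1.
by rewrite -scalerA -scalerBr; apply: (subZ (sDQ 2)).
Qed.

Lemma line_xyx : spans_line (gen 5 4 * Q_incl x_elt * Q_incl y_elt * gen 5 4 * Q_incl x_elt * gen 5 4).
Proof.
have H := Q5_ok.
(* The power of a is the exponent sum of the word: three letters s_4, two x and one y, each of
   exponent sum one. *)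
have -> : gen 5 4 * Q_incl x_elt * Q_incl y_elt * gen 5 4 * Q_incl x_elt * gen 5 4 =
    (la ^+ 6) *: Fe s' t'.
  rewrite x_eltE y_eltE gen_s; move: s' t' H => s t H; rewrite !(scale_mull, scale_mulr) !scalerA; congr (_ *: _).
    by ring.
  by rewrite /Fe /Ve /Xe; braid.
apply: (@spans_lineZ _ (laV ^+ 6)); first by rewrite -exprMn laK expr1n.
by exists 1, 1; rewrite mulr1 scale1r subrr; split=> //; apply: (sub0 (sDQ 2)).
Qed.

Lemma line_em : spans_line (gen 5 4 * Q_incl w_minus * gen 5 4 * Q_incl w_minus * gen 5 4).
Proof.
have H := Q5_ok; have Q := ok_q H.
have -> : gen 5 4 * Q_incl w_minus * gen 5 4 * Q_incl w_minus * gen 5 4 =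
    (laV ^+ 3) *: em s' t'.
  rewrite w_minusE gen_s; move: s' t' {H Q} => s t; rewrite !(scale_mull, scale_mulr) !scalerA /em; congr (_ *: _);
  have := laK; move: la laV => u v E; ring: E.
apply: (@spans_lineZ _ (la ^+ 3)); first by rewrite -exprMn mulrC laK expr1n.
have := em_fe H; move: (nq _ _ _) (nqi _ _ _) Q => q qi Q h.
exists (- (qi * qi * qi * qi * qi)), (- (q * q * q * q * q)); split; first by ring: Q.
by rewrite scaleNr opprK.
Qed.

Lemma line_ep : spans_line (genV 5 4 * Q_incl w_plus * genV 5 4 * Q_incl w_plus * genV 5 4).
Proof.
have H := Q5_ok; have Q := ok_q H.
have -> : genV 5 4 * Q_incl w_plus * genV 5 4 * Q_incl w_plus * genV 5 4 =
    (la ^+ 3) *: (t' 4 * Wp s' t' * t' 4 * Wp s' t' * t' 4).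
  rewrite w_plusE genV_t; move: s' t' {H Q} => s t; rewrite !(scale_mull, scale_mulr) !scalerA; congr (_ *: _);
  have := laK; move: la laV => u v E; ring: E.
apply: (@spans_lineZ _ (laV ^+ 3)); first by rewrite -exprMn laK expr1n.
have := ep_fe H; move: (nq _ _ _) (nqi _ _ _) Q => q qi Q h.
exists (- (qi * qi * qi)), (- (q * q * q)); split; first by ring: Q.
by rewrite scaleNr opprK.
Qed.

Theorem proposition5p6 :
  let s4 : Q 5 := gen 5 4 in
  let s4V : Q 5 := genV 5 4 in
  let x : Q 5 := Q_incl x_elt in
  let y : Q 5 := Q_incl y_elt in
  let wp : Q 5 := Q_incl w_plus in
  let wm : Q 5 := Q_incl w_minus in
  let em : Q 5 := s4 * wm * s4 * wm * s4 in
  let ep : Q 5 := s4V * wp * s4V * wp * s4V in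
  [/\ Q5 3 = add_line (Q5 2) (s4 * x * y * s4 * x * s4),
      Q5 3 = add_line (Q5 2) em /\ add_line (Q5 2) em = add_line (Q5 2) ep
    & forall lam : Q 4,
        [/\ eq_modulo (Q5 2) (Q_incl lam * em) (em * Q_incl lam),
            eq_modulo (Q5 2) (em * Q_incl lam) (epsilon lam *: em),
            eq_modulo (Q5 2) (Q_incl lam * ep) (ep * Q_incl lam)
          & eq_modulo (Q5 2) (ep * Q_incl lam) (epsilon lam *: ep)]].
Proof.
move=> s4 s4V x y wp wm em ep; split.
- exact/add_lineE/line_xyx.
- by rewrite -!add_lineE; [split|exact: line_ep|exact: line_em].
move=> lam; have [mL mR] := line_lam lam line_em; have [pL pR] := line_lam lam line_ep.
split; apply: D_Q5 => //.
  by apply: (sub_modt (sDQ 2) mL); apply: (sub_mods (sDQ 2)).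
by apply: (sub_modt (sDQ 2) pL); apply: (sub_mods (sDQ 2)).
Qed.
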